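(* Let $k\ge 1$ be an integer. Given a finite set of points $S$ on the sphere and a pseudohemisphere arrangement $\mathcal H$, one can color $S$ with $k$ colors such that any pseudohemisphere in $\mathcal H$ that contains at least $4k-3$ points of $S$ contains points of all $k$ colors. Equivalently, the vertices $S$ of any finite pseudohemisphere-hypergraph can be colored with $k$ colors such that any hyperedge containing at least $4k-3$ vertices contains vertices of all $k$ colors.
   Context: A pseudohemisphere arrangement is a finite collection of regions (pseudohemispheres) on the sphere, each being a side of a simple closed curve that is centrally symmetric (invariant under the antipodal map), such that any two of the boundary curves intersect exactly twice. A hypergraph $\mathcal F$ with an ordered vertex set is ABA-free if it does not contain two hyperedges $A$ and $B$ for which there are three vertices $x<y<z$ such that $x,z\in A\setminus B$ and $y\in B\setminus A$. For a hypergraph $\mathcal F$ on $S$, write $\bar F=S\setminus F$; $\Delta$ denotes symmetric difference. A pseudohemisphere-hypergraph is a hypergraph $\mathcal H$ on an ordered set of vertices $S$ such that there exist a set $X\subset S$ and an ABA-free hypergraph $\mathcal F$ on $S$ such that the hyperedges of $\mathcal H$ form a subset of $\{F\Delta X,\ \bar F\Delta X\mid F\in\mathcal F\}$. *)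

(* Defs.v *)
From HB Require Import structures.
From mathcomp Require Import all_boot all_order all_algebra.
From mathcomp Require Import all_classical all_reals all_analysis.
Import Order.TTheory GRing.Theory Num.Theory.
Import numFieldNormedType.Exports.

Set Implicit Arguments.
Unset Strict Implicit.
Unset Printing Implicit Defensive.

Local Open Scope ring_scope.
Local Open Scope classical_set_scope.

Section Geometric.
Variable R : realType.

(* The norm of 'rV[R]_3 in the library is the sup norm, so the Euclidean sphere
   is given by its equation; the topology is the usual one. *)
Definition sphere : set 'rV[R]_3 :=
  [set x : 'rV[R]_3 | \sum_(i < 3) x ord0 i ^+ 2 = 1].

Definition simple_closed_curve (C : set 'rV[R]_3) : Prop :=
  exists f : R -> 'rV[R]_3,
    [/\ {within `[0, 1], continuous f},
        f 0 = f 1,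
        (forall s t, 0 <= s < 1 -> 0 <= t < 1 -> f s = f t -> s = t) &
        C = f @` `[0, 1]].

Definition centrally_symmetric (C : set 'rV[R]_3) : Prop :=
  forall x, C x -> C (- x).

(* Sides are open: they are the components of the complement of the curve. *)
Definition side (C H : set 'rV[R]_3) : Prop :=
  exists2 x, (sphere `\` C) x & H = connected_component (sphere `\` C) x.

(* The two sides of one curve may both occur in an arrangement, so only
   distinct boundary curves are required to meet exactly twice. *)
Definition pseudohemisphere_arrangement (HH : set (set 'rV[R]_3)) : Prop :=
  finite_set HH /\
  exists bd : set 'rV[R]_3 -> set 'rV[R]_3,
    (forall H, HH H ->
      [/\ bd H `<=` sphere, simple_closed_curve (bd H),
          centrally_symmetric (bd H) & side (bd H) H]) /\
    (forall H1 H2, HH H1 -> HH H2 -> bd H1 <> bd H2 ->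
      exists p q, p <> q /\ bd H1 `&` bd H2 = [set p; q]).

End Geometric.

Section Combinatorial.
Context {d : Order.disp_t} {V : finOrderType d}.

Definition ABA_free (F : {set {set V}}) : Prop :=
  ~ exists A B : {set V}, [/\ A \in F, B \in F &
      exists x y z : V,
        [/\ (x < y)%O, (y < z)%O, x \in A :\: B, z \in A :\: B
          & y \in B :\: A]].

Definition symdiff (A B : {set V}) : {set V} := (A :\: B) :|: (B :\: A).

Definition pseudohemisphere_hypergraph (E : {set {set V}}) : Prop :=
  exists (X : {set V}) (F : {set {set V}}), ABA_free F /\
    E \subset [set symdiff A X | A in F] :|: [set symdiff (~: A) X | A in F].

End Combinatorial.

(* Main.v *)
Require Import Defs.
From HB Require Import structures.
From mathcomp Require Import all_boot all_order all_algebra.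
From mathcomp Require Import finmap.
From mathcomp Require Import all_classical all_reals all_analysis.
From mathcomp Require Import zify ring lra.
Import Order.TTheory GRing.Theory Num.Theory.
Import numFieldNormedType.Exports.

Set Implicit Arguments.
Unset Strict Implicit.
Unset Printing Implicit Defensive.

(** Both halves of the statement rest on one theorem about ABA-free families, [polychromatic]: if
    F is ABA-free on U, then U has a k-colouring for which every member of F and every complement
    of a member shows all colours as soon as it has 2k-1 points in U. In a
    pseudohemisphere-hypergraph, X and its complement are coloured separately: on each of these two
    parts every hyperedge is a member of F or a complement of one, and 4k-3 vertices include 2k-1
    in one of the parts.

    The theorem is proved by splitting off one colour class at a time. Every nonempty trace of a
    member of F or of a complement contains a point of the upper or lower hull ([extreme_hit]).
    Take a minimal set R of hull points that meets all the inclusion-minimal traces with at least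
    2k-1 points. If such a trace M contained three points of R, let m be the middle one along the
    hull; by minimality of R some minimal trace contains m but not the other two, and it would be
    included in M ([middle]). So R meets each minimal trace in one or two points
    ([shallow_hitting]), it can receive a colour of its own, and 2k-3 points are left.

    On the sphere, two facts about a centrally symmetric simple closed curve C are needed. First,
    C separates antipodal points ([antipodal_separation]): if a path d led from y to -y off C,
    consider the angle swept by its projection along c(s), where c runs in C from a point p to -p.
    It is an odd multiple of pi, it depends continuously on s, and it changes sign between s = 0
    and s = 1. Second, the boundary of each component H of the complement is all of C
    ([comp_boundary]): otherwise it lies in an arc, the closure of H retracts to this arc by
    Tietze's theorem, and using this retraction on H, its antipodal conjugate on -H and the
    identity elsewhere gives an odd map of the sphere that misses two antipodal points, against
    the Borsuk-Ulam theorem, which has the same proof as the first fact. If another curve of the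
    arrangement crosses C, it follows that C has exactly two sides, which are antipodal
    ([side_oriented]).

    Choose a curve X of the arrangement and a generic point o on it, and consider the points of S
    on one side of X or on one of the open arcs of X from o to -o; the remaining points are treated
    symmetrically. Orient the other curves so that o is on the negative side, and order them by
    their crossing points with the arc, ties being broken by height ([prec]). The key claim
    ([no_alternation]) is that for curves A, B, C in this order there cannot be both a point above
    A, below B and above C and a point below A, above B and below C. Indeed the signs along the
    three curves show that one of the two regions has a finite frontier, whereas a nonempty open
    subset of the sphere that is disjoint from its antipode has an infinite one
    ([infinite_frontier]). Hence the sets of curves below the points of S form an ABA-free family,
    and then the sets of points above the curves are ABA-free for the lexicographic order of the
    points ([polychromatic_lines]). If the whole arrangement has only one boundary curve, its
    members are pairwise disjoint and the same criterion applies trivially. *)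

(** * ABA-free families *)

Section ABA.
(* names such as setCK refer to finite sets in this section *)
Import mathcomp.boot.finset.
Variable V : finType.

(** Strict linear orders, as relations, so that one finite type can carry several
    of them and each of them can be reversed. *)
Definition strict_total (lt : rel V) : Prop :=
  [/\ irreflexive lt, transitive lt & forall x y, x != y -> lt x y || lt y x].

Definition rev_rel (lt : rel V) : rel V := fun x y => lt y x.

Lemma strict_total_rev lt : strict_total lt -> strict_total (rev_rel lt).
Proof.
case=> irr tr tot; split=> [x|y x z xy yz|x y xy]; first exact: irr.
- exact: tr yz xy.
- by rewrite /rev_rel orbC tot.
Qed.

(** The traces on U of the members of F form an ABA-free family for lt. *)
Definition ABA_on (lt : rel V) (U : {set V}) (F : {set {set V}}) : Prop :=
  forall A B x y z, A \in F -> B \in F -> x \in U -> y \in U -> z \in U ->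
    lt x y -> lt y z -> x \in A -> x \notin B -> z \in A -> z \notin B ->
    y \in B -> y \notin A -> False.

Lemma ABA_on_rev lt U F : ABA_on lt U F -> ABA_on (rev_rel lt) U F.
Proof.
move=> ab A B x y z AF BF xU yU zU xy yz xA xB zA zB yB yA.
exact: (ab A B z y x).
Qed.

(** The family of complements; together with F it forms the abstract
    pseudohalfplanes [halfplanes F] below. *)
Definition compl_family (F : {set {set V}}) := [set ~: A | A in F].

Lemma compl_familyK F : compl_family (compl_family F) = F.
Proof.
apply/setP => A; apply/imsetP/idP => [[B /imsetP[C CF ->] ->]|AF].
  by rewrite setCK.
by exists (~: A); rewrite ?setCK//; apply: imset_f.
Qed.

Lemma mem_compl_family F A : (A \in compl_family F) = (~: A \in F).
Proof.
apply/imsetP/idP => [[B BF ->]|AF]; first by rewrite setCK.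
by exists (~: A); rewrite ?setCK.
Qed.

Lemma ABA_on_compl lt U F : ABA_on lt U F -> ABA_on lt U (compl_family F).
Proof.
move=> ab A B x y z; rewrite !mem_compl_family => AF BF xU yU zU xy yz.
move=> xA xB zA zB yB yA.
apply: (ab _ _ x y z BF AF) => //; rewrite !inE ?negbK//.
Qed.

(** A point of U that lies in every member of F having points of U on both sides of
    it: no bounding curve passes above it. These are the points of the upper
    hull; those of the complementary family are the points of the lower hull. *)
Definition unskippable (lt : rel V) (U : {set V}) (F : {set {set V}}) a : Prop :=
  a \in U /\ forall A x z, A \in F -> x \in U -> z \in U -> lt x a -> lt a z ->
    x \in A -> z \in A -> a \in A.

Lemma unskippable_rev lt U F a :
  unskippable lt U F a -> unskippable (rev_rel lt) U F a.
Proof.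
move=> [aU h]; split=> // A x z AF xU zU xa az xA zA.
exact: (h A z x).
Qed.

(** For u and w in A: some member B of F contains w but not u, and reaches outside A
    on the side of u away from w. If the members of F are upper half-planes, this implies
    that w is farther than u from the line bounding A. The relation is a strict order on A;
    if no nonempty trace of a member of F is properly included in the trace of A, its
    maximal points are unskippable. *)
Definition above (lt : rel V) (U : {set V}) (F : {set {set V}}) (A : {set V}) u w : Prop :=
  exists B : {set V}, [/\ B \in F, u \notin B, w \in B &
    exists2 x, x \in U :&: B :\: A & (lt u w /\ lt x u) \/ (lt w u /\ lt u x)].

Lemma above_rev lt U F A u w :
  above lt U F A u w -> above (rev_rel lt) U F A u w.
Proof.
by move=> [B [BF uB wB [x xP h]]]; exists B; split=> //; exists x => //; case: h; [right|left].
Qed.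

Lemma above_trans_lt lt U F A u w t : strict_total lt -> ABA_on lt U F -> A \in F ->
  u \in U :&: A -> w \in U :&: A -> t \in U :&: A -> lt u w ->
  above lt U F A u w -> above lt U F A w t -> above lt U F A u t.
Proof.
move=> st ab AF /setIP[uU uA] /setIP[wU wA] /setIP[tU tA] uw ruw rwt.
have := st; move=> [irr tr tot].
have ltN a b : lt a b -> lt b a -> False.
  by move=> h1 h2; have := tr _ _ _ h1 h2; rewrite irr.
case: (ruw) => [B [BF uB wB [x xP]]] [[_ xu]|[wu _]]; last first.
  by case: (ltN _ _ uw wu).
case: (rwt) => [C [CF wC tC [y yP]]].
move: (xP) (yP) => /setDP[/setIP[xU xB] xA] /setDP[/setIP[yU yC] yA].
have Bu z : z \in U -> lt u z -> z \in B -> z \in A.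
  by move=> zU uz zB; apply/negPn/negP => zA; apply: (ab B A x u z).
case=> [[wt yw]|[tw wy]].
- have ut := tr _ _ _ uw wt.
  have [uC|uC] := boolP (u \in C).
    have tB : t \in B by apply/negPn/negP => tB; apply: (ab C B u w t).
    by exists B; split=> //; exists x => //; left.
  exists C; split=> //; exists y => //; left; split=> //.
  have yu : y != u by apply: contraNneq yA => ->.
  have /orP[//|uy] := tot _ _ yu.
  by case: (ab A C u y w).
- have uy := tr _ _ _ uw wy.
  have yB : y \notin B by apply/negP => yB; have := Bu _ yU uy yB; rewrite (negbTE yA).
  have [tB|tB] := boolP (t \in B); last first.
    by case: (ab C B t w y).
  have tu : t != u by apply: contraNneq uB => <-.
  have /orP[tu'|ut] := tot _ _ tu; last first.
    by exists B; split=> //; exists x => //; left.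
  have [uC|uC] := boolP (u \in C); first by case: (ab C B u w y).
  by exists C; split=> //; exists y => //; right.
Qed.

Lemma above_trans lt U F A u w t : strict_total lt -> ABA_on lt U F -> A \in F ->
  u \in U :&: A -> w \in U :&: A -> t \in U :&: A ->
  above lt U F A u w -> above lt U F A w t -> above lt U F A u t.
Proof.
move=> st ab AF uUA wUA tUA ruw rwt.
have := st => -[irr tr tot].
have uw : u != w by case: ruw => B [_ uB wB _]; apply: contraNneq uB => ->.
have /orP[uw'|wu] := tot _ _ uw; first exact: (above_trans_lt st ab AF uUA wUA).
apply/above_rev/(above_trans_lt (strict_total_rev st) (ABA_on_rev ab) AF uUA wUA tUA wu);
  exact: above_rev.
Qed.

Lemma above_irr lt U F A u : ~ above lt U F A u u.
Proof. by case=> B [_ uB]; rewrite (negbTE uB). Qed.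

(** Induction on the trace of A: if it properly contains the trace of another member,
    use that one. Otherwise a point of A that is maximal for [above] is unskippable,
    since a member skipping it would also leave A and put a point above it. *)
Lemma unskippable_hit lt U F A : strict_total lt -> ABA_on lt U F -> A \in F ->
  U :&: A != set0 -> exists2 a, a \in A & unskippable lt U F a.
Proof.
move=> st ab; have [n] := ubnP #|U :&: A|.
elim: n A => // n IH A; rewrite ltnS => cA AF A0.
have := st => -[irr tr tot].
have [[B BF /andP[B0 BA]]|nB] :=
    pselect (exists2 B, B \in F & (U :&: B != set0) && (U :&: B \proper U :&: A)).
  have [|a aB ha] := IH B _ BF B0; first exact: leq_trans (proper_card BA) cA.
  exists a => //; have := proper_sub BA => /fintype.subsetP/(_ a).
  by rewrite !inE aB andbT; case: ha => -> _ /(_ isT).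
case/set0Pn: A0 => a0 a0A.
pose S u := [set w in U :&: A | `[< above lt U F A u w >]].
(* a maximal point: one with the fewest points above it *)
case: (arg_minnP (fun u => #|S u|) a0A) => a aUA amin.
have sink w : w \in U :&: A -> ~ above lt U F A a w.
  move=> wUA raw; have := amin _ wUA; rewrite leqNgt => /negP; apply.
  apply: proper_card; apply/properP; split.
    apply/fintype.subsetP => t; rewrite !inE => /andP[tUA /asboolP rwt].
    rewrite tUA; apply/asboolP; apply: (above_trans st ab AF aUA wUA) => //.
    by rewrite inE.
  exists w; first by rewrite !inE -in_setI wUA; apply/asboolP.
  by rewrite !inE; apply/negP => /andP[_ /asboolP/above_irr].
have /setIP[aU aA] := aUA.
exists a => //; split=> // B x z BF xU zU xa az xB zB.
apply/negPn/negP => aB.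
have [BA|/subsetPn[t /setIP[tU tB] tA]] := boolP (U :&: B \subset U :&: A).
  apply: nB; exists B => //; apply/andP; split.
    by apply/set0Pn; exists x; rewrite inE xU.
  apply/properP; split => //; exists a => //.
  by rewrite inE (negbTE aB) andbF.
have tA' : t \notin A by move: tA; rewrite inE tU.
have ta : t != a by apply: contraNneq tA' => ->.
have tP : t \in U :&: B :\: A by rewrite !inE tU tB tA'.
have /orP[ta'|at'] := tot _ _ ta.
  have zA : z \in A by apply/negPn/negP => zA; apply: (ab B A t a z).
  apply: (sink z); first by rewrite inE zU.
  by exists B; split=> //; exists t => //; left.
have xA : x \in A by apply/negPn/negP => xA; apply: (ab B A x a t).
apply: (sink x); first by rewrite inE xU.
by exists B; split=> //; exists t => //; right.
Qed.

(** The members of F and their complements. *)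
Definition halfplanes (F : {set {set V}}) := F :|: compl_family F.

Lemma halfplanes_compl F : halfplanes (compl_family F) = halfplanes F.
Proof. by rewrite /halfplanes compl_familyK setUC. Qed.

(** Points of the upper or of the lower hull. *)
Definition extreme lt U F a : Prop :=
  unskippable lt U F a \/ unskippable lt U (compl_family F) a.

Lemma extreme_compl lt U F a : extreme lt U F a -> extreme lt U (compl_family F) a.
Proof. by rewrite /extreme compl_familyK => -[]; [right|left]. Qed.

Lemma extreme_hit lt U F L : strict_total lt -> ABA_on lt U F -> L \in halfplanes F ->
  U :&: L != set0 -> exists2 a, a \in L & extreme lt U F a.
Proof.
move=> st ab /setUP[LF|LF] L0.
  by have [a aL ha] := unskippable_hit st ab LF L0; exists a => //; left.
have [a aL ha] := unskippable_hit st (ABA_on_compl ab) LF L0.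
by exists a => //; right.
Qed.

(** Every half-plane that contains m but neither a nor b is included in A, inside U. *)
Definition forced (U A : {set V}) (F : {set {set V}}) m a b : Prop :=
  forall C, C \in halfplanes F -> m \in C -> a \notin C -> b \notin C ->
    forall s, s \in U -> s \in C -> s \in A.

Lemma forced_sym U A F m a b : forced U A F m a b -> forced U A F m b a.
Proof. by move=> h C CP mC aC bC; apply: h. Qed.

(** Three hull points p < q < r of a member A of F. Along the hull, read as a circle, A cuts
    out an interval, and the middle one m of the three points satisfies [forced] with respect
    to the other two. A lower hull point in A splits U: A contains all the points before it
    or all those after it. The four lemmas [mid_*] treat the possible circular positions, up to
    reversal of the order; T and B record upper and lower hull points. *)
Section Mid.
Variables (lt : rel V) (U : {set V}) (F : {set {set V}}).
Hypotheses (st : strict_total lt) (ab : ABA_on lt U F).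
Variables (A : {set V}) (p q r : V).
Hypotheses (AF : A \in F) (pA : p \in A) (qA : q \in A) (rA : r \in A).
Hypotheses (pq : lt p q) (qr : lt q r).

Let T := unskippable lt U F.
Let B := unskippable lt U (compl_family F).
Let below a := forall s, s \in U -> lt s a -> s \in A.
Let beyond a := forall s, s \in U -> lt a s -> s \in A.

Lemma bot_split a : a \in A -> B a -> below a \/ beyond a.
Proof.
move=> aA [aU h]; have [?|/existsNP[x /not_implyP[xU /not_implyP[xa /negP xA]]]] := pselect (below a).
  by left.
right=> z zU az; apply/negPn/negP => zA.
have := h (~: A) x z; rewrite mem_compl_family setCK !inE => /(_ AF xU zU xa az xA zA).
by rewrite aA.
Qed.

Lemma bottom_between a D x z : B a -> D \in F -> x \in U -> z \in U -> lt x a -> lt a z ->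
  x \notin D -> z \notin D -> a \in D -> False.
Proof.
move=> [aU h] DF xU zU xa az xD zD aD.
have := h (~: D) x z; rewrite mem_compl_family setCK !inE => /(_ DF xU zU xa az xD zD).
by rewrite aD.
Qed.

Lemma top_between a D x z : T a -> D \in F -> x \in U -> z \in U -> lt x a -> lt a z ->
  x \in D -> z \in D -> a \notin D -> False.
Proof. by move=> [aU h] DF xU zU xa az xD zD /negP; apply; apply: (h D x z). Qed.

Hypotheses (pU : p \in U) (qU : q \in U) (rU : r \in U).
Let tr : transitive lt. Proof. by case: st. Qed.
Let irr : irreflexive lt. Proof. by case: st. Qed.
Let tot x y : x <> y -> lt x y \/ lt y x.
Proof. by case: st => _ _ h xy; apply/orP/h/eqP. Qed.
Let pr : lt p r. Proof. exact: tr pq qr. Qed.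

Lemma mid_TL : T q -> B r -> below r -> forced U A F p q r.
Proof.
move=> Tq Br br C CP pC qC rC s sU sC; apply/negPn/negP => sA.
have rs : lt r s.
  by have [E|/tot[sr|//]] := pselect (s = r); [rewrite E rA in sA|rewrite br in sA].
case/setUP: CP => [CF|]; last rewrite mem_compl_family => CF.
  exact: (top_between Tq CF pU sU pq (tr qr rs)).
by apply: (bottom_between Br CF pU sU pr rs); rewrite !inE ?negbK.
Qed.

Lemma mid_TT : T q -> (T p \/ below p) -> (T r \/ beyond r) -> forced U A F q p r.
Proof.
move=> Tq hp hr C CP qC pC rC s sU sC; apply/negPn/negP => sA.
case/setUP: CP => [CF|]; last first.
  rewrite mem_compl_family => CF.
  by apply: (top_between Tq CF pU rU pq qr); rewrite !inE ?negbK.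
have [sp|/tot[sp|ps]] := pselect (s = p); first by rewrite sp pA in sA.
  case: hp => [Tp|bp]; last by rewrite bp in sA.
  exact: (top_between Tp CF sU qU sp pq).
have [sr|/tot[sr|rs]] := pselect (s = r); first by rewrite sr rA in sA.
  exact: (ab AF CF pU sU rU ps sr).
case: hr => [Tr|br]; last by rewrite br in sA.
exact: (top_between Tr CF qU sU qr rs).
Qed.

Lemma mid_LL : B q -> B r -> below r -> forced U A F q p r.
Proof.
move=> Bq Br br C CP qC pC rC s sU sC; apply/negPn/negP => sA.
have rs : lt r s.
  by have [E|/tot[sr|//]] := pselect (s = r); [rewrite E rA in sA|rewrite br in sA].
case/setUP: CP => [CF|]; last rewrite mem_compl_family => CF.
  exact: (bottom_between Bq CF pU rU pq qr).
by apply: (bottom_between Br CF qU sU qr rs); rewrite !inE ?negbK.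
Qed.

Lemma mid_LT : B q -> below q -> (T r \/ beyond r) -> forced U A F p q r.
Proof.
move=> Bq bq hr C CP pC qC rC s sU sC; apply/negPn/negP => sA.
have qs : lt q s.
  by have [E|/tot[sr|//]] := pselect (s = q); [rewrite E qA in sA|rewrite bq in sA].
case/setUP: CP => [CF|]; last rewrite mem_compl_family => CF; last first.
  by apply: (bottom_between Bq CF pU sU pq qs); rewrite !inE ?negbK.
have [sr|/tot[sr|rs]] := pselect (s = r); first by rewrite sr rA in sA.
  exact: (ab AF CF qU sU rU qs sr).
case: hr => [Tr|br]; last by rewrite br in sA.
exact: (top_between Tr CF pU sU pr rs).
Qed.

End Mid.

Lemma middle_F lt U F A p q r : strict_total lt -> ABA_on lt U F -> A \in F ->
  [/\ p \in A, q \in A & r \in A] -> lt p q -> lt q r ->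
  extreme lt U F p -> extreme lt U F q -> extreme lt U F r ->
  [\/ forced U A F p q r, forced U A F q p r | forced U A F r p q].
Proof.
move=> st ab AF [pA qA rA] pq qr ep eq er.
have uU a : extreme lt U F a -> a \in U by case=> -[].
have [[pU qU] rU] := (uU _ ep, uU _ eq, uU _ er).
have str := strict_total_rev st; have abr := ABA_on_rev ab.
have rTL (Tq : unskippable lt U F q) (Bp : unskippable lt U (compl_family F) p)
    (bp : forall s, s \in U -> lt p s -> s \in A) : forced U A F r p q.
  apply: forced_sym.
  by apply: (mid_TL str pA qr pq rU) => //; exact: unskippable_rev.
have spl a : a \in A -> unskippable lt U (compl_family F) a ->
    (forall s, s \in U -> lt s a -> s \in A) \/ (forall s, s \in U -> lt a s -> s \in A).
  by move=> aA; apply: bot_split.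
have hr : [\/ unskippable lt U F r,
   unskippable lt U (compl_family F) r /\ (forall s, s \in U -> lt s r -> s \in A) |
   forall s, s \in U -> lt r s -> s \in A].
  case: er => [?|Br]; first by constructor 1.
  by case: (spl _ rA Br) => ?; [constructor 2|constructor 3].
have hp : [\/ unskippable lt U F p,
   unskippable lt U (compl_family F) p /\ (forall s, s \in U -> lt p s -> s \in A) |
   forall s, s \in U -> lt s p -> s \in A].
  case: ep => [?|Br]; first by constructor 1.
  by case: (spl _ pA Br) => ?; [constructor 3|constructor 2].
case: eq => [Tq|Bq].
  case: hr => [Tr|[Br br]|br]; last 2 first.
  - by constructor 1; apply: (mid_TL st rA pq qr pU).
  - case: hp => [Tp|[Bp bp]|bp]; last 2 first.
    + by constructor 3; apply: rTL.
    + by constructor 2; apply: (mid_TT st ab AF pA rA pq qr pU qU rU) => //; right.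
    + by constructor 2; apply: (mid_TT st ab AF pA rA pq qr pU qU rU) => //; [left|right].
  case: hp => [Tp|[Bp bp]|bp].
  - by constructor 2; apply: (mid_TT st ab AF pA rA pq qr pU qU rU) => //; left.
  - by constructor 3; apply: rTL.
  - by constructor 2; apply: (mid_TT st ab AF pA rA pq qr pU qU rU) => //; [right|left].
case: (spl _ qA Bq) => bq.
  case: hr => [Tr|[Br br]|br].
  - by constructor 1; apply: (mid_LT st ab AF qA rA pq qr pU qU rU) => //; left.
  - by constructor 2; apply: (mid_LL st rA pq qr pU qU rU).
  - by constructor 1; apply: (mid_LT st ab AF qA rA pq qr pU qU rU) => //; right.
case: hp => [Tp|[Bp bp]|bp].
- constructor 3; apply: forced_sym.
  apply: (mid_LT str abr AF qA pA qr pq rU qU pU) => //.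
    exact: unskippable_rev.
  by left; exact: unskippable_rev.
- constructor 2; apply: forced_sym.
  by apply: (mid_LL str pA qr pq rU qU pU) => //; exact: unskippable_rev.
- constructor 3; apply: forced_sym.
  apply: (mid_LT str abr AF qA pA qr pq rU qU pU) => //.
    exact: unskippable_rev.
  by right.
Qed.

Lemma middle lt U F A p q r : strict_total lt -> ABA_on lt U F -> A \in halfplanes F ->
  [/\ p \in A, q \in A & r \in A] -> lt p q -> lt q r ->
  extreme lt U F p -> extreme lt U F q -> extreme lt U F r ->
  [\/ forced U A F p q r, forced U A F q p r | forced U A F r p q].
Proof.
move=> st ab /setUP[|] AF; first exact: middle_F.
move=> hA pq qr ep eq er.
have := middle_F st (ABA_on_compl ab) AF hA pq qr
  (extreme_compl ep) (extreme_compl eq) (extreme_compl er).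
by rewrite /forced !halfplanes_compl.
Qed.

Lemma middle_unordered lt U F A p q r : strict_total lt -> ABA_on lt U F -> A \in halfplanes F ->
  [/\ p \in A, q \in A & r \in A] -> [/\ p != q, q != r & r != p] ->
  extreme lt U F p -> extreme lt U F q -> extreme lt U F r ->
  [\/ forced U A F p q r, forced U A F q p r | forced U A F r p q].
Proof.
move=> st ab AF [pA qA rA] [pq qr rp] ep eq er.
have := st => -[_ _ tot]; have M := fun a b c => @middle lt U F A a b c st ab AF.
case/orP: (tot _ _ pq) => h1; case/orP: (tot _ _ qr) => h2.
- exact: (M p q r).
- case/orP: (tot _ _ rp) => h3.
  + case: (M r p q) => // /forced_sym h;
      [constructor 3|constructor 1|constructor 2] => //; exact: forced_sym.
  + case: (M p r q) => // h; [constructor 1|constructor 3|constructor 2] => //; exact: forced_sym.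
- case/orP: (tot _ _ rp) => h3.
  + case: (M q r p) => // h; [constructor 2|constructor 3|constructor 1] => //; exact: forced_sym.
  + case: (M q p r) => // h; [constructor 2|constructor 1|constructor 3] => //; exact: forced_sym.
- case: (M r q p) => // h; [constructor 3|constructor 2|constructor 1] => //; exact: forced_sym.
Qed.

(** A set R that meets some small subset of every large half-plane in one or two points. The
    small subsets are the inclusion-minimal traces of size at least n, and R is an
    inclusion-minimal set of extreme points meeting all of them. *)
Lemma shallow_hitting lt U F n : strict_total lt -> ABA_on lt U F -> (0 < n)%N ->
  exists2 R : {set V}, R \subset U &
    forall L, L \in halfplanes F -> (n <= #|U :&: L|)%N ->
      exists M : {set V}, [/\ M \subset U :&: L, (n <= #|M|)%N, M :&: R != set0 & (#|M :&: R| <= 2)%N].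
Proof.
move=> st ab n0.
pose good (M : {set V}) := (n <= #|M|)%N && [exists L in halfplanes F, M == U :&: L].
have goodE L : L \in halfplanes F -> (n <= #|U :&: L|)%N -> good (U :&: L).
  by move=> LF nL; rewrite /good nL; apply/existsP; exists L; rewrite LF eqxx.
pose mins := [set M | minset good M].
pose hit (R : {set V}) := [forall M in mins, M :&: R != set0].
pose hull := [set a | `[< extreme lt U F a >]].
have hullhit : hit hull.
  apply/forallP => M; apply/implyP; rewrite inE => /minsetp/andP[nM /existsP[L /andP[LF /eqP ME]]].
  have [|a aL ea] := extreme_hit st ab LF; first by rewrite -ME -card_gt0 (leq_trans n0).
  apply/set0Pn; exists a; rewrite !inE ME !inE aL andbT; apply/andP; split; last exact/asboolP.
  by case: ea => -[].
have [R Rmin Rhull] := minset_exists hullhit.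
have Rhit := minsetp Rmin.
have Rex a : a \in R -> extreme lt U F a.
  by move=> aR; move/fintype.subsetP/(_ a aR): Rhull; rewrite inE => /asboolP.
exists R.
  by apply/fintype.subsetP => a /Rex; case=> -[].
move=> L LF nL.
have [M Mmin ML] := minset_exists (goodE L LF nL).
have MM : M \in mins by rewrite inE.
have /andP[nM /existsP[A /andP[AF /eqP MA]]] := minsetp Mmin.
exists M; split=> //.
  by move/forallP/(_ M): Rhit; rewrite MM.
rewrite leqNgt; apply/negP => /card_gt2P[p [q [r [[/setIP[pM pR] /setIP[qM qR] /setIP[rM rR]] ne]]]].
(* by minimality of R, each of its points is the only one in some minimal trace *)
have private a : a \in R -> exists2 C, C \in halfplanes F & [/\ good (U :&: C), a \in C &
    forall b, b \in R -> b != a -> b \in U -> b \notin C].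
  move=> aR.
  have /forallPn[M'] : ~~ hit (R :\ a).
    apply/negP => h; have := minsetinf Rmin h (subsetDl _ _) => /setP/(_ a).
    by rewrite !inE eqxx aR.
  rewrite negb_imply negbK => /andP[M'm /eqP M'0].
  move/forallP/(_ M'): Rhit; rewrite M'm => /set0Pn[b /setIP[bM' bR]].
  have {}M'0 c : c \in R -> c != a -> c \notin M'.
    move=> cR ca; apply/negP => cM'; move/setP/(_ c): M'0.
    by rewrite !inE cM' ca cR.
  have ba : b = a by apply/eqP; apply: contraTT bM'; apply: M'0.
  move: M'm; rewrite inE => /minsetp gM'; have /andP[_ /existsP[C /andP[CF /eqP M'C]]] := gM'.
  exists C => //; split; first by rewrite -M'C.
    by move: bM'; rewrite ba M'C inE => /andP[].
  by move=> c cR ca cU; have := M'0 c cR ca; rewrite M'C inE cU.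
(* a private trace contained in M would be M itself *)
have key m a b : m \in R -> a \in R -> b \in R -> a \in M -> b \in M ->
    a != m -> b != m -> forced U A F m a b -> False.
  move=> mR aR bR aM bM am bm fo.
  have [C CF [gC mC Cb]] := private m mR.
  have aU : a \in U by move: aM; rewrite MA inE => /andP[].
  have bU : b \in U by move: bM; rewrite MA inE => /andP[].
  have CA : U :&: C \subset M.
    rewrite MA; apply/fintype.subsetP => s /setIP[sU sC]; rewrite inE sU.
    exact: (fo C CF mC (Cb a aR am aU) (Cb b bR bm bU)).
  have := minsetinf Mmin gC CA => /setP/(_ a).
  by rewrite aM inE aU (negbTE (Cb a aR am aU)).
have [pA qA rA] : [/\ p \in A, q \in A & r \in A].
  by move: pM qM rM; rewrite MA !inE => /andP[_ ->] /andP[_ ->] /andP[_ ->].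
have [pq qr rp] := ne.
case: (@middle_unordered lt U F A p q r st ab AF) => // ; try exact: Rex.
- by apply: key => //; rewrite eq_sym.
- by apply: key => //; rewrite eq_sym.
- by apply: key => //; rewrite eq_sym.
Qed.

(** One colour at a time: R receives the new colour k, and every half-plane with at least
    2k+1 points keeps 2k-1 of them outside R. *)
Theorem polychromatic lt U F k : strict_total lt -> ABA_on lt U F ->
  exists c : V -> nat, forall L, L \in halfplanes F -> (2 * k - 1 <= #|U :&: L|)%N ->
    forall i, (i < k)%N -> exists2 v, v \in U :&: L & c v = i.
Proof.
move=> st; elim: k U => [|k IH] U ab; first by exists (fun=> 0%N).
have [|R RU hR] := @shallow_hitting lt U F (2 * k.+1 - 1) st ab; first lia.
have [|c hc] := IH (U :\: R).
  move=> A B x y z AF BF /setDP[xU _] /setDP[yU _] /setDP[zU _].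
  exact: (ab A B x y z).
exists (fun v => if v \in R then k else c v) => L LF nL i.
have [M [ML nM M0 M2]] := hR L LF nL.
rewrite ltnS leq_eqVlt => /orP[/eqP->|ik].
  case/set0Pn: M0 => v /setIP[vM vR]; exists v; last by rewrite vR.
  exact: (fintype.subsetP ML).
have [|v /setIP[/setDP[vU vR] vL] vi] := hc L LF _ i ik; last first.
  by exists v; rewrite ?(negbTE vR)// inE vU.
apply: (@leq_trans #|M :\: R|); last first.
  apply/subset_leq_card/fintype.subsetP => v /setDP[vM vR].
  by move/fintype.subsetP/(_ v vM): ML; rewrite !inE vR.
by have := cardsID R M; lia.
Qed.

End ABA.

(** * Lexicographic orders and hypergraphs *)

Section Lex.
Variable V : finType.

(** The lexicographic order of the incidence vectors of points with the sets of s; the rank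
    breaks the ties between points with equal vectors. *)
Fixpoint lex (s : seq {set V}) : rel V := fun p q =>
  if s is L :: s' then
    if (p \in L) == (q \in L) then lex s' p q else p \in L
  else (enum_rank p < enum_rank q)%N.

Lemma lex_strict_total s : strict_total (lex s).
Proof.
elim: s => [|L s [irr tr tot]]; split=> /=.
- by move=> x; rewrite /= ltnn.
- by move=> y x z /=; apply: ltn_trans.
- by move=> x y xy; rewrite -neq_ltn; apply: contraNneq xy => /val_inj/enum_rank_inj ->.
- by move=> x /=; rewrite eqxx.
- move=> y x z /=; have := tr y x z.
  by case: (x \in L); case: (y \in L); case: (z \in L).
- move=> x y xy /=; have := tot _ _ xy.
  by case: (x \in L); case: (y \in L).
Qed.

Lemma lex_first s p q j : lex s p q -> (j < size s)%N ->
  p \notin nth finset.set0 s j -> q \in nth finset.set0 s j ->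
  exists2 i, (i < j)%N & p \in nth finset.set0 s i /\ q \notin nth finset.set0 s i.
Proof.
elim: s j => [|L s IH] [|j] //=.
  by move=> + _ /negbTE pL qL; rewrite pL qL.
case: eqP => [e|ne] pq js pj qj; last first.
  exists 0%N => //=; split=> //; apply/negP => qL; apply: ne.
  by rewrite pq qL.
have [i ij [pi qi]] := IH j pq js pj qj.
by exists i.+1.
Qed.

(** The sets of s are thought of as the sets of points above the lines of an arrangement, listed
    by slope. The hypothesis is the ABA-freeness of the dual family, whose members are the sets
    of lines below each point; the lexicographic order makes s itself ABA-free. *)
Theorem polychromatic_lines (U : {set V}) (s : seq {set V}) k :
  (forall i j l p q, (i < j)%N -> (j < l)%N -> (l < size s)%N ->
     p \in U -> q \in U ->
     p \in nth finset.set0 s i -> p \notin nth finset.set0 s j -> p \in nth finset.set0 s l ->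
     q \notin nth finset.set0 s i -> q \in nth finset.set0 s j -> q \notin nth finset.set0 s l -> False) ->
  exists c : V -> nat, forall L, L \in s ->
    ((2 * k - 1 <= #|U :&: L|)%N ->
      forall i, (i < k)%N -> exists2 v, v \in U :&: L & c v = i) /\
    ((2 * k - 1 <= #|U :\: L|)%N ->
      forall i, (i < k)%N -> exists2 v, v \in U :\: L & c v = i).
Proof.
move=> tri.
(* an alternation of two sets, together with the first set that tells two of its points apart,
   gives a forbidden triple of sets *)
have ab : ABA_on (lex s) U [set L in s].
  move=> A B x y z; rewrite !inE => As Bs xU yU zU xy yz xA xB zA zB yB yA.
  have /orP[AB|BA] : (index A s <= index B s)%N || (index B s <= index A s)%N by exact: leq_total.
  - have [|||i iA [yi zi]] := @lex_first s y z (index A s) yz; rewrite ?index_mem ?nth_index//.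
    apply: (tri i (index A s) (index B s) y z) => //; rewrite ?nth_index ?index_mem//.
    rewrite ltn_neqAle AB andbT; apply: contraNneq yA => e.
    by rewrite -(nth_index finset.set0 As) e nth_index.
  - have [|||i iB [xi yi]] := @lex_first s x y (index B s) xy; rewrite ?index_mem ?nth_index//.
    apply: (tri i (index B s) (index A s) x y) => //; rewrite ?nth_index ?index_mem//.
    rewrite ltn_neqAle BA andbT; apply: contraNneq yA => e.
    by rewrite -(nth_index finset.set0 As) -e nth_index.
have [c hc] := polychromatic k (lex_strict_total s) ab.
exists c => L Ls; split.
  by apply: hc; rewrite !inE Ls.
rewrite finset.setDE; apply: hc; rewrite !inE mem_compl_family finset.setCK inE Ls orbT //.
Qed.

End Lex.

Lemma pigeonhole_halves k a b : (4 * k - 3 <= a + b)%N -> (0 < k)%N ->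
  (2 * k - 1 <= a)%N \/ (2 * k - 1 <= b)%N.
Proof. by case: (leqP (2 * k - 1) a); [left|right; lia]. Qed.

Lemma glue_colorings (V : finType) (U : {set V}) (L : {set V}) (c0 c1 : V -> nat) k :
  (0 < k)%N ->
  ((2 * k - 1 <= #|L :&: U|)%N -> forall i, (i < k)%N -> exists2 v, v \in L :&: U & c0 v = i) ->
  ((2 * k - 1 <= #|L :\: U|)%N -> forall i, (i < k)%N -> exists2 v, v \in L :\: U & c1 v = i) ->
  (4 * k - 3 <= #|L|)%N ->
  forall i, (i < k)%N -> exists2 v, v \in L & (if v \in U then c0 v else c1 v) = i.
Proof.
move=> k0 h0 h1; rewrite -(cardsID U) => /pigeonhole_halves /(_ k0) h i ik.
case: h => h.
  by have [v /setIP[vL vU] vi] := h0 h i ik; exists v; rewrite ?vU.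
by have [v /setDP[vL vU] vi] := h1 h i ik; exists v; rewrite ?(negbTE vU).
Qed.

Lemma polychromatic_pseudohemisphere_hypergraph k (hk : (1 <= k)%N)
    (d : Order.disp_t) (V : finOrderType d) (E : {set {set V}}) :
  pseudohemisphere_hypergraph E ->
  exists c : V -> 'I_k,
    forall A : {set V}, A \in E -> (4 * k - 3 <= #|A|)%N ->
      forall i : 'I_k, exists2 v, v \in A & c v = i.
Proof.
case: k hk => // k _ [X [F [ab EF]]].
pose lt : rel V := fun x y => (x < y)%O.
have st : strict_total lt.
  split=> [x|y x z|x y xy]; first exact: Order.POrderTheory.ltxx.
    exact: Order.POrderTheory.lt_trans.
  by rewrite /lt -Order.TotalTheory.neq_lt.
have abU U : ABA_on lt U F.
  move=> A B x y z AF BF _ _ _ xy yz xA xB zA zB yB yA; apply: ab.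
  by exists A, B; split=> //; exists x, y, z; rewrite !inE; split=> //; apply/andP.
have [c0 h0] := polychromatic k.+1 st (abU X).
have [c1 h1] := polychromatic k.+1 st (abU (~: X)).
exists (fun v => inord (if v \in X then c0 v else c1 v)) => A AE cA i.
have inF B : B \in F -> B \in halfplanes F by move=> BF; rewrite inE BF.
have inC B : B \in F -> ~: B \in halfplanes F by move=> BF; rewrite inE mem_compl_family finset.setCK BF orbT.
have [L0 [L1 [L0F L1F L0X L1X]]] : exists L0 L1, [/\ L0 \in halfplanes F, L1 \in halfplanes F,
    A :&: X = X :&: L0 & A :\: X = ~: X :&: L1].
  have /setUP[/imsetP[B BF ->]|/imsetP[B BF ->]] := fintype.subsetP EF _ AE.
    exists (~: B), B; split; [exact: inC|exact: inF|apply/setP => v|apply/setP => v];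
      by rewrite !inE; case: (v \in B); case: (v \in X).
  exists B, (~: B); split; [exact: inF|exact: inC|apply/setP => v|apply/setP => v];
    by rewrite !inE; case: (v \in B); case: (v \in X).
have [|||v vA vi] := @glue_colorings _ X A c0 c1 k.+1 _ _ _ cA i (ltn_ord i) => //.
- by rewrite L0X; exact: h0.
- by rewrite L1X; exact: h1.
by exists v => //; apply/val_inj; rewrite /= vi inordK.
Qed.

Local Open Scope ring_scope.
Local Open Scope classical_set_scope.
Local Open Scope card_scope.

(** * Vectors and projections along a line *)

Section Vec.
Variable R : realType.
Notation E := 'rV[R]_3.
Implicit Types u v w c x y z : E.

Let i0 : 'I_3 := @Ordinal 3 0 isT.
Let i1 : 'I_3 := @Ordinal 3 1 isT.
Let i2 : 'I_3 := @Ordinal 3 2 isT.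

(** The Euclidean scalar product; the norm of the vector space is the sup norm. *)
Definition dot u v : R := u ord0 i0 * v ord0 i0 + u ord0 i1 * v ord0 i1 + u ord0 i2 * v ord0 i2.

Definition det3 u v w : R :=
  u ord0 i0 * (v ord0 i1 * w ord0 i2 - v ord0 i2 * w ord0 i1)
  - u ord0 i1 * (v ord0 i0 * w ord0 i2 - v ord0 i2 * w ord0 i0)
  + u ord0 i2 * (v ord0 i0 * w ord0 i1 - v ord0 i1 * w ord0 i0).

Lemma sum3 (F : 'I_3 -> R) : \sum_(i < 3) F i = F i0 + F i1 + F i2.
Proof.
rewrite !big_ord_recl big_ord0 addr0 addrA; congr (F _ + F _ + F _); exact: val_inj.
Qed.

Lemma sphereE x : sphere x = (dot x x = 1).
Proof. by rewrite /sphere/= sum3 !expr2. Qed.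

Lemma vecP u v : u ord0 i0 = v ord0 i0 -> u ord0 i1 = v ord0 i1 -> u ord0 i2 = v ord0 i2 -> u = v.
Proof.
move=> e0 e1 e2; apply/matrixP => i j; rewrite ord1.
case: j => -[|[|[|//]]] h.
- by rewrite (_ : Ordinal h = i0) //; apply: val_inj.
- by rewrite (_ : Ordinal h = i1) //; apply: val_inj.
- by rewrite (_ : Ordinal h = i2) //; apply: val_inj.
Qed.

Lemma dotC u v : dot u v = dot v u. Proof. rewrite /dot; ring. Qed.
Lemma dotDl u v w : dot (u + v) w = dot u w + dot v w.
Proof. rewrite /dot !mxE; ring. Qed.
Lemma dotNl u v : dot (- u) v = - dot u v.
Proof. rewrite /dot !mxE; ring. Qed.
Lemma dotNr u v : dot u (- v) = - dot u v.
Proof. rewrite /dot !mxE; ring. Qed.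
Lemma dotZl a u v : dot (a *: u) v = a * dot u v.
Proof. rewrite /dot !mxE; ring. Qed.
Lemma dotDr u v w : dot u (v + w) = dot u v + dot u w.
Proof. rewrite /dot !mxE; ring. Qed.
Lemma dotZr a u v : dot u (a *: v) = a * dot u v.
Proof. rewrite /dot !mxE; ring. Qed.
Lemma dot_ge0 u : 0 <= dot u u. Proof. rewrite /dot; nra. Qed.
Lemma dot_eq0 u : dot u u = 0 -> u = 0.
Proof. by move=> h; apply: vecP; rewrite mxE; move: h; rewrite /dot; nra. Qed.

Lemma sphereN x : sphere x -> sphere (- x).
Proof. by rewrite !sphereE dotNl dotNr opprK. Qed.

Lemma sphere_neqN x : sphere x -> x <> - x.
Proof.
rewrite sphereE => h e; have : dot x x = - dot x x by rewrite {1}e dotNl.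
by rewrite h; lra.
Qed.

(** For a unit vector c, the projections of d and d' to the plane orthogonal to c, oriented by c,
    are complex numbers z and z'; [pre] and [pim] are the real and imaginary parts of the product
    of z' with the conjugate of z. Both are polynomial, no frame of the plane has to be chosen. *)
Definition pre c d d' : R := dot d d' - dot c d * dot c d'.
Definition pim c d d' : R := det3 c d d'.

Lemma pre_mul c d1 d2 d3 : dot c c = 1 ->
  pre c d1 d2 * pre c d2 d3 - pim c d1 d2 * pim c d2 d3 = pre c d2 d2 * pre c d1 d3.
Proof.
move=> h.
suff : pre c d1 d2 * pre c d2 d3 - pim c d1 d2 * pim c d2 d3 - pre c d2 d2 * pre c d1 d3
   = (1 - dot c c) * (dot d1 d2 * dot d2 d3 - dot d2 d2 * dot d1 d3).
  by rewrite h subrr mul0r => /eqP; rewrite subr_eq0 => /eqP.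
rewrite /pre /pim /det3 /dot; ring.
Qed.

Lemma pim_mul c d1 d2 d3 : dot c c = 1 ->
  pre c d1 d2 * pim c d2 d3 + pim c d1 d2 * pre c d2 d3 = pre c d2 d2 * pim c d1 d3.
Proof.
move=> h.
pose k : R := det3 d1 d2 d3 * dot c d2.
suff : pre c d1 d2 * pim c d2 d3 + pim c d1 d2 * pre c d2 d3 - pre c d2 d2 * pim c d1 d3
   = (1 - dot c c) * k.
  by rewrite h subrr mul0r => /eqP; rewrite subr_eq0 => /eqP.
rewrite /k /pre /pim /det3 /dot; ring.
Qed.

Lemma pre_ge0 c d : dot c c = 1 -> 0 <= pre c d d.
Proof.
move=> h; rewrite (_ : pre c d d = dot (d - dot c d *: c) (d - dot c d *: c)) ?dot_ge0//.
rewrite !(dotDl, dotDr, dotNl, dotNr, dotZl, dotZr) h (dotC d c) /pre; ring.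
Qed.

Lemma pre_eq0 c d : dot c c = 1 -> pre c d d = 0 -> d = dot c d *: c.
Proof.
move=> h p0; apply/eqP; rewrite -subr_eq0; apply/eqP/dot_eq0.
rewrite !(dotDl, dotDr, dotNl, dotNr, dotZl, dotZr) h (dotC d c).
by move: p0; rewrite /pre; lra.
Qed.

Lemma pre_gt0 c d : sphere c -> sphere d -> d <> c -> d <> - c -> 0 < pre c d d.
Proof.
rewrite !sphereE => hc hd dc dNc; rewrite lt_def pre_ge0// andbT; apply/eqP => p0.
have e := pre_eq0 hc p0.
have : (dot c d - 1) * (dot c d + 1) = 0.
  by move: p0; rewrite /pre hd; lra.
move/eqP; rewrite mulf_eq0 => /orP[|] /eqP k.
  by apply: dc; rewrite e (_ : dot c d = 1) ?scale1r//; lra.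
by apply: dNc; rewrite e (_ : dot c d = -1) ?scaleN1r//; lra.
Qed.

Lemma pre_preC c d d' : pre c d d' = pre c d' d.
Proof. by rewrite /pre (dotC d d') mulrC. Qed.

Lemma pim_anti c d d' : pim c d d' = - pim c d' d.
Proof. rewrite /pim /det3; ring. Qed.

Lemma pre_Nc c d d' : pre (- c) d d' = pre c d d'.
Proof. by rewrite /pre !dotNl mulrNN. Qed.
Lemma pim_Nc c d d' : pim (- c) d d' = - pim c d d'.
Proof. rewrite /pim /det3 !mxE; ring. Qed.
Lemma pre_Nd c d d' : pre c (- d) (- d') = pre c d d'.
Proof. by rewrite /pre !dotNr dotNl !opprK mulrNN. Qed.
Lemma pim_Nd c d d' : pim c (- d) (- d') = pim c d d'.
Proof. rewrite /pim /det3 !mxE; ring. Qed.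
Lemma pre_Nr c d d' : pre c d (- d') = - pre c d d'.
Proof. by rewrite /pre !dotNr; ring. Qed.
Section Cont.
Variable T : topologicalType.

Lemma coord_cont (f : T -> E) (j : 'I_3) : continuous f -> continuous (fun t => f t ord0 j).
Proof. by move=> cf t; apply: (@continuous_comp _ _ _ f (fun M : E => M ord0 j)); [exact: cf|exact: coord_continuous]. Qed.

Lemma dot_cont (f g : T -> E) : continuous f -> continuous g -> continuous (fun t => dot (f t) (g t)).
Proof.
move=> cf cg t; rewrite /dot.
by apply: cvgD; [apply: cvgD|]; apply: cvgM; apply: coord_cont.
Qed.

Lemma pre_cont (f g h : T -> E) : continuous f -> continuous g -> continuous h ->
  continuous (fun t => pre (f t) (g t) (h t)).
Proof.
move=> cf cg ch t; rewrite /pre.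
by apply: cvgB; [|apply: cvgM]; apply: dot_cont.
Qed.

Lemma pim_cont (f g h : T -> E) : continuous f -> continuous g -> continuous h ->
  continuous (fun t => pim (f t) (g t) (h t)).
Proof.
move=> cf cg ch t; rewrite /pim /det3.
by apply: cvgD; [apply: cvgB|]; (apply: cvgM; first by apply: coord_cont);
  apply: cvgB; apply: cvgM; apply: coord_cont.
Qed.

End Cont.

End Vec.

(** * Connectedness and winding angles *)

Section Connected.
Variable T : topologicalType.

(** A locally constant property is constant on a connected set. *)
Lemma connected_const (W : set T) (P : T -> Prop) x y : connected W ->
  (forall y, W y -> \forall y' \near y, W y' -> (P y <-> P y')) ->
  W x -> W y -> P x -> P y.
Proof.
move=> cW loc Wx Wy Px.
suff : W `&` [set z | P z] = W by move/seteqP => [_ /(_ y Wy) []].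
apply: cW; first by exists x.
- exists (interior [set z | W z -> P z]); first exact: open_interior.
  apply/seteqP; split => z [Wz Pz]; split=> //.
    by have := loc z Wz; apply: filterS => z' h Wz'; apply/(h Wz').
  exact: (interior_subset Pz).
- exists (~` (interior [set z | W z -> ~ P z])).
    by apply: open_closedC; exact: open_interior.
  apply/seteqP; split => z [Wz Pz]; split=> //.
    by move=> /interior_subset /(_ Wz).
  apply: contrapT => nPz; apply: Pz.
  by have := loc z Wz; apply: filterS => z' h Wz' Pz'; apply: nPz; apply/(h Wz').
Qed.

Lemma connected_chain (W : set T) (rho : T -> T -> Prop) x y : connected W ->
  (forall z, W z -> \forall z' \near z, W z' -> rho z z' /\ rho z' z) ->
  W x -> W y ->
  exists (n : nat) (d : nat -> T), [/\ d 0%N = x, d n = y, forall i, W (d i) &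
    forall i, (i < n)%N -> rho (d i) (d i.+1)].
Proof.
move=> cW loc Wx Wy.
pose P z := exists (n : nat) (d : nat -> T), [/\ d 0%N = x, d n = z, forall i, W (d i) &
    forall i, (i < n)%N -> rho (d i) (d i.+1)].
have step z z' : W z' -> rho z z' -> P z -> P z'.
  move=> Wz' zz' [n [d [d0 dn Wd rd]]].
  exists n.+1, (fun i => if (i <= n)%N then d i else z'); split=> //.
  - by rewrite ltnn.
  - by move=> i; case: ifP.
  - move=> i; rewrite ltnS => i_n; rewrite i_n; case: ltnP => h; first exact: rd.
    by have -> : i = n by [apply/eqP; rewrite eqn_leq i_n]; rewrite dn.
suff : P y by [].
apply: (connected_const cW _ Wx Wy).
  move=> z Wz; have := loc z Wz; apply: filterS => z' h Wz'.
  by have [h1 h2] := h Wz'; split; exact: step.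
by exists 0%N, (fun=> x).
Qed.

End Connected.

Section Winding.
Variable R : realType.
Notation E := 'rV[R]_3.

Lemma polar (p q : R) : 0 < p -> exists2 r, 0 < r &
  p = r * cos (atan (q / p)) /\ q = r * sin (atan (q / p)).
Proof.
move=> p0; have c0 : 0 < cos (atan (q / p)).
  by rewrite cos_atan invr_gt0 sqrtr_gt0; nra.
exists (p / cos (atan (q / p))); first exact: divr_gt0.
split; first by rewrite divfK// gt_eqF.
have /(congr1 (fun z => z * p)) := atanK (q / p).
rewrite /tan divfK ?gt_eqF// => /esym e.
by rewrite {1}e; field; rewrite gt_eqF.
Qed.

Let ang (c d d' : E) := atan (pim c d d' / pre c d d').

(** The angles between consecutive projections add up to an argument of the last projection
    relative to the first one. *)
Lemma total_angle (c : E) (d : nat -> E) n : dot c c = 1 ->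
  (forall i, (i <= n)%N -> 0 < pre c (d i) (d i)) ->
  (forall i, (i < n)%N -> 0 < pre c (d i) (d i.+1)) ->
  exists2 r, 0 < r & pre c (d 0%N) (d n) = r * cos (\sum_(i < n) ang c (d i) (d i.+1))
    /\ pim c (d 0%N) (d n) = r * sin (\sum_(i < n) ang c (d i) (d i.+1)).
Proof.
move=> hc; elim: n => [|n IH] hd hdd.
  exists (pre c (d 0%N) (d 0%N)); first exact: hd.
  by rewrite big_ord0 cos0 sin0 mulr1 mulr0; split=> //; rewrite /pim /det3; ring.
have [||r r0 [e1 e2]] := IH; [by move=> i h; apply: hd; lia|by move=> i h; apply: hdd; lia|].
have pn := hd n (leqnSn n).
have [s s0 [f1 f2]] := polar (pim c (d n) (d n.+1)) (hdd n (leqnn _)).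
exists (r * s / pre c (d n) (d n)); first by rewrite divr_gt0// mulr_gt0.
rewrite big_ord_recr/=; move: f1 f2; rewrite -/(ang c (d n) (d n.+1)).
move: (ang c (d n) (d n.+1)) => a f1 f2; rewrite cosD sinD; split.
- apply: (@mulfI _ (pre c (d n) (d n))); first by rewrite gt_eqF.
  rewrite -pre_mul// e1 e2 f1 f2.
  by field; rewrite gt_eqF.
- apply: (@mulfI _ (pre c (d n) (d n))); first by rewrite gt_eqF.
  rewrite -pim_mul// e1 e2 f1 f2.
  by field; rewrite gt_eqF.
Qed.

(** A polygonal path d_0, ..., d_n with d_n = - d_0 turns, seen along c, by an odd multiple of
    pi. The total angle depends continuously on s, so it cannot take opposite values at s = 0
    and s = 1: it would vanish in between. *)
Lemma no_odd_winding (c : R -> E) (d : nat -> R -> E) n :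
  {within `[0, 1], continuous c} ->
  (forall i, {within `[0, 1], continuous (d i)}) ->
  (forall s, 0 <= s <= 1 -> dot (c s) (c s) = 1) ->
  (forall s i, 0 <= s <= 1 -> (i <= n)%N -> 0 < pre (c s) (d i s) (d i s)) ->
  (forall s i, 0 <= s <= 1 -> (i < n)%N -> 0 < pre (c s) (d i s) (d i.+1 s)) ->
  (forall s, 0 <= s <= 1 -> d n s = - d 0%N s) ->
  \sum_(i < n) ang (c 1) (d i 1) (d i.+1 1) = - \sum_(i < n) ang (c 0) (d i 0) (d i.+1 0) ->
  False.
Proof.
move=> cc cd hc hd hdd hdn anti.
pose th m s := \sum_(i < m) ang (c s) (d i s) (d i.+1 s).
have cth m : (m <= n)%N -> {within `[0, 1], continuous (th m)}.
  elim: m => [|m IH] mn.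
    have -> : th 0%N = fun=> 0 by apply/funext => s; rewrite /th big_ord0.
    exact: cst_continuous.
  have -> : th m.+1 = th m \+ (fun s => ang (c s) (d m s) (d m.+1 s)).
    by apply/funext => s; rewrite /th big_ord_recr.
  move=> s; apply: cvgD; first by apply: IH; exact: ltnW.
  move: s; apply/subspace_continuousP => s s01'; have s01 := s01'; rewrite /= in_itv/= in s01.
  rewrite /ang; apply: (@continuous_cvg _ _ _ _ _ _ (@atan R)); first exact: continuous_atan.
  apply: cvgM; first exact: ((subspace_continuousP _ _).1 (pim_cont cc (cd m) (cd m.+1)) s s01').
  apply: cvgV; first by rewrite gt_eqF// hdd.
  exact: ((subspace_continuousP _ _).1 (pre_cont cc (cd m) (cd m.+1)) s s01').
(* the total angle vanishes for some s, although its cosine is negative *)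
have [s] : exists2 s, s \in `[0, 1]%R & th n s = 0.
  apply: IVT; [exact: ler01|exact: cth|]; rewrite -/(th n 1) -/(th n 0) in anti; rewrite anti.
  by case: (leP 0 (th n 0)) => h; rewrite ge_min le_max; apply/andP; split; apply/orP; lra.
rewrite in_itv/= => s01 ths.
have [r r0 [e1 e2]] := total_angle (hc s s01) (fun i => hd s i s01) (fun i => hdd s i s01).
move: e1; rewrite -/(th n s) ths cos0 mulr1 hdn// pre_Nr.
have := hd s 0%N s01 (leq0n n).
by move=> + h; rewrite -oppr_lt0 h ltNge (ltW r0).
Qed.

End Winding.

(** * Antipodal separation and the Borsuk-Ulam theorem *)

Lemma continuous_within_comp (S T U : topologicalType) (A : set T) (f : S -> T) (h : T -> U) :
  continuous f -> (forall t, A (f t)) -> {within A, continuous h} -> continuous (h \o f).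
Proof.
move=> cf Af /subspace_continuousP ch t B /= hB.
have := ch (f t) (Af t) B hB; rewrite /= /within/= => /cf /=.
by rewrite !nbhs_simpl/=; apply: filterS => t' /(_ (Af t')).
Qed.

Section BU.
Variable R : realType.
Notation E := 'rV[R]_3.

(** A path c on the sphere from a point to its antipode meets, up to sign, every connected set
    W containing two antipodal points. Otherwise take a chain in W from x to -x, fine enough
    to be followed by its projections along all c(s): replacing c by -c changes the sign of
    all the angles. *)
Theorem antipodal_separation (c : R -> E) (W : set E) x :
  {within `[0, 1], continuous c} -> (forall s, 0 <= s <= 1 -> sphere (c s)) ->
  c 1 = - c 0 -> connected W -> W `<=` sphere (R := R) ->
  (forall y s, W y -> 0 <= s <= 1 -> y <> c s /\ y <> - c s) ->
  W x -> W (- x) -> False.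
Proof.
move=> cc sc c1 cW Ws Wc Wx WNx.
pose rho y y' := forall s, 0 <= s <= 1 -> 0 < pre (c s) y y'.
have K : compact (c @` `[0, 1]) by apply: continuous_compact => //; exact: segment_compact.
(* by compactness of c, nearby points of W make acute angles seen along all c(s) *)
have loc z : W z -> \forall z' \near z, W z' -> rho z z' /\ rho z' z.
  move=> Wz.
  have : \forall z' \near z, c @` `[0, 1] `<=` (fun c => 0 < pre c z z').
    apply: ((compact_near_coveringP _).1 K E (nbhs z) (fun z' c => 0 < pre c z z')).
    move=> _ [s /= s01 <-]; rewrite in_itv/= in s01.
    have ct : continuous (fun p : E * E => pre p.1 z p.2).
      apply: pre_cont => p; [exact: cvg_fst|exact: cvg_cst|exact: cvg_snd].
    have := ct (c s, z); rewrite /continuous_at /= => /(_ [set r | 0 < r]) /=.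
    apply; apply: lt_nbhsr; have [h1 h2] := Wc z s Wz s01.
    by apply: pre_gt0 => //; [exact: sc|exact: Ws].
  move=> h; apply: filterS h => z' h _.
  have h' : rho z z' by move=> s s01; apply: h; exists s => //=; rewrite in_itv.
  by split=> // s s01; rewrite pre_preC; exact: h'.
have [n [d [d0 dn Wd rd]]] := connected_chain cW loc Wx WNx.
apply: (@no_odd_winding _ c (fun i _ => d i) n) => //.
- by move=> i; exact: cst_continuous.
- by move=> s /sc; rewrite sphereE.
- move=> s i s01 _; have [h1 h2] := Wc (d i) s (Wd i) s01.
  by apply: pre_gt0 => //; [exact: sc|exact: Ws].
- by move=> s i s01 i_n; exact: rd.
- by move=> s _; rewrite dn d0.
- rewrite -sumrN; apply: eq_bigr => i _.
  by rewrite c1 pre_Nc pim_Nc mulNr atanN.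
Qed.

Let e (j : 'I_3) : E := delta_mx 0 j.
Let i0 : 'I_3 := @Ordinal 3 0 isT.
Let i1 : 'I_3 := @Ordinal 3 1 isT.
Let i2 : 'I_3 := @Ordinal 3 2 isT.

(** For fixed s, half a great circle from a pole (t = 0) to the opposite pole (t = 1), at longitude
    pi s. The meridian at s = 1 is the antipode of the one at s = 0, traversed backwards. *)
Definition meridian (s t : R) : E :=
  cos (pi * t) *: e i0 + (sin (pi * t) * cos (pi * s)) *: e i1 + (sin (pi * t) * sin (pi * s)) *: e i2.

Lemma meridian_sphere s t : sphere (meridian s t).
Proof.
rewrite sphereE /dot !mxE/= !mulr0 !mulr1 !addr0 !add0r.
have := cos2Dsin2 (pi * t); have := cos2Dsin2 (pi * s).
set a := cos _; set b := sin _; set c' := cos _; set d := sin _ => h1 h2.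
transitivity (c' ^+ 2 + d ^+ 2 * (a ^+ 2 + b ^+ 2)); first by ring.
by rewrite h1 mulr1.
Qed.

Lemma meridian1 t : meridian 1 t = - meridian 0 (1 - t).
Proof.
rewrite /meridian !mulr1 mulrBr !mulr1 !mulr0 cos0 sin0 cospi sinpi.
rewrite cosB sinB cospi sinpi.
apply/matrixP => i j; rewrite !mxE; ring.
Qed.

Lemma meridian_cont : continuous (fun p : R * R => meridian p.1 p.2).
Proof.
move=> p.
have c1 (f : R * R -> R) : {for p, continuous f} -> {for p, continuous (fun p => cos (pi * f p))}.
  move=> cf; apply: (@continuous_cvg _ _ _ _ _ _ (@cos R)); first exact: continuous_cos.
  by apply: cvgM => //; exact: cvg_cst.
have s1 (f : R * R -> R) : {for p, continuous f} -> {for p, continuous (fun p => sin (pi * f p))}.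
  move=> cf; apply: (@continuous_cvg _ _ _ _ _ _ (@sin R)); first exact: continuous_sin.
  by apply: cvgM => //; exact: cvg_cst.
have f1 : {for p, continuous (@fst R R)} by exact: cvg_fst.
have f2 : {for p, continuous (@snd R R)} by exact: cvg_snd.
by apply: cvgD; [apply: cvgD|]; (apply: cvgZ; last exact: cvg_cst);
  try apply: cvgM; first [exact: (c1 _ f1)|exact: (s1 _ f1)|exact: (c1 _ f2)|exact: (s1 _ f2)].
Qed.

(** The Borsuk-Ulam theorem for the 2-sphere: an odd map h takes some value on the line spanned
    by x; positivity of [pre x (h y) (h y)] says that h y is not on that line. Otherwise h
    maps each meridian to a path from a point to its opposite around this line; exchanging
    the meridians s = 0 and s = 1 reverses the path and its total angle. *)
Theorem borsuk_ulam (h : E -> E) x : sphere x -> {within sphere (R := R), continuous h} ->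
  (forall y, sphere y -> h (- y) = - h y) ->
  (forall y, sphere y -> 0 < pre x (h y) (h y)) -> False.
Proof.
move=> sx ch hodd hx.
pose g s t := h (meridian s t).
have cg : continuous (fun p : R * R => g p.1 p.2).
  apply: (@continuous_within_comp _ _ _ (sphere (R := R)) (fun p : R * R => meridian p.1 p.2)) => //.
    exact: meridian_cont.
  by move=> p; exact: meridian_sphere.
have cgs t : continuous (fun s => g s t).
  move=> s; apply: (@continuous_comp _ _ _ (fun s => (s, t)) (fun p : R * R => g p.1 p.2)).
    exact: (cvg_pair (f := fun s => s) (g := fun=> t) cvg_id (cvg_cst _)).
  exact: cg.
pose rho1 t t' := forall s, 0 <= s <= 1 -> 0 < pre x (g s t) (g s t').
have loc1 t : \forall t' \near t, rho1 t t'.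
  have : \forall t' \near t, `[0, 1]%classic `<=` (fun s : R => 0 < pre x (g s t) (g s t')).
    apply: ((compact_near_coveringP _).1 (@segment_compact R 0 1)
      R (nbhs t) (fun t' s => 0 < pre x (g s t) (g s t'))).
    move=> s _.
    have ct : continuous (fun p : R * R => pre x (g p.1 t) (g p.1 p.2)).
      apply: pre_cont => [p|p|]; [exact: cvg_cst| |exact: cg].
      by apply: (@continuous_comp _ _ _ fst (fun s => g s t)); [exact: cvg_fst|exact: cgs].
    have := ct (s, t); rewrite /continuous_at /= => /(_ [set r | 0 < r]) /=.
    by apply; apply: lt_nbhsr; apply: hx; exact: meridian_sphere.
  by move=> H; apply: filterS H => t' H s s01; apply: H; rewrite /= in_itv.
pose rho t t' := rho1 t t' /\ rho1 (1 - t) (1 - t').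
have rhoC t t' : rho t t' -> rho t' t.
  by move=> [h1 h2]; split=> s s01; rewrite pre_preC; [exact: h1|exact: h2].
have loc t : \forall t' \near t, rho t t'.
  apply: filterI; first exact: loc1.
  have : (fun t' => 1 - t') @ t --> 1 - t by apply: cvgB; [exact: cvg_cst|exact: cvg_id].
  by move=> /(_ _ (loc1 (1 - t))).
have [n [d [d0 dn Wd rd]]] : exists (n : nat) (d : nat -> R), [/\ d 0%N = 0, d n = 2^-1, forall i, `[0, 2^-1]%classic (d i) &
    forall i, (i < n)%N -> rho (d i) (d i.+1)].
  apply: connected_chain.
  - exact: segment_connected.
  - by move=> z _; apply: filterS (loc z) => z' hz _; split=> //; exact: rhoC.
  - by rewrite /= in_itv/=; lra.
  - by rewrite /= in_itv/=; lra.
(* a subdivision of [0, 1] that is symmetric under t |-> 1 - t *)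
pose T i := if (i <= n)%N then d i else 1 - d (n + n - i)%N.
have T0 : T 0%N = 0 by rewrite /T leq0n.
have Trev i : (i <= n + n)%N -> T (n + n - i)%N = 1 - T i.
  move=> i2n; rewrite /T; case: leqP => h1; case: leqP => h2.
  - have -> : i = n by lia.
    by rewrite addnK dn; lra.
  - by lra.
  - by rewrite subKn.
  - lia.
have Tr i : (i < n + n)%N -> rho1 (T i) (T i.+1).
  move=> i2n; rewrite /T; case: (ltnP i n) => h1.
    by rewrite (ltnW h1); case: (rd i h1).
  have e1 : (n + n - i.+1 < n)%N by lia.
  have [_ r1] := rhoC _ _ (rd _ e1).
  have e2 : (n + n - i.+1).+1 = (n + n - i)%N by lia.
  rewrite e2 in r1.
  case: (leqP i n) => h3 //.
  have e3 : i = n by lia.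
  rewrite e3 dn.
  by move: r1; rewrite e3 addnK dn (_ : 1 - 2^-1 = 2^-1)//; lra.
apply: (@no_odd_winding _ (fun=> x) (fun i s => g s (T i)) (n + n)%N) => //.
- exact: cst_continuous.
- by move=> i; apply: continuous_subspaceT; exact: cgs.
- by move=> *; rewrite -sphereE.
- by move=> s i _ _; apply: hx; exact: meridian_sphere.
- by move=> s i s01 i2n; exact: Tr.
- move=> s _; have := Trev 0%N (leq0n _); rewrite subn0 T0 subr0 => ->.
  rewrite /g -hodd; last exact: meridian_sphere.
  congr h; rewrite /meridian !mulr0 !mulr1 cos0 sin0 cospi sinpi !mul0r !scale0r !addr0.
  by rewrite scaleN1r scale1r.
- rewrite -sumrN (reindex_inj rev_ord_inj); apply: eq_bigr => i _ /=.
  have e1 : (n + n - i.+1 <= n + n)%N by lia.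
  have e2 : (n + n - i.+1).+1 = (n + n - i)%N by have := ltn_ord i; lia.
  have gE j : (j <= n + n)%N -> g 1 (T (n + n - j)%N) = - g 0 (T j).
    move=> jn; rewrite /g Trev// meridian1 hodd; last exact: meridian_sphere.
    by congr (- h (meridian 0 _)); lra.
  rewrite e2 !gE//; [|exact: ltnW].
  by rewrite pre_Nd pim_Nd pre_preC pim_anti mulNr atanN.
Qed.

End BU.

(** * Components of the complement of a symmetric curve *)

Lemma within_comp (S T U : topologicalType) (B : set S) (A : set T) (f : S -> T) (h : T -> U) :
  {within B, continuous f} -> (forall t, B t -> A (f t)) -> {within A, continuous h} ->
  {within B, continuous (h \o f)}.
Proof.
move=> /subspace_continuousP cf Af /subspace_continuousP ch.
apply/subspace_continuousP => t Bt V /= hV.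
have := cf t Bt _ (ch (f t) (Af t Bt) V hV); rewrite /= /within/= !nbhs_simpl/=.
by apply: filterS => t' h' Bt'; apply: h' => //; exact: Af.
Qed.

Lemma within_eq (T U : topologicalType) (A : set T) (f g : T -> U) :
  (forall t, A t -> f t = g t) -> {within A, continuous f} -> {within A, continuous g}.
Proof.
by move=> fg; apply: subspace_eq_continuous => t; rewrite inE; exact: fg.
Qed.

(** A continuous injection of a compact set is a homeomorphism onto its image. *)
Lemma compact_inverse (S : ptopologicalType) (T : topologicalType) (K : set S) (f : S -> T) : hausdorff_space T ->
  compact K -> closed K -> {within K, continuous f} ->
  (forall s t, K s -> K t -> f s = f t -> s = t) ->
  exists g : T -> S, {within f @` K, continuous g} /\ (forall t, K t -> g (f t) = t).
Proof.
move=> hT cK clK cf inj.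
pose g y := get [set t | K t /\ f t = y].
have gf t : K t -> g (f t) = t.
  move=> Kt; have [|Kg fg] := @getPex _ [set t' | K t' /\ f t' = f t]; first by exists t.
  exact: inj.
clearbody g.
exists g; split => //; apply/continuous_closedP => A cA; apply/closed_subspaceP.
exists (f @` (K `&` A)).
  apply: compact_closed => //; apply: continuous_compact.
    by apply: continuous_subspaceW cf => t [].
  exact: compact_closedI.
apply/seteqP; split => y.
  by move=> [[t [Kt At] <-]] _; split; [by change (A (g (f t))); rewrite gf|exists t].
move=> [Ay [t Kt e]]; subst y; have At : A t by change (A (g (f t))) in Ay; rewrite gf in Ay.
by split; exists t.
Qed.

Section Sphere.
Variable R : realType.
Notation E := 'rV[R]_3.
Notation S2 := (sphere (R := R)).
Implicit Types (x y z : E) (C H : set E).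

Lemma closed_sphere : closed S2.
Proof.
have -> : S2 = (fun y => dot y y) @^-1` [set 1].
  by apply/seteqP; split => y /=; rewrite sphereE.
apply: preimage_closed; last exact: closed_eq.
by move=> y _; apply: dot_cont => z; exact: cvg_id.
Qed.

(** Central projection to the sphere. *)
Definition nmz (z : E) : E := (Num.sqrt (dot z z))^-1 *: z.

Lemma nmz_sphere z : 0 < dot z z -> S2 (nmz z).
Proof.
move=> h; rewrite sphereE /nmz dotZl dotZr mulrA -invfM -expr2 sqr_sqrtr ?ltW//.
by rewrite mulVf// gt_eqF.
Qed.

Lemma nmz_id z : S2 z -> nmz z = z.
Proof. by rewrite sphereE /nmz => ->; rewrite sqrtr1 invr1 scale1r. Qed.

Lemma nmz_cvg (T : Type) (F : set_system T) (FF : Filter F) (f : T -> E) z :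
  f @ F --> z -> 0 < dot z z -> nmz (f t) @[t --> F] --> nmz z.
Proof.
move=> cf h; rewrite /nmz.
have cd : dot (f t) (f t) @[t --> F] --> dot z z.
  have ct : continuous (fun y : E => dot y y) by apply: dot_cont => y; exact: cvg_id.
  exact: (continuous_cvg FF (ct z) cf).
apply: cvgZ => //; apply: cvgV; first by rewrite gt_eqF// sqrtr_gt0.
exact: (continuous_cvg FF (@sqrt_continuous R (dot z z)) cd).
Qed.

(** The sphere is locally connected. *)
Lemma cap_connected y (U : set E) : S2 y -> nbhs y U ->
  \forall y' \near y, S2 y' -> exists K, [/\ connected K, K y, K y' & K `<=` S2 `&` U].
Proof.
move=> Sy Uy.
have dy : 0 < dot y y by move: Sy; rewrite sphereE => ->.
have : \forall z \near y, U (nmz z) /\ 0 < dot z z.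
  apply: filterI.
    have := @nmz_cvg _ (nbhs y) (nbhs_filter y) id y (@cvg_id _ _) dy.
    by rewrite nmz_id// => h; exact: (h _ Uy).
  have ct : continuous (fun z : E => dot z z) by apply: dot_cont => z; exact: cvg_id.
  by have := ct y [set r | 0 < r]; apply; exact: lt_nbhsr.
move=> /nbhs_ballP[e /= e0 he]; apply/nbhs_ballP; exists e => //= y' yy' Sy'.
pose seg s := y + s *: (y' - y).
have segb s : 0 <= s <= 1 -> ball y e (seg s).
  move=> /andP[s0 s1]; move: yy'; rewrite -!ball_normE/= /seg opprD addNKr normrN normrZ => h.
  rewrite distrC in h; apply: le_lt_trans h; rewrite ger0_norm//.
  by rewrite ler_piMl.
have cs : continuous seg.
  by move=> s; apply: cvgD; [exact: cvg_cst|apply: cvgZ; [exact: cvg_id|exact: cvg_cst]].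
exists ((nmz \o seg) @` `[0, 1]); split.
- apply: connected_continuous_connected; first exact: segment_connected.
  apply/subspace_continuousP => s /=; rewrite in_itv/= => s01.
  apply: (@nmz_cvg _ _ _ seg); first exact: cvg_trans (cvg_app _ (cvg_within _)) (cs s).
  by case: (he _ (segb s s01)).
- exists 0; first by rewrite /= in_itv/=; lra.
  by rewrite /= /seg scale0r addr0 nmz_id.
- exists 1; first by rewrite /= in_itv/=; lra.
  by rewrite /= /seg scale1r addrC subrK nmz_id.
- move=> z [s /= s01 <-]; rewrite in_itv/= in s01.
  by have [h1 h2] := he _ (segb s s01); split => //; exact: nmz_sphere.
Qed.

Notation comp C x := (connected_component (S2 `\` C) x).

Lemma comp_locally_const C x y : closed C -> (S2 `\` C) y ->
  \forall y' \near y, S2 y' -> ~ C y' /\ (comp C x y <-> comp C x y').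
Proof.
move=> cC [Sy Cy].
have nC : nbhs y (~` C) by apply: open_nbhs_nbhs; split => //; exact: closed_openC.
have := cap_connected Sy nC; apply: filterS => y' h /h [K [cK Ky Ky' KS]].
have KC : K `<=` S2 `\` C by move=> z /KS.
split; first by case: (KC _ Ky').
have cyy' : comp C y y' by exact: (connected_component_max Ky KC cK).
split => h'; first exact: connected_component_trans h' cyy'.
by apply: connected_component_trans h' _; exact: connected_component_sym.
Qed.

Lemma comp_opp C x y : centrally_symmetric C -> comp C x y -> comp C (- x) (- y).
Proof.
move=> sC [K [Kx KS cK] Ky]; exists (-%R @` K); last by exists y.
split; first by exists x.
  move=> _ [z Kz <-]; have [Sz Cz] := KS _ Kz; split; first exact: sphereN.
  by move=> /sC; rewrite opprK.
apply: connected_continuous_connected => //.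
by apply: continuous_subspaceT => z; exact: opp_continuous.
Qed.

Lemma comp_sub C x : comp C x `<=` S2 `\` C.
Proof. exact: connected_component_sub. Qed.

Section Curve.
Variable C : set E.
Hypotheses (CS : C `<=` S2) (sC : centrally_symmetric C) (scC : simple_closed_curve C).

Lemma curve_compact : compact C.
Proof.
case: scC => f [cf _ _ ->]; apply: continuous_compact => //; exact: segment_compact.
Qed.

Lemma curve_closed : closed C.
Proof. by apply: compact_closed; [exact: norm_hausdorff|exact: curve_compact]. Qed.

(** A closed curve may be parametrized from any of its points. *)
Lemma curve_rebase y0 : C y0 -> exists f : R -> E,
  [/\ {within `[0, 1], continuous f}, f 0 = y0, f 1 = y0,
      forall s t, 0 <= s < 1 -> 0 <= t < 1 -> f s = f t -> s = t &
      C = f @` `[0, 1]].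
Proof.
case: scC => f [cf f01 inj CE]; rewrite {1}CE => -[t0' /= t01' e0].
have [t0 t01 {}e0] : exists2 t0, 0 <= t0 < 1 & f t0 = y0.
  move: t01'; rewrite in_itv/= => /andP[a b].
  have [tlt|] := ltP t0' 1; first by exists t0' => //; rewrite a.
  move=> c; have e : t0' = 1 by lra.
  by exists 0; [lra|rewrite f01 -e].
(* the parameter is translated by t0 modulo 1 *)
pose f1 t := f (t + t0); pose f2 t := f (t + t0 - 1).
pose F t := if t <= 1 - t0 then f1 t else f2 t.
have F2 t : 1 - t0 <= t -> F t = f2 t.
  rewrite /F; case: (leP t (1 - t0)) => // h h'; have -> : t = 1 - t0 by lra.
  by rewrite /f1 /f2 subrK subrr f01.
have shift_cont (a : R) : continuous (fun t : R => t + a).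
  by move=> t; apply: cvgD; [exact: cvg_id|exact: cvg_cst].
exists F; split.
- have -> : `[0, 1]%classic = `[0, 1 - t0]%classic `|` `[1 - t0, 1]%classic :> set R.
    apply/seteqP; split => t /=; rewrite !in_itv/=; last by case; lra.
    by move=> h; case: (leP t (1 - t0)) => h'; [left|right]; lra.
  apply: withinU_continuous; try exact: interval_closed.
    apply: (@within_eq _ _ _ f1).
      by move=> t /=; rewrite in_itv/= /F => /andP[_ ->].
    change ({within `[0, 1 - t0]%classic, continuous (f \o (fun t => t + t0))}).
    apply: (@within_comp _ R _ _ (`[0, 1]%classic : set R)) => //.
      by apply: continuous_subspaceT; exact: shift_cont.
    by move=> t /=; rewrite !in_itv/=; lra.
  apply: (@within_eq _ _ _ f2).
    by move=> t /=; rewrite in_itv/= => /andP[h _]; rewrite F2.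
  have -> : f2 = f \o (fun t => t + (t0 - 1)) by apply/funext => t; rewrite /f2/= addrA.
  apply: (@within_comp _ R _ _ (`[0, 1]%classic : set R)) => //.
  - by apply: continuous_subspaceT; exact: shift_cont.
  - by move=> t /=; rewrite !in_itv/=; lra.
- by rewrite /F ifT /f1 ?add0r//; lra.
- by rewrite F2 /f2 ?(addrC 1) ?addrK//; lra.
- move=> s t s01 t01''; rewrite /F /f1 /f2.
  have i1 u : 1 - t0 < u -> u < 1 -> 0 <= u + t0 - 1 < 1 by lra.
  have i2 u : 0 <= u -> u < 1 - t0 -> 0 <= u + t0 < 1 by lra.
  have e1 u : u <= 1 - t0 -> ~ u < 1 - t0 -> f (u + t0) = f 0.
    by move=> h1 h2; rewrite f01; congr f; lra.
  case: leP => hs; case: leP => ht.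
  + have [s1|s1] := ltP s (1 - t0); have [t1|t1] := ltP t (1 - t0).
    * by move/inj => h; apply: (addIr t0); apply: h; apply: i2 => //; lra.
    * rewrite [X in _ = X](e1 t)//; last by lra.
      by move/inj => h; have : s + t0 = 0; [apply: h; lra|lra].
    * rewrite [X in X = _](e1 s)//; last by lra.
      by move/inj => h; have : 0 = t + t0; [apply: h; lra|lra].
    * by lra.
  + have [s1|s1] := ltP s (1 - t0).
      by move/inj => h; have : s + t0 = t + t0 - 1; [apply: h; lra|lra].
    rewrite [X in X = _](e1 s)//; last by lra.
    by move/inj => h; have : 0 = t + t0 - 1; [apply: h; lra|lra].
  + have [t1|t1] := ltP t (1 - t0).
      by move/inj => h; have : s + t0 - 1 = t + t0; [apply: h; lra|lra].
    rewrite [X in _ = X](e1 t)//; last by lra.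
    by move/inj => h; have : s + t0 - 1 = 0; [apply: h; lra|lra].
  + by move/inj => h; have : s + t0 - 1 = t + t0 - 1; [apply: h; lra|lra].
- rewrite CE; apply/seteqP; split => y [t /=]; rewrite in_itv/= => tt <-.
    have [h|h] := leP t0 t.
      exists (t - t0); first by rewrite /= in_itv/=; lra.
      by rewrite /F ifT /f1 ?subrK//; lra.
    exists (t - t0 + 1); first by rewrite /= in_itv/=; lra.
    by rewrite F2 /f2; [congr f; lra|lra].
  rewrite /F; case: leP => h.
    by exists (t + t0) => //=; rewrite in_itv/=; lra.
  by exists (t + t0 - 1) => //=; rewrite in_itv/=; lra.
Qed.

(** A symmetric curve separates antipodal points. *)
Lemma comp_disjoint_opp x y : comp C x y -> comp C x (- y) -> False.
Proof.
move=> Hy HNy.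
have [p Cp] : C !=set0.
  by case: scC => f [_ _ _ ->]; exists (f 0), 0 => //=; rewrite in_itv/=; lra.
have [f [cf f0 f1 inj CE]] := curve_rebase Cp.
have [h h01 fh] : exists2 h, 0 <= h <= 1 & f h = - p.
  by have := sC Cp; rewrite CE => -[h /=]; rewrite in_itv/= => ? <-; exists h.
have Cf s : 0 <= s <= 1 -> C (f (s * h)).
  by move=> s01; rewrite CE; exists (s * h) => //=; rewrite in_itv/=; nra.
apply: (@antipodal_separation R (fun s => f (s * h)) (comp C x) y).
- change ({within `[0, 1]%classic, continuous (f \o (fun t : R => t * h))}).
  apply: (@within_comp _ R _ _ (`[0, 1]%classic : set R)) => //.
    by apply: continuous_subspaceT => t; apply: cvgM; [exact: cvg_id|exact: cvg_cst].
  by move=> t /=; rewrite !in_itv/=; nra.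
- by move=> s s01; apply: CS; exact: Cf.
- by rewrite mul1r mul0r f0.
- exact: component_connected.
- by move=> z /comp_sub[].
- move=> z s /comp_sub[_ Cz] s01; split=> e; apply: Cz; rewrite e.
    exact: Cf.
  by apply: sC; exact: Cf.
- exact: Hy.
- exact: HNy.
Qed.

(** Otherwise the boundary of the component H lies in a proper arc f(I) of C. The map r retracts
    the closure of H onto this arc, by extending the inverse of f; applying it on H, its
    conjugate by the antipode on -H and the identity elsewhere yields an odd map h of the sphere
    that avoids x and -x. *)
Theorem comp_boundary x : (S2 `\` C) x -> C `<=` closure (comp C x).
Proof.
move=> Sx y0 Cy0; apply: contrapT => ncl.
set H := comp C x.
have Hx : H x by exact: connected_component_refl.
have [f [cf f0 f1 inj CE]] := curve_rebase Cy0.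
(* near the ends of the parametrization the curve avoids the closure of H *)
have [eta eta0 heta] : exists2 eta, 0 < eta < 2^-1 &
    forall t, 0 <= t <= 1 -> closure H (f t) -> eta <= t <= 1 - eta.
  have ncl' : \forall z \near y0, ~ closure H z.
    by apply: open_nbhs_nbhs; split => //; apply: closed_openC; exact: closed_closure.
  have nb a : 0 <= a <= 1 -> f a = y0 -> exists2 e, 0 < e &
      forall t, 0 <= t <= 1 -> `|a - t| < e -> ~ closure H (f t).
    move=> a01 fa; have ia : `[0, 1]%classic a by rewrite /= in_itv.
    have h : f @ within `[0, 1]%classic (nbhs a) --> f a by exact: ((subspace_continuousP _ _).1 cf a ia).
    rewrite fa in h; have := h _ ncl'.
    rewrite /= /within/= => /nbhs_ballP[e /= e0 he]; exists e => // t t01 ate.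
    by apply: he => //; rewrite ?in_itv// -ball_normE.
  have [|e0 e0p h0] := nb 0 _ f0; first lra.
  have [|e1 e1p h1] := nb 1 _ f1; first lra.
  exists (Num.min (Num.min e0 e1) 4^-1).
    by rewrite !lt_min !gt_min; apply/andP; split; [apply/andP; split; [apply/andP|]|]; try apply/orP; lra.
  move=> t t01 clt; apply/andP; split; rewrite leNgt; apply/negP.
    rewrite !lt_min => /andP[/andP[a b] c]; apply: (h0 t t01) clt.
    by rewrite sub0r normrN ger0_norm//; lra.
  move=> h; have : 1 - t < Num.min (Num.min e0 e1) 4^-1 by lra.
  rewrite !lt_min => /andP[/andP[a b] c]; apply: (h1 t t01) clt.
  by rewrite ger0_norm//; lra.
pose I := `[eta, 1 - eta]%classic : set R.
have I01 t : I t -> 0 <= t < 1 by rewrite /I /= in_itv/=; lra.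
have cfI : {within I, continuous f}.
  by apply: continuous_subspaceW cf => t /I01 /=; rewrite in_itv/=; lra.
have [g0 [cg0 g0f]] : exists g : E -> R, {within f @` I, continuous g} /\ (forall t, I t -> g (f t) = t).
  apply: (@compact_inverse R E) => //; [exact: segment_compact|exact: interval_closed|].
  by move=> s t /I01 ? /I01 ?; exact: inj.
have clJ : closed (f @` I).
  apply: compact_closed; first exact: norm_hausdorff.
  by apply: continuous_compact => //; exact: segment_compact.
have [|g [gg0 cg _]] := @continuous_bounded_extension E R pseudometric_normal (f @` I) clJ g0 1 ltr01 cg0.
  move=> _ [t It <-]; rewrite g0f//; have := I01 t It => /andP[a b].
  by rewrite ger0_norm//; lra.
have gf t : I t -> g (f t) = t.
  by move=> It; rewrite -gg0 ?g0f// inE; exists t.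
pose clamp (t : R) := Num.max eta (Num.min t (1 - eta)).
have clampI t : I (clamp t).
  rewrite /I /= in_itv/= /clamp le_max lexx/= ge_max ge_min lexx orbT andbT.
  by lra.
have clamp_id t : I t -> clamp t = t.
  rewrite /I /= in_itv/= /clamp => /andP[a b].
  by rewrite min_l// max_r.
have cclamp : continuous clamp.
  move=> t; apply: (@continuous_max _ _ (fun=> eta) (fun t => Num.min t (1 - eta))).
    exact: cvg_cst.
  by apply: (@continuous_min _ _ id (fun=> 1 - eta)); [exact: cvg_id|exact: cvg_cst].
pose r y := f (clamp (g y)).
have cr : continuous r.
  apply: (@continuous_within_comp _ _ _ I (clamp \o g) f) => //.
    by move=> z; apply: continuous_comp; [exact: cg|exact: cclamp].
  by move=> t /=; exact: clampI.
have r_id y : (f @` I) y -> r y = y.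
  by move=> [t It <-]; rewrite /r gf// clamp_id.
have rC y : C (r y).
  rewrite CE; exists (clamp (g y)) => //.
  by have /= := I01 _ (clampI (g y)); rewrite in_itv/=; lra.
have clS y : closure H y -> S2 y.
  by move=> h; apply: closed_sphere; apply: closureS h => z /comp_sub[].
(* points of the closure outside H are on the arc *)
have bdJ y : closure H y -> ~ H y -> (f @` I) y.
  move=> cly nHy; have [Cy|nCy] := pselect (C y).
    move: Cy (cly); rewrite {1}CE => -[t /=]; rewrite in_itv/= => t01 <- /(heta t t01) tI.
    by exists t => //; rewrite /I /= in_itv.
  have SCy : (S2 `\` C) y by split => //; exact: clS.
  have := comp_locally_const x curve_closed SCy => /cly[z [Hz h]].
  have [Sz _] := comp_sub Hz.
  by have [_ h'] := h Sz; case: nHy; apply/h'.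
have HN y : H y -> closure H (- y) -> False.
  move=> Hy; have [Sy Cy] := comp_sub Hy.
  have SCNy : (S2 `\` C) (- y).
    by split; [exact: sphereN|move=> /sC; rewrite opprK].
  have := comp_locally_const x curve_closed SCNy => + cly => /cly[z [Hz h]].
  have [Sz _] := comp_sub Hz; have [_ h'] := h Sz.
  by apply: (@comp_disjoint_opp x y Hy); apply/h'.
pose h y := if `[< closure H y >] then r y else
            if `[< closure H (- y) >] then - r (- y) else y.
have h1 y : closure H y -> h y = r y by rewrite /h => /asboolP ->.
have h2 y : closure H (- y) -> h y = - r (- y).
  rewrite /h => hy; case: asboolP => hy'; last by rewrite (asboolT hy).
  have nHy : ~ H y by move=> Hy; exact: (HN y).
  have nHNy : ~ H (- y) by move=> Hy; apply: (HN (- y)); rewrite ?opprK.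
  by rewrite !r_id ?opprK//; exact: bdJ.
have h3 y : ~ H y -> ~ H (- y) -> h y = y.
  rewrite /h => nH nHN; case: asboolP => [cly|_]; first by rewrite r_id//; exact: bdJ.
  by case: asboolP => [cly|//]; rewrite r_id ?opprK//; exact: bdJ.
have hodd y : h (- y) = - h y.
  have [cly|ncly] := pselect (closure H y).
    by rewrite (h1 y)// h2 opprK.
  have [cly'|ncly'] := pselect (closure H (- y)).
    by rewrite (h1 (- y))// h2// opprK.
  by rewrite !h3 ?opprK//; move/subset_closure.
pose A3 := S2 `&` [set y | ~ H y /\ ~ H (- y)].
have clA3 : closed A3.
  move=> y cly; have Sy : S2 y by apply: closed_sphere; apply: closureS cly => z [].
  split => //=; split => Hy.
    have := comp_locally_const x curve_closed (comp_sub Hy) => /cly[z [[Sz [nHz _]] hz]].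
    by have [_ [h' _]] := hz Sz; apply: nHz; apply: h'.
  have := comp_locally_const x curve_closed (comp_sub Hy).
  have oc : (fun z : E => - z) @ y --> - y by exact: opp_continuous.
  move=> /oc /=; rewrite nbhs_simpl/= => /cly[z [[Sz [_ nHz]] hz]].
  by have [_ [h' _]] := hz (sphereN Sz); apply: nHz; apply: h'.
have ch : {within S2, continuous h}.
  have -> : S2 = (closure H `|` (-%R @^-1` closure H)) `|` A3.
    apply/seteqP; split => y.
      move=> Sy; have [cly|ncly] := pselect (closure H y); first by left; left.
      have [cly'|ncly'] := pselect (closure H (- y)); first by left; right.
      by right; split => //; split => /subset_closure.
    by move=> [[/clS//|h']|[]//]; rewrite -[y]opprK; apply/sphereN/clS.
  have clN : closed (-%R @^-1` closure H).
    by apply: preimage_closed; [move=> z _; exact: opp_continuous|exact: closed_closure].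
  apply: withinU_continuous => //; first by apply: closedU => //; exact: closed_closure.
    apply: withinU_continuous => //; first exact: closed_closure.
      by apply: (@within_eq _ _ _ r) => [z /h1//|]; apply: continuous_subspaceT.
    apply: (@within_eq _ _ _ (fun z => - r (- z))) => [z /h2//|].
    apply: continuous_subspaceT => z.
    have oc : (fun z : E => - z) @ z --> - z by exact: opp_continuous.
    have rc : r (- t) @[t --> z] --> r (- z) by exact: (continuous_cvg _ (cr (- z)) oc).
    exact: cvgN rc.
  by apply: (@within_eq _ _ _ id) => [z [_ [? ?]]|]; [rewrite h3|apply: continuous_subspaceT => z; exact: cvg_id].
have [Ssx nCx] := Sx.
have hS y : S2 y -> [/\ S2 (h y), h y <> x & h y <> - x].
  move=> Sy; have CC u : C u -> [/\ S2 u, u <> x & u <> - x].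
    move=> Cu; split; [exact: CS|by move=> e; apply: nCx; rewrite -e|].
    by move=> e; apply: nCx; rewrite -[x]opprK -e; exact: sC.
  have [cly|ncly] := pselect (closure H y); first by rewrite h1//; exact: CC.
  have [cly'|ncly'] := pselect (closure H (- y)); first by rewrite h2//; apply: CC; exact: sC.
  rewrite h3; [|by move/subset_closure|by move/subset_closure].
  split => // e; first by apply: ncly; rewrite e; exact: subset_closure.
  by apply: ncly'; rewrite e opprK; exact: subset_closure.
apply: (@borsuk_ulam R h x) => //.
by move=> y /hS[? ? ?]; apply: pre_gt0.
Qed.

End Curve.
End Sphere.

(** * Arcs, orientations and crossings *)

Section Arcs.
Variable R : realType.
Notation E := 'rV[R]_3.
Notation S2 := (sphere (R := R)).

(** A curve A cut at e and -e into two simple arcs phi and psi, both parametrized by [0, 1]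
    from e to -e. *)
Record arcs (A : set E) (e : E) (phi psi : R -> E) : Prop := Arcs {
  arcs_cont1 : {within `[0, 1], continuous phi};
  arcs_cont2 : {within `[0, 1], continuous psi};
  arcs_start1 : phi 0 = e;
  arcs_start2 : psi 0 = e;
  arcs_end1 : phi 1 = - e;
  arcs_end2 : psi 1 = - e;
  arcs_inj1 : forall s t, 0 <= s <= 1 -> 0 <= t <= 1 -> phi s = phi t -> s = t;
  arcs_inj2 : forall s t, 0 <= s <= 1 -> 0 <= t <= 1 -> psi s = psi t -> s = t;
  arcs_disj1 : forall s t, 0 < s < 1 -> 0 <= t <= 1 -> phi s <> psi t;
  arcs_disj2 : forall s t, 0 < s < 1 -> 0 <= t <= 1 -> psi s <> phi t;
  arcs_in1 : forall t, 0 <= t <= 1 -> A (phi t);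
  arcs_in2 : forall t, 0 <= t <= 1 -> A (psi t);
  arcs_cover : forall y, A y -> exists2 t, 0 <= t <= 1 & y = phi t \/ y = psi t }.

Lemma arcs_sym A e phi psi : arcs A e phi psi -> arcs A e psi phi.
Proof.
case=> c1 c2 s1 s2 e1 e2 j1 j2 d1 d2 n1 n2 cov; split=> // y /cov[t t01 [] ->].
  by exists t => //; right.
by exists t => //; left.
Qed.

Lemma reparam_cont (f : R -> E) (a b : R) : {within `[0, 1], continuous f} ->
  (forall t, 0 <= t <= 1 -> 0 <= a * t + b <= 1) ->
  {within `[0, 1], continuous (fun t => f (a * t + b))}.
Proof.
move=> cf h; change ({within `[0, 1]%classic, continuous (f \o (fun t : R => a * t + b))}).
apply: (@within_comp _ R _ _ (`[0, 1]%classic : set R)) => //.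
  apply: continuous_subspaceT => t; apply: cvgD; last exact: cvg_cst.
  by apply: cvgM; [exact: cvg_cst|exact: cvg_id].
Qed.

Lemma arcs_rev A e phi psi : arcs A e phi psi ->
  arcs A (- e) (fun t => phi (1 - t)) (fun t => psi (1 - t)).
Proof.
have rc (f : R -> E) : {within `[0, 1], continuous f} -> {within `[0, 1], continuous (fun t => f (1 - t))}.
  move=> cf; have -> : (fun t => f (1 - t)) = (fun t => f (-1 * t + 1)).
    by apply/funext => t; congr f; lra.
  by apply: reparam_cont => // t t01; lra.
move=> h; split.
- exact/rc/(arcs_cont1 h).
- exact/rc/(arcs_cont2 h).
- by rewrite subr0 (arcs_end1 h).
- by rewrite subr0 (arcs_end2 h).
- by rewrite subrr (arcs_start1 h) opprK.
- by rewrite subrr (arcs_start2 h) opprK.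
- by move=> s t s01 t01 e1; have := arcs_inj1 h _ _ e1; lra.
- by move=> s t s01 t01 e1; have := arcs_inj2 h _ _ e1; lra.
- by move=> s t s01 t01; apply: (arcs_disj1 h); lra.
- by move=> s t s01 t01; apply: (arcs_disj2 h); lra.
- by move=> t t01; apply: (arcs_in1 h); lra.
- by move=> t t01; apply: (arcs_in2 h); lra.
- move=> y /(arcs_cover h)[t t01 [] ->]; (exists (1 - t); first lra);
    rewrite (_ : 1 - (1 - t) = t); auto; lra.
Qed.

(** That phi and psi are antipodal to each other is not claimed. *)
Lemma arcs_exist (A : set E) e : A `<=` S2 -> centrally_symmetric A -> simple_closed_curve A ->
  A e -> exists phi psi, arcs A e phi psi.
Proof.
move=> AS sA scA Ae; have [f [cf f0 f1 inj AE]] := curve_rebase scA Ae.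
have Af t : 0 <= t <= 1 -> A (f t) by move=> t01; rewrite AE; exists t => //=; rewrite in_itv.
have [h h01 fh] : exists2 h, 0 < h < 1 & f h = - e.
  have := sA _ Ae; rewrite {1}AE => -[h /=]; rewrite in_itv/= => h01 fh; exists h => //.
  have ne : e <> - e by apply: sphere_neqN; exact: AS.
  have h0 : h != 0 by apply: contra_notN ne => /eqP h0; rewrite -fh h0 f0.
  have h1 : h != 1 by apply: contra_notN ne => /eqP h1; rewrite -fh h1 f1.
  by rewrite !lt_neqAle eq_sym h0 h1.
exists (fun t => f (h * t + 0)), (fun t => f ((h - 1) * t + 1)); split.
- by apply: reparam_cont => // t t01; nra.
- by apply: reparam_cont => // t t01; nra.
- by rewrite mulr0 addr0.
- by rewrite mulr0 add0r.
- by rewrite mulr1 addr0.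
- by rewrite mulr1 subrK.
- move=> s t s01 t01 /inj k; have : h * s + 0 = h * t + 0 by apply: k; nra.
  by rewrite !addr0 => /(mulfI _); apply; rewrite gt_eqF//; lra.
- have key s : 0 < s <= 1 -> f 1 = f ((h - 1) * s + 1) -> False.
    by move=> s01; rewrite f1 -f0 => /inj k; have : 0 = (h - 1) * s + 1; [apply: k; nra|nra].
  move=> s t s01 t01.
  have [s0|s0] := eqVneq s 0; have [t0|t0] := eqVneq t 0.
  + by rewrite s0 t0.
  + rewrite {1}s0 mulr0 add0r => /key; case; rewrite lt_def t0; lra.
  + rewrite {1}t0 mulr0 add0r => /esym/key; case; rewrite lt_def s0; lra.
  + have s0' : 0 < s by rewrite lt_def s0; lra.
    have t0' : 0 < t by rewrite lt_def t0; lra.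
    move/inj => k; have : (h - 1) * s + 1 = (h - 1) * t + 1 by apply: k; nra.
    by move/addIr/mulfI; apply; rewrite lt_eqF//; lra.
- move=> s t s01 t01; have [t0|t0] := eqVneq t 0.
    by rewrite t0 mulr0 add0r f1 -f0 => /inj k; have : h * s + 0 = 0; [apply: k; nra|nra].
  have t0' : 0 < t by rewrite lt_def t0; lra.
  by move/inj => k; have : h * s + 0 = (h - 1) * t + 1; [apply: k; nra|nra].
- move=> s t s01 t01.
  by move/inj => k; have : (h - 1) * s + 1 = h * t + 0; [apply: k; nra|nra].
- by move=> t t01; apply: Af; nra.
- by move=> t t01; apply: Af; nra.
- move=> y; rewrite AE => -[t /=]; rewrite in_itv/= => t01 <-.
  have [th|th] := leP t h.
    exists (t / h); first by rewrite divr_ge0 ?ler_pdivrMr; lra.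
    by left; rewrite addr0 mulrC divfK// gt_eqF//; lra.
  exists ((1 - t) / (1 - h)); first by rewrite divr_ge0 ?ler_pdivrMr; lra.
  by right; congr f; field; rewrite gt_eqF//; lra.
Qed.

(** The two sides of A are antipodal, and g is a sign function for them: it is odd, vanishes exactly
    on A, and its positive part is open and connected, with all of A in its closure. No continuity
    of g is needed. *)
Record oriented (A : set E) (g : E -> R) : Prop := Oriented {
  or_sub : A `<=` S2;
  or_sym : centrally_symmetric A;
  or_curve : simple_closed_curve A;
  or_odd : forall y, g (- y) = - g y;
  or_zero : forall y, S2 y -> (g y = 0 <-> A y);
  or_open : forall y, S2 y -> 0 < g y -> \forall z \near y, S2 z -> 0 < g z;
  or_conn : connected [set y | S2 y /\ 0 < g y];
  or_bd : A `<=` closure [set y | S2 y /\ 0 < g y] }.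

Lemma oriented_neg_open A g y : oriented A g -> S2 y -> g y < 0 ->
  \forall z \near y, S2 z -> g z < 0.
Proof.
move=> og Sy gy; have := @or_open _ _ og (- y) (sphereN Sy).
rewrite (or_odd og) oppr_gt0 => /(_ gy) h.
have oc : (fun z : E => - z) @ y --> - y by exact: opp_continuous.
have := oc _ h; rewrite /= nbhs_simpl/=; apply: filterS => z hz Sz.
by have := hz (sphereN Sz); rewrite (or_odd og) oppr_gt0.
Qed.

Lemma oriented_neg_bd A g y : oriented A g -> A y -> closure [set y | S2 y /\ g y < 0] y.
Proof.
move=> og Ay U Uy; have := or_bd og (or_sym og Ay).
have oc : (fun z : E => - z) @ (- y) --> y by rewrite -{2}[y]opprK; exact: opp_continuous.
move=> /(_ _ (oc _ Uy))[z [[Sz gz] Uz]]; exists (- z); split => //.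
by split; [exact: sphereN|rewrite (or_odd og) oppr_lt0].
Qed.

Lemma oriented_opp A g : oriented A g -> oriented A (fun y => - g y).
Proof.
move=> og; have [? ? ? odd zero op conn bd] := og; split => //.
- by move=> y; rewrite odd.
- move=> y Sy; rewrite -zero//; split=> [/eqP|->]; last by rewrite oppr0.
  by rewrite oppr_eq0 => /eqP.
- move=> y Sy gy; have := oriented_neg_open og Sy; rewrite -oppr_gt0 => /(_ gy).
  by apply: filterS => z h Sz; rewrite oppr_gt0; exact: h.
- have -> : [set y | S2 y /\ 0 < - g y] = -%R @` [set y | S2 y /\ 0 < g y].
    apply/seteqP; split=> y.
      move=> [Sy gy]; exists (- y); last by rewrite opprK.
      by split; [exact: sphereN|rewrite odd].
    by move=> [z [Sz gz] <-]; split; [exact: sphereN|rewrite odd opprK].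
  apply: connected_continuous_connected => //.
  by apply: continuous_subspaceT => z; exact: opp_continuous.
- move=> y Ay; have := oriented_neg_bd og Ay.
  by apply: closureS => z [Sz]; rewrite -oppr_gt0.
Qed.

Section Path.
Variables (A : set E) (g : E -> R) (phi : R -> E).
Hypotheses (og : oriented A g) (cphi : {within `[0, 1], continuous phi}).
Hypothesis Sphi : forall t, 0 <= t <= 1 -> S2 (phi t).

Lemma path_pos (W : set R) a b : connected W -> (forall t, W t -> 0 <= t <= 1) ->
  (forall t, W t -> g (phi t) <> 0) -> W a -> W b -> 0 < g (phi a) -> 0 < g (phi b).
Proof.
move=> cW W01 nz Wa Wb; apply: (connected_const (P := fun t => 0 < g (phi t)) cW) => //.
move=> t Wt; have t01 := W01 t Wt.
have cphi' : phi @ within `[0, 1]%classic (nbhs t) --> phi t.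
  by apply: ((subspace_continuousP _ _).1 cphi); rewrite /= in_itv.
have /orP[gn|gp] : (g (phi t) < 0) || (0 < g (phi t)) by rewrite -neq_lt; exact/eqP/nz.
  have H : \forall s \near t, `[0, 1]%classic s -> S2 (phi s) -> g (phi s) < 0.
    exact: (cphi' _ (oriented_neg_open og (Sphi t01) gn)).
  apply: filterS H => t' h Wt'.
  have t'01 := W01 _ Wt'.
  have gn' : g (phi t') < 0 by apply: h; rewrite ?in_itv//; exact: Sphi.
  by split=> k; have := lt_trans k _; [move=> /(_ _ gn)|move=> /(_ _ gn')]; rewrite ltxx.
have H : \forall s \near t, `[0, 1]%classic s -> S2 (phi s) -> 0 < g (phi s).
  exact: (cphi' _ (or_open og (Sphi t01) gp)).
apply: filterS H => t' h Wt'.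
have t'01 := W01 _ Wt'.
have gp' : 0 < g (phi t') by apply: h; rewrite ?in_itv//; exact: Sphi.
by split.
Qed.

End Path.

Lemma path_sign (A : set E) (g : E -> R) (phi : R -> E) (W : set R) a b : oriented A g -> {within `[0, 1], continuous phi} ->
  (forall t, 0 <= t <= 1 -> S2 (phi t)) -> connected W -> (forall t, W t -> 0 <= t <= 1) ->
  (forall t, W t -> g (phi t) <> 0) -> W a -> W b -> 0 < g (phi a) * g (phi b).
Proof.
move=> og cphi Sphi cW W01 nz Wa Wb.
have /orP[gn|gp] : (g (phi a) < 0) || (0 < g (phi a)) by rewrite -neq_lt; exact/eqP/nz.
  rewrite nmulr_rgt0//; have := path_pos (oriented_opp og) cphi Sphi cW W01 _ Wa Wb.
  rewrite !oppr_gt0; apply => // t Wt /eqP; rewrite oppr_eq0 => /eqP; exact: nz.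
by rewrite pmulr_rgt0//; exact: (path_pos og cphi Sphi cW W01 nz Wa Wb).
Qed.

Lemma path_zero (A : set E) (g : E -> R) (phi : R -> E) : oriented A g -> {within `[0, 1], continuous phi} ->
  (forall t, 0 <= t <= 1 -> S2 (phi t)) -> g (phi 0) * g (phi 1) < 0 ->
  exists2 x, 0 < x < 1 & g (phi x) = 0.
Proof.
move=> og cphi Sphi neg; apply: contrapT => nz.
have := @path_sign A g phi `[0, 1]%classic 0 1 og cphi Sphi (@segment_connected _ _ _).
have h : 0 < g (phi 0) * g (phi 1) -> False by lra.
move=> k; apply: h; apply: k; rewrite /= ?in_itv/= ?lexx ?ler01//.
move=> t; rewrite in_itv/= => t01 gt; apply: nz.
have t0 : t != 0 by apply: contraTneq neg => t0; rewrite t0 in gt; rewrite gt mul0r ltxx.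
have t1 : t != 1 by apply: contraTneq neg => t1; rewrite t1 in gt; rewrite gt mulr0 ltxx.
by exists t => //; rewrite !lt_neqAle eq_sym t0 t1.
Qed.

(** Crossing of two curves in exactly two points; for symmetric curves these are antipodal
    ([meet2_opp]). *)
Definition meet2 (A B : set E) : Prop := exists p q, p <> q /\ A `&` B = [set p; q].

Lemma meet2_sym A B : meet2 A B -> meet2 B A.
Proof. by move=> [p [q [pq e]]]; exists p, q; rewrite setIC. Qed.

Lemma meet2_opp (A B : set E) w y : A `<=` S2 -> centrally_symmetric A -> centrally_symmetric B ->
  meet2 A B -> A w -> B w -> A y -> B y -> y = w \/ y = - w.
Proof.
move=> AS sA sB [p [q [pq AB]]] Aw Bw Ay By.
have ABE z : (A `&` B) z -> z = p \/ z = q by rewrite AB.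
have wN := sphere_neqN (AS _ Aw).
have hNw : (A `&` B) (- w) by split; [exact: sA|exact: sB].
have hw : (A `&` B) w by [].
have hy : (A `&` B) y by [].
case: (ABE _ hw) => ew; case: (ABE _ hNw) => eNw; case: (ABE _ hy) => ey;
  first [by case: wN; rewrite eNw ew|by left; rewrite ew ey|by right; rewrite eNw ey].
Qed.

Lemma arcs_S A e phi psi : A `<=` S2 -> arcs A e phi psi ->
  (forall t, 0 <= t <= 1 -> S2 (phi t)) /\ (forall t, 0 <= t <= 1 -> S2 (psi t)).
Proof. by move=> AS h; split=> t t01; apply: AS; [exact: (arcs_in1 h)|exact: (arcs_in2 h)]. Qed.

(** Each of the two arcs from e to -e joins opposite sides of B, hence meets B; as there are only
    two intersection points, each arc meets B once and the sign of B changes there. *)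
Lemma one_crossing A B g e phi psi : A `<=` S2 -> centrally_symmetric A ->
  arcs A e phi psi -> oriented B g -> meet2 A B ->
  ~ B e -> exists2 x, 0 < x < 1 & [/\ g (phi x) = 0,
   (forall t, 0 <= t < x -> 0 < g e * g (phi t)) &
   (forall t, x < t <= 1 -> g e * g (phi t) < 0)].
Proof.
move=> AS sA h og AB Be.
have [S1 S2'] := arcs_S AS h.
have Ae : A e by rewrite -(arcs_start1 h); apply: (arcs_in1 h); lra.
have ge : g e <> 0 by move=> k; apply: Be; apply/(or_zero og (AS _ Ae)).
have ge2 : 0 < g e * g e by rewrite -expr2 exprn_even_gt0//=; exact/eqP.
have [x x01 gx] : exists2 x, 0 < x < 1 & g (phi x) = 0.
  apply: (path_zero og (arcs_cont1 h) S1).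
  by rewrite (arcs_start1 h) (arcs_end1 h) (or_odd og) mulrN oppr_lt0.
have [y y01 gy] : exists2 y, 0 < y < 1 & g (psi y) = 0.
  apply: (path_zero og (arcs_cont2 h) S2').
  by rewrite (arcs_start2 h) (arcs_end2 h) (or_odd og) mulrN oppr_lt0.
have le (z : R) : 0 < z < 1 -> 0 <= z <= 1 by lra.
have uniq t : 0 <= t <= 1 -> g (phi t) = 0 -> t = x.
  move=> t01 gt.
  have Bp s : 0 <= s <= 1 -> g (phi s) = 0 -> B (phi s) by move=> s01 ?; apply/(or_zero og (S1 _ s01)).
  have Bq s : 0 <= s <= 1 -> g (psi s) = 0 -> B (psi s) by move=> s01 ?; apply/(or_zero og (S2' _ s01)).
  have m := meet2_opp AS sA (or_sym og) AB.
  have [x01' y01'] := (le _ x01, le _ y01).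
  have [Ax Bx] : A (phi x) /\ B (phi x) by split; [exact: (arcs_in1 h)|exact: Bp].
  have [Ay By] : A (psi y) /\ B (psi y) by split; [exact: (arcs_in2 h)|exact: Bq].
  have [At Bt] : A (phi t) /\ B (phi t) by split; [exact: (arcs_in1 h)|exact: Bp].
  case: (m _ _ Ay By Ax Bx) => [|e1]; first by move/(arcs_disj1 h x01).
  case: (m _ _ Ay By At Bt) => e2; first by case: (arcs_disj2 h y01 t01).
  by apply: (arcs_inj1 h t01 x01'); rewrite e1 e2.
exists x => //; split => //.
- move=> t t0x; rewrite -(arcs_start1 h).
  apply: (@path_sign B g phi `[0, t]%classic 0 t og (arcs_cont1 h) S1 (@segment_connected _ _ _)).
  + by move=> s; rewrite /= in_itv/=; lra.
  + by move=> s; rewrite /= in_itv/= => s0t /uniq k; have := k _; lra.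
  + by rewrite /= in_itv/= lexx; lra.
  + by rewrite /= in_itv/= lexx; lra.
- move=> t xt1; have : 0 < g (phi t) * g (phi 1).
    apply: (@path_sign B g phi `[t, 1]%classic t 1 og (arcs_cont1 h) S1 (@segment_connected _ _ _)).
    + by move=> s; rewrite /= in_itv/=; lra.
    + by move=> s; rewrite /= in_itv/= => s0t /uniq k; have := k _; lra.
    + by rewrite /= in_itv/= lexx; lra.
    + by rewrite /= in_itv/= lexx; lra.
  by rewrite (arcs_end1 h) (or_odd og) mulrN oppr_gt0 mulrC.
Qed.

(** If the end points e and -e are the two intersection points, the open arcs lie on opposite sides
    of B. *)
Lemma arcs_sides A B g e phi psi : A `<=` S2 -> centrally_symmetric A ->
  arcs A e phi psi -> oriented B g -> meet2 A B -> B e ->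
  (forall s t, 0 < s < 1 -> 0 < t < 1 -> 0 < g (phi s) * g (phi t)) /\
  (forall s t, 0 < s < 1 -> 0 < t < 1 -> g (phi s) * g (psi t) < 0).
Proof.
move=> AS sA h og AB Be.
have [S1 S2'] := arcs_S AS h.
have Ae : A e by rewrite -(arcs_start1 h); apply: (arcs_in1 h); lra.
have le (z : R) : 0 < z < 1 -> 0 <= z <= 1 by lra.
have nz1 t : 0 < t < 1 -> g (phi t) <> 0.
  move=> t01 gt; have /(or_zero og (S1 _ (le _ t01))) Bt := gt.
  case: (meet2_opp AS sA (or_sym og) AB Ae Be (arcs_in1 h (le _ t01)) Bt).
    by rewrite -(arcs_start1 h) => /(arcs_inj1 h) k; have := k (le _ t01) _; lra.
  by rewrite -(arcs_end1 h) => /(arcs_inj1 h) k; have := k (le _ t01) _; lra.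
have nz2 t : 0 < t < 1 -> g (psi t) <> 0.
  move=> t01 gt; have /(or_zero og (S2' _ (le _ t01))) Bt := gt.
  case: (meet2_opp AS sA (or_sym og) AB Ae Be (arcs_in2 h (le _ t01)) Bt).
    by rewrite -(arcs_start2 h) => /(arcs_inj2 h) k; have := k (le _ t01) _; lra.
  by rewrite -(arcs_end2 h) => /(arcs_inj2 h) k; have := k (le _ t01) _; lra.
have cI : connected (`]0, 1[%classic : set R).
  exact/connected_intervalP/interval_is_interval.
have s1 s t : 0 < s < 1 -> 0 < t < 1 -> 0 < g (phi s) * g (phi t).
  move=> s01 t01; apply: (@path_sign B g phi `]0, 1[%classic s t og (arcs_cont1 h) S1 cI).
  - by move=> u /=; rewrite in_itv/=; lra.
  - by move=> u /=; rewrite in_itv/=; exact: nz1.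
  - by rewrite /= in_itv.
  - by rewrite /= in_itv.
have s2 s t : 0 < s < 1 -> 0 < t < 1 -> 0 < g (psi s) * g (psi t).
  move=> s01 t01; apply: (@path_sign B g psi `]0, 1[%classic s t og (arcs_cont2 h) S2' cI).
  - by move=> u /=; rewrite in_itv/=; lra.
  - by move=> u /=; rewrite in_itv/=; exact: nz2.
  - by rewrite /= in_itv.
  - by rewrite /= in_itv.
split=> // s t s01 t01.
have [r r01 re] := arcs_cover h (sA _ (arcs_in1 h (le _ s01))).
have r0 : r != 0.
  apply/eqP => r0; have e1 : - phi s = e by case: re; rewrite r0 ?(arcs_start1 h) ?(arcs_start2 h).
  have : phi s = phi 1 by rewrite (arcs_end1 h) -e1 opprK.
  by move/(arcs_inj1 h) => k; have := k (le _ s01) _; lra.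
have r1 : r != 1.
  apply/eqP => r1; have e1 : - phi s = - e by case: re; rewrite r1 ?(arcs_end1 h) ?(arcs_end2 h).
  have : phi s = phi 0 by rewrite (arcs_start1 h); exact: oppr_inj.
  by move/(arcs_inj1 h) => k; have := k (le _ s01) _; lra.
have r01' : 0 < r < 1 by rewrite !lt_neqAle eq_sym r0 r1.
case: re => re.
  have := s1 s r s01 r01'; rewrite -re (or_odd og) mulrN oppr_gt0 => k.
  by have := s1 s s s01 s01; rewrite ltNge ltW.
have := s2 r t r01' t01; rewrite -re (or_odd og); lra.
Qed.

End Arcs.

(** * The two sides of a curve; frontiers of open sets *)

Section Sides.
Variable R : realType.
Notation E := 'rV[R]_3.
Notation S2 := (sphere (R := R)).
Notation comp C x := (connected_component (S2 `\` C) x).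

Section Two.
Variables C B : set E.
Hypotheses (CS : C `<=` S2) (sC : centrally_symmetric C) (scC : simple_closed_curve C).
Hypotheses (BS : B `<=` S2) (sB : centrally_symmetric B) (scB : simple_closed_curve B).
Hypothesis CB : meet2 C B.

Let cC := curve_closed scC.
Let cB := curve_closed scB.

Lemma curve_not_sub : exists2 c, C c & ~ B c.
Proof.
have [p [q [pq e]]] := CB.
have [f [cf f01 inj CE]] := scC.
have Cf t : 0 <= t <= 1 -> C (f t) by move=> t01; rewrite CE; exists t => //=; rewrite in_itv.
apply: contrapT => nex.
have Bf t : 0 <= t <= 1 -> f t = p \/ f t = q.
  move=> t01; have : (C `&` B) (f t).
    split; first exact: Cf.
    by apply: contrapT => nB; apply: nex; exists (f t) => //; exact: Cf.
  by rewrite e.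
have n (a b : R) : 0 <= a < b -> b < 1 -> f a <> f b.
  by move=> ab b1 /inj k; have : a = b; [apply: k; lra|lra].
have n01 : f 0 <> f 2^-1 by apply: n; lra.
have n02 : f 0 <> f 4^-1 by apply: n; lra.
have n12 : f 4^-1 <> f 2^-1 by apply: n; lra.
have [|e0|e0] := Bf 0; first lra; (have [|e1|e1] := Bf 2^-1; first lra);
  (have [|e2|e2] := Bf 4^-1; first lra);
  first [by apply: n01; rewrite e0 e1|by apply: n02; rewrite e0 e2|by apply: n12; rewrite e1 e2].
Qed.

(** Every component of the complement of C meets the other curve B: its closure contains a point
    of C off B together with its antipode, which are on different sides of B. *)
Lemma comp_meets y : (S2 `\` C) y -> exists2 z, B z & comp C y z.
Proof.
move=> SCy; apply: contrapT => nex.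
set H := comp C y.
have HB : H `<=` S2 `\` B.
  move=> z Hz; have [Sz _] := comp_sub Hz; split => // Bz; apply: nex; exists z => //.
have [c0 Cc0 Bc0] := curve_not_sub.
have near c : C c -> ~ B c -> exists2 z, H z & comp B c z.
  move=> Cc Bc; have SBc : (S2 `\` B) c by split => //; exact: CS.
  have := comp_boundary CS sC scC SCy Cc (comp_locally_const c cB SBc).
  move=> [z [Hz h]]; exists z => //; have [Sz _] := comp_sub Hz.
  by have [_ h'] := h Sz; apply/h'; exact: connected_component_refl.
have [z Hz cz] := near c0 Cc0 Bc0.
have BNc : ~ B (- c0) by move/sB; rewrite opprK.
have [z' Hz' cz'] := near (- c0) (sC Cc0) BNc.
have czz' : comp B z z'.
  exact: (connected_component_max Hz HB (@component_connected _ _ _)).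
apply: (@comp_disjoint_opp R B BS sB scB c0 c0).
  by apply: connected_component_refl; split => //; exact: CS.
apply: connected_component_trans (connected_component_trans cz czz') _.
exact: connected_component_sym.
Qed.

(** The complement of C has at most two components, represented by the middle points of the two
    arcs of B. *)
Lemma sides_cover x y : (S2 `\` C) x -> (S2 `\` C) y -> comp C x y \/ comp C x (- y).
Proof.
move=> SCx SCy.
have [b [Cb Bb]] : exists b, C b /\ B b.
  by have [p [q [_ e]]] := CB; have : (C `&` B) p; [rewrite e; left|exists p].
have [phi [psi h]] := arcs_exist BS sB scB Bb.
have m := meet2_opp CS sC sB CB Cb Bb.
have le (z : R) : 0 < z < 1 -> 0 <= z <= 1 by lra.
have nC1 t : 0 < t < 1 -> ~ C (phi t).
  move=> t01 Ct; case: (m _ Ct (arcs_in1 h (le _ t01))).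
    by rewrite -(arcs_start1 h) => /(arcs_inj1 h) k; have := k (le _ t01) _; lra.
  by rewrite -(arcs_end1 h) => /(arcs_inj1 h) k; have := k (le _ t01) _; lra.
have nC2 t : 0 < t < 1 -> ~ C (psi t).
  move=> t01 Ct; case: (m _ Ct (arcs_in2 h (le _ t01))).
    by rewrite -(arcs_start2 h) => /(arcs_inj2 h) k; have := k (le _ t01) _; lra.
  by rewrite -(arcs_end2 h) => /(arcs_inj2 h) k; have := k (le _ t01) _; lra.
have half : 0 < (2^-1 : R) < 1 by lra.
have conn (f : R -> E) : {within `[0, 1], continuous f} -> (forall t, 0 < t < 1 -> ~ C (f t)) ->
    (forall t, 0 <= t <= 1 -> B (f t)) ->
    forall s t, 0 < s < 1 -> 0 < t < 1 -> comp C (f s) (f t).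
  move=> cf nC inB s t s01 t01.
  have I (u : R) : 0 < u < 1 -> (f @` `]0, 1[) (f u) by move=> u01; exists u => //=; rewrite in_itv.
  apply: (connected_component_max (I s s01) _ _ (I t t01)).
    move=> _ [u /= u01 <-]; rewrite in_itv/= in u01.
    by split; [apply/BS/inB/le|exact: nC].
  apply: connected_continuous_connected; first exact/connected_intervalP/interval_is_interval.
  by apply: continuous_subspaceW cf => u /=; rewrite !in_itv/=; exact: le.
have c1 := conn phi (arcs_cont1 h) nC1 (arcs_in1 h).
have c2 := conn psi (arcs_cont2 h) nC2 (arcs_in2 h).
have key z : (S2 `\` C) z -> comp C z (phi 2^-1) \/ comp C z (psi 2^-1).
  move=> SCz; have [w Bw zw] := comp_meets SCz.
  have [_ nCw] := comp_sub zw.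
  have [t t01 wt] := arcs_cover h Bw.
  have t0 : t != 0.
    by apply/eqP => t0; apply: nCw; case: wt => ->; rewrite t0 ?(arcs_start1 h) ?(arcs_start2 h).
  have t1 : t != 1.
    by apply/eqP => t1; apply: nCw; case: wt => ->; rewrite t1 ?(arcs_end1 h) ?(arcs_end2 h); exact: sC.
  have t01' : 0 < t < 1 by rewrite !lt_neqAle eq_sym t0 t1.
  case: wt => wt; [left|right]; rewrite wt in zw; apply: connected_component_trans zw _.
    exact: c1.
  exact: c2.
have SCNx : (S2 `\` C) (- x) by case: SCx => ? nC; split; [exact: sphereN|move/sC; rewrite opprK].
have no m0 : comp C x m0 -> comp C (- x) m0 -> False.
  move=> h1 h2; apply: (comp_disjoint_opp CS sC scC (connected_component_refl SCx)).
  by apply: connected_component_trans h1 _; exact: connected_component_sym.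
have same m0 : comp C x m0 -> comp C y m0 -> comp C x y.
  by move=> h1 h2; apply: connected_component_trans h1 _; exact: connected_component_sym.
have opp m0 : comp C (- x) m0 -> comp C y m0 -> comp C x (- y).
  move=> h1 h2; have : comp C (- x) y.
    by apply: connected_component_trans h1 _; exact: connected_component_sym.
  by move=> /(comp_opp sC); rewrite opprK.
by case: (key _ SCx) => hx; case: (key _ SCNx) => hNx; case: (key _ SCy) => hy;
  first [case: (no _ hx hNx)|left; exact: same hx hy|right; exact: opp hNx hy].
Qed.

(** With a second curve at hand, the sides of C are H and its antipode. *)
Lemma side_oriented H : side C H -> exists2 g, oriented C g & forall y, H y <-> S2 y /\ 0 < g y.
Proof.
move=> [x SCx ->]; set H0 := comp C x.
have HN y : H0 y -> H0 (- y) -> False by exact: comp_disjoint_opp.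
pose g y : R := if `[< H0 y >] then 1 else if `[< H0 (- y) >] then -1 else 0.
have g1 y : H0 y -> g y = 1 by rewrite /g => /asboolP ->.
have g2 y : H0 (- y) -> g y = -1.
  by rewrite /g => h; case: asboolP => [h'|_]; [case: (HN y)|rewrite (asboolT h)].
have gpos y : 0 < g y -> H0 y.
  by rewrite /g; case: asboolP => // _; case: asboolP => _; rewrite ?ltxx// oppr_gt0 ltr10.
have HE : [set y | S2 y /\ 0 < g y] = H0.
  by apply/seteqP; split=> y; [case=> _ /gpos|move=> Hy; split; [case: (comp_sub Hy)|rewrite g1]].
exists g; last by move=> y; rewrite -HE.
split => //.
- move=> y; have [h|h] := pselect (H0 y); first by rewrite (g1 _ h) g2 ?opprK.
  have [h'|h'] := pselect (H0 (- y)); first by rewrite (g1 _ h') (g2 _ h') opprK.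
  by rewrite /g opprK !asboolF// oppr0.
- move=> y Sy; split => [gy|Cy].
    apply: contrapT => nC; case: (@sides_cover x y SCx) => // h; move: gy.
      by rewrite g1// => /eqP; rewrite oner_eq0.
    by rewrite g2// => /eqP; rewrite oppr_eq0 oner_eq0.
  rewrite /g; case: asboolP => h; first by case: (comp_sub h).
  by case: asboolP => // h'; case: (comp_sub h') => _; case; exact: sC.
- move=> y Sy /gpos Hy; have := comp_locally_const x cC (comp_sub Hy).
  apply: filterS => z h Sz; have [_ h'] := h Sz.
  by rewrite g1//; apply/h'.
- by rewrite HE; exact: component_connected.
- by rewrite HE; exact: comp_boundary.
Qed.

End Two.

Section Frontier.
Variable O : set E.
Hypotheses (OS : O `<=` S2) (ON : forall y, O y -> ~ O (- y)).
Hypothesis Oopen : forall y, O y -> \forall z \near y, S2 z -> O z.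

Let i0 : 'I_3 := @Ordinal 3 0 isT.
Let i1 : 'I_3 := @Ordinal 3 1 isT.
Let i2 : 'I_3 := @Ordinal 3 2 isT.
Let e (j : 'I_3) : E := delta_mx 0 j.

Lemma exists_transverse (x : E) : dot x x = 1 -> exists v, 0 < pre x v v.
Proof.
move=> xx; apply: contrapT => nex.
have h v : pre x v v <= 0 by rewrite leNgt; apply/negP => p; apply: nex; exists v.
have := h (e i0); have := h (e i1); have := h (e i2).
move: xx; rewrite /pre /dot !mxE/= !mulr0 !mulr1 !addr0 !add0r; nra.
Qed.

Lemma exists_third (x y : E) : dot x x = 1 -> 0 < pre x y y -> exists n, det3 x y n <> 0.
Proof.
move=> xx; apply: contraPP => /forallNP nex.
have h n : det3 x y n = 0 by apply: contrapT; exact: nex.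
have := h (e i0); have := h (e i1); have := h (e i2).
rewrite /det3 !mxE/= !(mulr0, mulr1, addr0, add0r, subr0, sub0r) => a b c.
suff -> : pre x y y = 0 by rewrite ltxx.
transitivity (dot x x * dot y y - dot x y * dot x y); first by rewrite xx mul1r.
rewrite /dot; move: a b c.
set x0 := x ord0 i0; set x1 := x ord0 i1; set x2 := x ord0 i2.
set y0 := y ord0 i0; set y1 := y ord0 i1; set y2 := y ord0 i2 => a b c.
have e1 : x0 * y1 - x1 * y0 = 0 by lra.
have e2 : x1 * y2 - x2 * y1 = 0 by lra.
have e3 : x0 * y2 - x2 * y0 = 0 by lra.
transitivity ((x0 * y1 - x1 * y0) ^+ 2 + (x1 * y2 - x2 * y1) ^+ 2 + (x0 * y2 - x2 * y0) ^+ 2); first by ring.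
by rewrite e1 e2 e3; ring.
Qed.

(** A path from x (s = 0) to y (s = 1) through the direction n. For independent x, y, n the central
    projections of these paths, for the different values of tau, only share their end points. *)
Definition bump (x y n : E) (tau s : R) : E := (1 - s) *: x + s *: y + (s * (1 - s) * tau) *: n.

Lemma bump_coord x y n tau s : let z := bump x y n tau s in
  [/\ det3 z y n = (1 - s) * det3 x y n, det3 x z n = s * det3 x y n &
      det3 x y z = s * (1 - s) * tau * det3 x y n].
Proof. by rewrite /bump /det3 !mxE; split; ring. Qed.

Lemma bump_cont x y n tau : continuous (bump x y n tau).
Proof.
have c1 : continuous (fun s : R => 1 - s) by move=> s; apply: cvgB; [exact: cvg_cst|exact: cvg_id].
move=> s; apply: cvgD.
  by apply: cvgD; apply: cvgZ; [exact: c1|exact: cvg_cst|exact: cvg_id|exact: cvg_cst].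
apply: cvgZ; last exact: cvg_cst.
by apply: cvgM; [apply: cvgM; [exact: cvg_id|exact: c1]|exact: cvg_cst].
Qed.

Lemma bump_neq0 x y n tau s : det3 x y n <> 0 -> 0 < dot (bump x y n tau s) (bump x y n tau s).
Proof.
move=> D; rewrite lt_def dot_ge0 andbT; apply/eqP => /dot_eq0 z0.
have [e1 e2 _] := bump_coord x y n tau s.
rewrite z0 in e1 e2.
have d1 : det3 0 y n = 0 by rewrite /det3 !mxE; ring.
have d2 : det3 x 0 n = 0 by rewrite /det3 !mxE; ring.
by apply: D; have : (1 - s) * det3 x y n + s * det3 x y n = 0; [rewrite -e1 -e2 d1 d2 addr0|lra].
Qed.

Lemma bump_inj x y n tau tau' s s' : det3 x y n <> 0 -> 0 < s < 1 ->
  nmz (bump x y n tau s) = nmz (bump x y n tau' s') -> tau = tau'.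
Proof.
move=> D s01; set z := bump _ _ _ tau s; set z' := bump _ _ _ _ _ => e1.
have [zp zp'] : 0 < dot z z /\ 0 < dot z' z' by split; exact: bump_neq0.
pose mu := Num.sqrt (dot z z) / Num.sqrt (dot z' z').
have ez : z = mu *: z'.
  rewrite /mu -scalerA -/(nmz z') -e1 /nmz scalerA mulfV ?scale1r//.
  by rewrite gt_eqF// sqrtr_gt0.
have [a1 a2 a3] := bump_coord x y n tau s; have [b1 b2 b3] := bump_coord x y n tau' s'.
rewrite -/z -/z' in a1 a2 a3 b1 b2 b3.
have m1 : det3 z y n = mu * det3 z' y n by rewrite {1}ez /det3 !mxE; ring.
have m2 : det3 x z n = mu * det3 x z' n by rewrite {1}ez /det3 !mxE; ring.
have m3 : det3 x y z = mu * det3 x y z' by rewrite {1}ez /det3 !mxE; ring.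
move/eqP: (D) => D'.
have c1 : 1 - s = mu * (1 - s') by apply: (mulIf D'); rewrite -a1 m1 b1 mulrA.
have c2 : s = mu * s' by apply: (mulIf D'); rewrite -a2 m2 b2 mulrA.
have c3 : s * (1 - s) * tau = mu * (s' * (1 - s') * tau') by apply: (mulIf D'); rewrite -a3 m3 b3 mulrA.
have mu1 : mu = 1 by lra.
move: c2 c3; rewrite mu1 !mul1r => <-; apply: mulfI.
by rewrite mulf_neq0// gt_eqF//; lra.
Qed.

(** A nonempty open subset O of the sphere that is disjoint from its antipode has infinite frontier:
    infinitely many disjoint paths lead from a point of O to a point of its antipode. The hypothesis
    says that F contains the frontier of O. *)
Lemma infinite_frontier (F : set E) : finite_set F ->
  (forall y, S2 y -> ~ O y -> ~ F y -> \forall z \near y, S2 z -> ~ O z) -> O = set0.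
Proof.
move=> finF bd; apply: contrapT => /eqP/set0P[x Ox].
have Sx := OS Ox; have xx : dot x x = 1 by rewrite -sphereE.
have [v xv] := exists_transverse xx.
(* a second point of O, transverse to x *)
have [x' [Ox' xx']] : exists x', O x' /\ 0 < pre x x' x'.
  have cs : continuous (fun s : R => x + s *: v).
    by move=> s; apply: cvgD; [exact: cvg_cst|apply: cvgZ; [exact: cvg_id|exact: cvg_cst]].
  have c0 : x + s *: v @[s --> (0 : R)] --> x.
    by have := cs 0; rewrite /continuous_at scale0r addr0.
  have cn : nmz (x + s *: v) @[s --> (0 : R)] --> x.
    by rewrite -{2}[x](nmz_id Sx); apply: nmz_cvg => //; rewrite xx ltr01.
  have nd : \forall z \near x, 0 < dot z z.
    have ct : continuous (fun y : E => dot y y) by apply: dot_cont => y; exact: cvg_id.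
    by have := ct x [set r | 0 < r]; apply; apply: lt_nbhsr; rewrite xx ltr01.
  have cd : \forall s \near (0 : R), 0 < dot (x + s *: v) (x + s *: v) by exact: (c0 _ nd).
  have := cn _ (Oopen Ox) => /= h.
  have : \forall s \near (0 : R), 0 < dot (x + s *: v) (x + s *: v) /\
      (S2 (nmz (x + s *: v)) -> O (nmz (x + s *: v))) by exact: filterI cd h.
  move=> /nbhs_ballP[d /= d0 hd].
  have [|h1 h2] := hd (d / 2).
    by rewrite -ball_normE/= sub0r normrN gtr0_norm; lra.
  exists (nmz (x + (d / 2) *: v)); split; first by apply: h2; exact: nmz_sphere.
  rewrite /nmz; set k := (Num.sqrt _)^-1.
  have k0 : 0 < k by rewrite invr_gt0 sqrtr_gt0.
  have -> : pre x (k *: (x + (d / 2) *: v)) (k *: (x + (d / 2) *: v)) =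
      k ^+ 2 * (d / 2) ^+ 2 * pre x v v.
    rewrite /pre !(dotZl, dotZr, dotDl, dotDr) xx (dotC v x); ring.
  by rewrite !mulr_gt0 ?exprn_gt0//; lra.
pose y := - x'.
have nOy : ~ O y by apply: ON.
have Sy : S2 y by apply: sphereN; exact: OS.
have xy : 0 < pre x y y by rewrite /y pre_Nd.
have [n D] := exists_third xx xy.
pose P (tau s : R) := nmz (bump x y n tau s).
have SP tau s : S2 (P tau s) by apply/nmz_sphere/bump_neq0.
have cP tau : continuous (P tau).
  by move=> s; apply: nmz_cvg; [exact: bump_cont|exact: bump_neq0].
have bdy : \forall z \near y, S2 z -> ~ O z.
  have oc : (fun z : E => - z) @ y --> - y by exact: opp_continuous.
  have ONy : O (- y) by rewrite /y opprK.
  have h : \forall z \near y, S2 (- z) -> O (- z) by exact: (oc _ (Oopen ONy)).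
  apply: filterS h => z h Sz Oz.
  by apply: (ON Oz); apply: h; exact: sphereN.
have hit tau : exists s, 0 < s < 1 /\ F (P tau s).
  apply: contrapT => nex; apply: nOy.
  have P0 : P tau 0 = x by rewrite /P /bump subr0 !mul0r scale1r !scale0r !addr0 nmz_id.
  have P1 : P tau 1 = y by rewrite /P /bump subrr mulr0 mul0r scale1r !scale0r addr0 add0r nmz_id.
  rewrite -P1.
  apply: (@connected_const R (`[0, 1]%classic : set R) (fun s => O (P tau s)) 0 1).
  - exact: segment_connected.
  - move=> s; rewrite /= in_itv/= => s01; have [Os|nOs] := pselect (O (P tau s)).
      have h : \forall s' \near s, S2 (P tau s') -> O (P tau s') by exact: (cP tau s _ (Oopen Os)).
      by apply: filterS h => s' h _; split => // _; apply: h; exact: SP.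
    have bdP : \forall z \near P tau s, S2 z -> ~ O z.
      have [->|s1] := eqVneq s 1; first by rewrite P1.
      apply: bd => // Fs; apply: nex; exists s; split => //.
      have s0 : s != 0 by apply/eqP => s0; apply: nOs; rewrite s0 P0.
      by rewrite !lt_neqAle eq_sym s0 s1.
    have h : \forall s' \near s, S2 (P tau s') -> ~ O (P tau s') by exact: (cP tau s _ bdP).
    by apply: filterS h => s' h _; split => // k; case: (h (SP _ _)).
  - by rewrite /= in_itv/= lexx ler01.
  - by rewrite /= in_itv/= lexx ler01.
  - by rewrite P0.
have [u hu] := choice (fun n : nat => hit n%:R).
pose w n := P n%:R (u n).
have inj : injective w.
  move=> a b ab; have [u01 _] := hu a.
  by have /eqP := bump_inj D u01 ab; rewrite eqr_nat => /eqP.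
apply: infinite_nat; have -> : [set: nat] = w @^-1` F.
  by apply/seteqP; split=> // a _; case: (hu a).
by apply: finite_preimage => // a b _ _; exact: inj.
Qed.

End Frontier.
End Sides.

(** * Lines relative to a reference curve *)

Section Lines.
Variable R : realType.
Notation E := 'rV[R]_3.
Notation S2 := (sphere (R := R)).

(** Along f on [0, 1), the sign of h is negative before x, zero at x and positive after x. *)
Definition sign_change (h : E -> R) (f : R -> E) (x : R) : Prop :=
  [/\ 0 <= x < 1, h (f x) = 0, forall s, 0 <= s < x -> h (f s) < 0 &
      forall s, x < s < 1 -> 0 < h (f s)].

Lemma sign_change_le0 h f x s : sign_change h f x -> 0 <= s < 1 -> h (f s) <= 0 -> s <= x.
Proof. by move=> [_ _ _ h4] s01 hs; rewrite leNgt; apply/negP => xs; have := h4 s _; lra. Qed.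

Lemma sign_change_ge0 h f x s : sign_change h f x -> 0 <= s < 1 -> 0 <= h (f s) -> x <= s.
Proof. by move=> [_ _ h3 _] s01 hs; rewrite leNgt; apply/negP => xs; have := h3 s _; lra. Qed.

Lemma sign_change_eq0 h f x s : sign_change h f x -> 0 <= s < 1 -> h (f s) = 0 -> s = x.
Proof.
move=> c s01 hs; apply/eqP; rewrite eq_le (sign_change_le0 c s01) ?hs//.
by rewrite (sign_change_ge0 c s01) ?hs.
Qed.

Lemma sign_change_oppK h f x : sign_change h f x -> sign_change (fun y => - - h y) f x.
Proof.
move=> [h1 h2 h3 h4]; split => // [|s|s]; rewrite opprK //; [exact: h3|exact: h4].
Qed.

(** A curve A, oriented by g with o on its negative side, relative to the reference curve X:
    it crosses the arcs u and u' of X from o to -o at the parameters t and t', in antipodal points, and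
    al parametrizes its half on the positive side of X, starting from u t. On the positive side of X,
    with o as the downward vertical direction, A is the graph of a line and t measures its slope. *)
Record line (X : set E) (gX : E -> R) (o : E) (u u' : R -> E)
    (A : set E) (g : E -> R) (t t' : R) (al : R -> E) : Prop := Line {
  line_or : oriented A g;
  line_o : g o < 0;
  line_t : 0 < t < 1;
  line_t' : 0 < t' < 1;
  line_ut : g (u t) = 0;
  line_lt : forall s, 0 <= s <= 1 -> s < t -> g (u s) < 0;
  line_gt : forall s, 0 <= s <= 1 -> t < s -> 0 < g (u s);
  line_lt' : forall s, 0 <= s <= 1 -> s < t' -> g (u' s) < 0;
  line_gt' : forall s, 0 <= s <= 1 -> t' < s -> 0 < g (u' s);
  line_opp : u' t' = - u t;
  line_meet : meet2 A X;
  line_arcs : exists al', arcs A (u t) al al';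
  line_pos : forall s, 0 < s < 1 -> 0 < gX (al s);
  line_cover : forall y, S2 y -> g y = 0 -> 0 < gX y -> exists2 s, 0 < s < 1 & y = al s }.

Section Ref.
Variables (X : set E) (gX : E -> R) (o : E) (u u' : R -> E).
Hypotheses (oX : oriented X gX) (aX : arcs X o u u').

Local Notation line := (line X gX o u u').

Let XS : X `<=` S2. Proof. exact: or_sub oX. Qed.
Let sX : centrally_symmetric X. Proof. exact: or_sym oX. Qed.
Let Xo : X o. Proof. by rewrite -(arcs_start1 aX); apply: (arcs_in1 aX); lra. Qed.
Let Su s : 0 <= s <= 1 -> S2 (u s). Proof. by move=> h; exact/XS/(arcs_in1 aX). Qed.
Let Su' s : 0 <= s <= 1 -> S2 (u' s). Proof. by move=> h; exact/XS/(arcs_in2 aX). Qed.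
Let gXu s : 0 <= s <= 1 -> gX (u s) = 0.
Proof. by move=> h; apply/(or_zero oX (Su h))/(arcs_in1 aX). Qed.
Let le01 (s : R) : 0 < s < 1 -> 0 <= s <= 1. Proof. lra. Qed.

Lemma line_exists A g : oriented A g -> meet2 A X -> g o < 0 ->
  exists t t' al, line A g t t' al.
Proof.
move=> og AX go.
have AS := or_sub og; have sA := or_sym og.
have nAo : ~ A o by move/(or_zero og (XS Xo)) => h; rewrite h ltxx in go.
have XA := meet2_sym AX.
have [t t01 [gt lt_t gt_t]] := one_crossing XS sX aX og XA nAo.
have [t' t'01 [gt' lt_t' gt_t']] := one_crossing XS sX (arcs_sym aX) og XA nAo.
have At : A (u t) by apply/(or_zero og (Su (le01 t01))).
have At' : A (u' t') by apply/(or_zero og (Su' (le01 t'01))).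
have Xt : X (u t) by exact: (arcs_in1 aX (le01 t01)).
have Xt' : X (u' t') by exact: (arcs_in2 aX (le01 t'01)).
have [al [al' aA]] := arcs_exist AS sA (or_curve og) At.
have opp : u' t' = - u t.
  case: (meet2_opp AS sA sX AX At Xt At' Xt') => // e.
  by case: (arcs_disj2 aX t'01 (le01 t01)).
have half : 0 < (2^-1 : R) < 1 by lra.
wlog pos : al al' aA / 0 < gX (al 2^-1).
  move=> W; have [_ op] := arcs_sides AS sA aA oX AX Xt.
  have neg := op _ _ half half.
  have /orP[h|h] : (gX (al 2^-1) < 0) || (0 < gX (al 2^-1)).
  - rewrite -neq_lt; apply: contraTneq neg => ->; rewrite mul0r ltxx //.
  - apply: (W al' al); first exact: arcs_sym.
    by move: neg; rewrite nmulr_rlt0.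
  - exact: (W al al').
have [same op] := arcs_sides AS sA aA oX AX Xt.
exists t, t', al; split => //.
- move=> s s01 st; have := lt_t s _; rewrite nmulr_rgt0//; apply.
  by lra.
- move=> s s01 st; have := gt_t s _; rewrite nmulr_rlt0//; apply.
  by lra.
- move=> s s01 st; have := lt_t' s _; rewrite nmulr_rgt0//; apply.
  by lra.
- move=> s s01 st; have := gt_t' s _; rewrite nmulr_rlt0//; apply.
  by lra.
- by exists al'.
- by move=> s s01; have := same _ _ half s01; rewrite pmulr_rgt0.
- move=> y Sy gy gXy; have Ay : A y by apply/(or_zero og Sy).
  have nXy : ~ X y by move/(or_zero oX Sy) => h; rewrite h ltxx in gXy.
  have [s s01 ys] := arcs_cover aA Ay.
  have s0 : s != 0.
    by apply/eqP => s0; apply: nXy; case: ys => ->; rewrite s0 ?(arcs_start1 aA) ?(arcs_start2 aA).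
  have s1 : s != 1.
    by apply/eqP => s1; apply: nXy; case: ys => ->; rewrite s1 ?(arcs_end1 aA) ?(arcs_end2 aA); exact: sX.
  have s01' : 0 < s < 1 by rewrite !lt_neqAle eq_sym s0 s1.
  exists s => //; case: ys => // ys.
  have := op _ _ half s01'; rewrite -ys pmulr_rlt0// => k.
  by have := lt_trans k gXy; rewrite ltxx.
Qed.

Section OneLine.
Variables (A : set E) (g : E -> R) (t t' : R) (al : R -> E).
Hypothesis L : line A g t t' al.

Lemma line_start : al 0 = u t.
Proof. by have [al' aA] := line_arcs L; rewrite (arcs_start1 aA). Qed.

Lemma line_zero s : 0 <= s <= 1 -> g (al s) = 0.
Proof.
move=> s01; have [al' aA] := line_arcs L; have As := arcs_in1 aA s01.
by apply/(or_zero (line_or L) (or_sub (line_or L) As)).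
Qed.

Lemma line_S s : 0 <= s <= 1 -> S2 (al s).
Proof.
by move=> s01; have [al' aA] := line_arcs L; exact: (or_sub (line_or L) (arcs_in1 aA s01)).
Qed.

Lemma line_ge0 s : 0 <= s < 1 -> 0 <= gX (al s).
Proof.
move=> s01; have [->|s0] := eqVneq s 0; first by rewrite line_start gXu//; have := line_t L; lra.
by apply/ltW/(line_pos L); rewrite lt_neqAle eq_sym s0.
Qed.

Lemma line_u_le s : 0 <= s <= 1 -> g (u s) <= 0 -> s <= t.
Proof. by move=> s01 gs; rewrite leNgt; apply/negP => h; have := line_gt L s01 h; lra. Qed.
Lemma line_u_ge s : 0 <= s <= 1 -> 0 <= g (u s) -> t <= s.
Proof. by move=> s01 gs; rewrite leNgt; apply/negP => h; have := line_lt L s01 h; lra. Qed.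
Lemma line_u'_le s : 0 <= s <= 1 -> g (u' s) <= 0 -> s <= t'.
Proof. by move=> s01 gs; rewrite leNgt; apply/negP => h; have := line_gt' L s01 h; lra. Qed.
Lemma line_u'_ge s : 0 <= s <= 1 -> 0 <= g (u' s) -> t' <= s.
Proof. by move=> s01 gs; rewrite leNgt; apply/negP => h; have := line_lt' L s01 h; lra. Qed.
End OneLine.

(** The halves of A and B on the positive side of X cannot both be above each other: the region below
    both of them would be open and closed there, and it is nonempty near z0. *)
Lemma nested_false A B g h z0 : oriented A g -> oriented B h -> X z0 -> g z0 < 0 -> h z0 < 0 ->
  (forall y, S2 y -> 0 < gX y -> g y = 0 -> 0 < h y) ->
  (forall y, S2 y -> 0 < gX y -> h y = 0 -> 0 < g y) ->
  (exists y, [/\ S2 y, 0 < gX y & g y = 0]) -> False.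
Proof.
move=> og oh Xz gz hz gh hg [y [Sy gXy gy]].
have Sz := XS Xz.
have := or_bd oX Xz (filterI (oriented_neg_open og Sz gz) (oriented_neg_open oh Sz hz)).
move=> [w [[Sw gXw] [/(_ Sw) gw /(_ Sw) hw]]].
suff : g y < 0 /\ h y < 0 by rewrite gy ltxx => -[].
apply: (@connected_const _ [set y | S2 y /\ 0 < gX y] (fun y => g y < 0 /\ h y < 0) w y) => //.
  exact: or_conn oX.
move=> z [{}Sz gXz].
have pos C k : oriented C k -> 0 < k z -> \forall z' \near z, S2 z' -> k z' < 0 -> False.
  move=> ok kz; have := or_open ok Sz kz; apply: filterS => z' k1 Sz'.
  by have := k1 Sz'; lra.
have [g0|gp|ge] := ltgtP (g z) 0.
- have [h0|hp|he] := ltgtP (h z) 0.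
  + apply: filterS (filterI (oriented_neg_open og Sz g0) (oriented_neg_open oh Sz h0)).
    by move=> z' [k1 k2] [Sz' _]; split => // _; split; [exact: k1|exact: k2].
  + by apply: filterS (pos _ _ oh hp) => z' k1 [Sz' _]; split=> [[_]|[_ /(k1 Sz')]//]; lra.
  + by have := hg z Sz gXz he; lra.
- by apply: filterS (pos _ _ og gp) => z' k1 [Sz' _]; split=> [[]|[/(k1 Sz')]//]; lra.
- apply: filterS (pos _ _ oh (gh z Sz gXz ge)) => z' k1 [Sz' _].
  by split=> [[]|[_ /(k1 Sz')]//]; lra.
Qed.

Section TwoLines.
Variables (A B : set E) (g h : E -> R) (t t' r r' : R) (al be : R -> E).
Hypotheses (LA : line A g t t' al) (LB : line B h r r' be) (AB : meet2 A B).

Lemma tie_sign_A : t = r -> (forall s, 0 < s < 1 -> 0 < h (al s)) \/ (forall s, 0 < s < 1 -> h (al s) < 0).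
Proof.
move=> tr; have [al' aA] := line_arcs LA.
have Bt : B (u t) by apply/(or_zero (line_or LB) (Su (le01 (line_t LA)))); rewrite tr (line_ut LB).
have [same _] := arcs_sides (or_sub (line_or LA)) (or_sym (line_or LA)) aA (line_or LB) AB Bt.
have half : 0 < (2^-1 : R) < 1 by lra.
have [h0|h0|h0] := ltgtP (h (al 2^-1)) 0.
- by right=> s s01; have := same _ _ half s01; rewrite nmulr_rgt0.
- by left=> s s01; have := same _ _ half s01; rewrite pmulr_rgt0.
- by have := same _ _ half half; rewrite h0 mul0r ltxx.
Qed.

Lemma opp_order : t <= r -> r' <= t'.
Proof.
rewrite le_eqVlt => /orP[/eqP tr|tr].
  have : u' t' = u' r' by rewrite (line_opp LA) (line_opp LB) tr.
  by move/(arcs_inj2 aX (le01 (line_t' LA)) (le01 (line_t' LB))) ->; rewrite lexx.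
apply: (line_u'_le LA); first exact: le01 (line_t' LB).
rewrite (line_opp LB) (or_odd (line_or LA)) oppr_le0; apply: ltW.
by apply: (line_gt LA) => //; exact: le01 (line_t LB).
Qed.

Lemma crossing_A : t < r -> exists x, sign_change h al x.
Proof.
move=> tr; have [al' aA] := line_arcs LA.
have hn : h (u t) < 0 by apply: (line_lt LB) => //; exact: le01 (line_t LA).
have nB : ~ B (u t).
  by move/(or_zero (line_or LB) (Su (le01 (line_t LA)))) => k; rewrite k ltxx in hn.
have [x x01 [hx h1 h2]] := one_crossing (or_sub (line_or LA)) (or_sym (line_or LA)) aA (line_or LB) AB nB.
exists x; split => //; first lra.
  by move=> s sx; have := h1 s sx; rewrite nmulr_rgt0.
by move=> s sx; have := h2 s _; rewrite nmulr_rlt0//; apply; lra.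
Qed.

Lemma crossing_A' : r < t -> exists x, sign_change (fun y => - h y) al x.
Proof.
move=> tr; have [al' aA] := line_arcs LA.
have hn : 0 < h (u t) by apply: (line_gt LB) => //; exact: le01 (line_t LA).
have nB : ~ B (u t).
  by move/(or_zero (line_or LB) (Su (le01 (line_t LA)))) => k; rewrite k ltxx in hn.
have [x x01 [hx h1 h2]] := one_crossing (or_sub (line_or LA)) (or_sym (line_or LA)) aA (line_or LB) AB nB.
exists x; split => //; first lra.
- by rewrite hx oppr0.
- by move=> s sx; have := h1 s sx; rewrite pmulr_rgt0// oppr_lt0.
by move=> s sx; rewrite oppr_gt0; have := h2 s _; rewrite pmulr_rlt0//; apply; lra.
Qed.

Lemma same_crossing x y : sign_change h al x \/ sign_change (fun y => - h y) al x ->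
  sign_change g be y \/ sign_change (fun y => - g y) be y -> al x = be y.
Proof.
move=> hx hy.
have [x01 hx0] : 0 <= x < 1 /\ h (al x) = 0.
  by case: hx => -[? + _ _] => [//|/eqP]; rewrite oppr_eq0 => /eqP.
have [y01 gy0] : 0 <= y < 1 /\ g (be y) = 0.
  by case: hy => -[? + _ _] => [//|/eqP]; rewrite oppr_eq0 => /eqP.
have x01' : 0 <= x <= 1 by lra.
have y01' : 0 <= y <= 1 by lra.
have [Sx Sy] := (line_S LA x01', line_S LB y01').
have Ax : A (al x) by apply/(or_zero (line_or LA) Sx)/(line_zero LA).
have Bx : B (al x) by apply/(or_zero (line_or LB) Sx).
have By : B (be y) by apply/(or_zero (line_or LB) Sy)/(line_zero LB).
have Ay : A (be y) by apply/(or_zero (line_or LA) Sy).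
case: (meet2_opp (or_sub (line_or LA)) (or_sym (line_or LA)) (or_sym (line_or LB)) AB Ax Bx Ay By) => // e.
have p1 := line_ge0 LA x01; have p2 := line_ge0 LB y01.
rewrite e (or_odd oX) in p2.
have x0 : x = 0.
  apply/eqP/negPn/negP => x0; have : 0 < gX (al x) by apply: (line_pos LA); rewrite lt_neqAle eq_sym x0.
  lra.
have y0 : y = 0.
  apply/eqP/negPn/negP => y0; have : 0 < gX (be y) by apply: (line_pos LB); rewrite lt_neqAle eq_sym y0.
  by rewrite e (or_odd oX); lra.
move: e; rewrite x0 y0 (line_start LA) (line_start LB) -(line_opp LA) => e.
by case: (arcs_disj1 aX (line_t LB) (le01 (line_t' LA))).
Qed.

End TwoLines.

(** The order of the lines: by the crossing parameter with u, and for lines through the same point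
    of X, by height. Here t and r are the parameters of the two lines, h is the sign
    function of the second one and al the half of the first one. *)
Definition prec (h : E -> R) (t r : R) (al : R -> E) : Prop :=
  t < r \/ (t = r /\ forall s, 0 < s < 1 -> 0 < h (al s)).

Section Prec.
Variables (A B : set E) (g h : E -> R) (t t' r r' : R) (al be : R -> E).
Hypotheses (LA : line A g t t' al) (LB : line B h r r' be) (AB : meet2 A B).

Lemma half_pos (f : R -> E) (k : E -> R) : (forall s, 0 < s < 1 -> 0 < k (f s)) ->
  (forall s, 0 < s < 1 -> k (f s) < 0) -> False.
Proof. by move=> k1 k2; have := k1 2^-1 _; have := k2 2^-1 _; lra. Qed.

Lemma tie_pos : t = r -> (forall s, 0 < s < 1 -> 0 < h (al s)) ->
  forall s, 0 < s < 1 -> g (be s) < 0.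
Proof.
move=> tr hal; case: (tie_sign_A LB LA (meet2_sym AB) (esym tr)) => // gbe.
case: (@nested_false A B g h o (line_or LA) (line_or LB) Xo (line_o LA) (line_o LB)).
- by move=> y Sy gXy gy; have [s s01 ->] := line_cover LA Sy gy gXy; exact: hal.
- by move=> y Sy gXy hy; have [s s01 ->] := line_cover LB Sy hy gXy; exact: gbe.
- exists (al 2^-1); have half : 0 < (2^-1 : R) < 1 by lra.
  by split; [exact: (line_S LA (le01 half))|exact: line_pos LA _ half|exact: (line_zero LA (le01 half))].
Qed.

Lemma tie_neg : t = r -> (forall s, 0 < s < 1 -> h (al s) < 0) ->
  forall s, 0 < s < 1 -> 0 < g (be s).
Proof.
move=> tr hal; case: (tie_sign_A LB LA (meet2_sym AB) (esym tr)) => // gbe.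
case: (@nested_false A B (fun y => - g y) (fun y => - h y) (- o)
  (oriented_opp (line_or LA)) (oriented_opp (line_or LB)) (sX Xo)).
- by rewrite (or_odd (line_or LA)) opprK; exact: line_o LA.
- by rewrite (or_odd (line_or LB)) opprK; exact: line_o LB.
- move=> y Sy gXy /eqP; rewrite oppr_eq0 oppr_gt0 => /eqP gy.
  by have [s s01 ->] := line_cover LA Sy gy gXy; exact: hal.
- move=> y Sy gXy /eqP; rewrite oppr_eq0 oppr_gt0 => /eqP hy.
  by have [s s01 ->] := line_cover LB Sy hy gXy; exact: gbe.
- exists (al 2^-1); have half : 0 < (2^-1 : R) < 1 by lra.
  split; [exact: (line_S LA (le01 half))|exact: line_pos LA _ half|].
  by rewrite (line_zero LA (le01 half)) oppr0.
Qed.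

Lemma prec_total : prec h t r al \/ prec g r t be.
Proof.
have [tr|tr|tr] := ltgtP t r; [by left; left|by right; left|].
case: (tie_sign_A LA LB AB tr) => hal; first by left; right.
by right; right; split => //; exact: tie_neg.
Qed.

Lemma prec_asym : prec h t r al -> prec g r t be -> False.
Proof.
case=> [tr|[tr hal]]; case=> [rt|[rt gbe]]; try lra.
exact: half_pos gbe (tie_pos tr hal).
Qed.

Lemma prec_le : prec h t r al -> t <= r.
Proof. by case=> [/ltW//|[->]]. Qed.

Lemma prec_change_A : prec h t r al -> exists x, sign_change h al x.
Proof.
case=> [tr|[tr hal]]; first exact: crossing_A LA LB AB tr.
exists 0; split; [lra| |by move=> s; lra|exact: hal].
by rewrite (line_start LA) tr (line_ut LB).
Qed.

Lemma prec_change_B : prec h t r al -> exists y, sign_change (fun y => - g y) be y.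
Proof.
case=> [tr|[tr hal]]; first exact: crossing_A' LB LA (meet2_sym AB) tr.
exists 0; split; [lra| |by move=> s; lra|].
  by rewrite (line_start LB) -tr (line_ut LA) oppr0.
by move=> s s01; rewrite oppr_gt0; exact: (tie_pos tr hal).
Qed.

(** For lines through the same point of X, height is inclusion of the upper sides: the frontier of
    the region above A and below B would reduce to the two common points of A and B. *)
Lemma tie_incl y : t = r -> (forall s, 0 < s < 1 -> 0 < h (al s)) ->
  S2 y -> 0 < gX y -> 0 < g y -> 0 < h y.
Proof.
move=> tr hal Sy gXy gy; have gbe := tie_pos tr hal.
have [og oh] := (line_or LA, line_or LB).
rewrite ltNge; apply/negP; rewrite le_eqVlt => /orP[/eqP hy|hy].
  by have [s s01 e] := line_cover LB Sy hy gXy; have := gbe s s01; rewrite -e; lra.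
pose O := [set z | S2 z /\ [/\ 0 < gX z, 0 < g z & h z < 0]].
suff : O = set0 by move/seteqP => [/(_ y) + _]; apply.
apply: (@infinite_frontier R O _ _ _ [set u t; - u t]) => //.
- by move=> z [].
- by move=> z [_ [gXz _ _]] [_ [+ _ _]]; rewrite (or_odd oX); lra.
- move=> z [Sz [gXz gz hz]].
  apply: filterS (filterI (or_open oX Sz gXz) (filterI (or_open og Sz gz) (oriented_neg_open oh Sz hz))).
  move=> w [k1 [k2 k3]] Sw.
  by split => //; split; [exact: k1|exact: k2|exact: k3].
move=> z Sz nOz nF.
have [gXn|gX0|gXe] := ltgtP (gX z) 0.
- apply: filterS (oriented_neg_open oX Sz gXn) => w k Sw [_ [k1 _ _]].
  by have := k Sw; lra.
- have [gn|g0|ge] := ltgtP (g z) 0.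
  + apply: filterS (oriented_neg_open og Sz gn) => w k Sw [_ [_ k1 _]].
    by have := k Sw; lra.
  + have [hn|h0|he] := ltgtP (h z) 0; first by case: nOz.
    * apply: filterS (or_open oh Sz h0) => w k Sw [_ [_ _ k1]].
      by have := k Sw; lra.
    * by have [s s01 e] := line_cover LB Sz he gX0; have := gbe s s01; rewrite -e; lra.
  + have [s s01 e] := line_cover LA Sz ge gX0; have := hal s s01; rewrite -e => h0.
    apply: filterS (or_open oh Sz h0) => w k Sw [_ [_ _ k1]].
    by have := k Sw; lra.
- have [gn|gn] := ltP (g z) 0.
    apply: filterS (oriented_neg_open og Sz gn) => w k Sw [_ [_ k1 _]].
    by have := k Sw; lra.
  have [h0|hn] := ltP 0 (h z).
    apply: filterS (or_open oh Sz h0) => w k Sw [_ [_ _ k1]].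
    by have := k Sw; lra.
  have Xz : X z by apply/(or_zero oX Sz).
  case: nF; have [s s01 [e|e]] := arcs_cover aX Xz; rewrite e in gn hn *.
    left; congr u; apply/eqP; rewrite eq_le (line_u_ge LA)// andbT.
    by rewrite tr (line_u_le LB).
  right; rewrite /= -(line_opp LA); congr u'; apply/eqP; rewrite eq_le (line_u'_ge LA)// andbT.
  have -> : t' = r'.
    by apply: (arcs_inj2 aX (le01 (line_t' LA)) (le01 (line_t' LB))); rewrite (line_opp LA) (line_opp LB) tr.
  by rewrite (line_u'_le LB).
Qed.

End Prec.

(** A fundamental domain for the antipode, up to o and -o: the positive side of X and the open arc u. *)
Definition half_domain (y : E) : Prop := 0 < gX y \/ exists2 s, 0 < s < 1 & y = u s.

Lemma half_domain_X y : half_domain y -> gX y = 0 -> exists2 s, 0 < s < 1 & y = u s.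
Proof. by move=> [h|//]; move=> k; rewrite k ltxx in h. Qed.

Section Three.
Variables (A B C : set E) (g h k : E -> R) (t t' r r' q q' : R) (al be ga : R -> E).
Hypotheses (LA : line A g t t' al) (LB : line B h r r' be) (LC : line C k q q' ga).
Hypotheses (AB : meet2 A B) (BC : meet2 B C) (AC : meet2 A C).

(** Three lines A, B, C in this order, whose crossing point w of A and B is weakly above C. Then no
    point of the domain is weakly below A, above B and below C, except possibly w. On each of
    the four curves the signs leave finitely many such points, so the open region has finite frontier. *)
Lemma weak_region_empty x1 x2 y1 y2 z1 z2 y : t <= r -> r <= q ->
  sign_change h al x1 -> sign_change k al x2 ->
  sign_change (fun y => - g y) be y1 -> sign_change k be y2 ->
  sign_change (fun y => - g y) ga z1 -> sign_change (fun y => - h y) ga z2 ->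
  0 <= k (al x1) ->
  S2 y -> half_domain y -> g y <= 0 -> 0 <= h y -> k y <= 0 ->
  [/\ g y = 0, h y = 0, k y = 0 & y = al x1].
Proof.
move=> tr rq X1 X2 Y1 Y2 Z1 Z2 kw.
have [og oh ok] := And3 (line_or LA) (line_or LB) (line_or LC).
have eAB : al x1 = be y1 by apply: (same_crossing LA LB AB); [left|right].
have eAC : al x2 = ga z1 by apply: (same_crossing LA LC AC); [left|right].
have [x101 hx1 _ _] := X1; have [x201 kx2 _ _] := X2.
have [y101 gy1 _ _] := Y1; have [y201 ky2 _ _] := Y2.
have [z101 gz1 _ _] := Z1; have [z201 hz2 _ _] := Z2.
have x21 : x2 <= x1 by exact: (sign_change_ge0 X2).
have y21 : y2 <= y1 by apply: (sign_change_ge0 Y2) => //; rewrite -eAB.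
have z21 : z2 <= z1.
  apply: (sign_change_ge0 Z2) => //; rewrite -eAC oppr_ge0.
  move: x21; rewrite le_eqVlt => /orP[/eqP->|x21]; first by rewrite hx1.
  by apply: ltW; case: X1 => _ _ + _; apply; lra.
have w0 (s : R) : 0 <= s < 1 -> 0 <= s <= 1 by lra.
(* the only candidates on the three curves are the crossing points, when they coincide *)
have onA z s : z = al s -> 0 <= s < 1 -> 0 <= h z -> k z <= 0 -> z = al x1 /\ x1 = x2.
  move=> -> s01 hs ks; have := sign_change_ge0 X1 s01 hs; have := sign_change_le0 X2 s01 ks.
  move=> h1 h2; have -> : s = x1 by lra.
  by split=> //; lra. 
have onB z s : z = be s -> 0 <= s < 1 -> g z <= 0 -> k z <= 0 -> z = be y1 /\ y1 = y2.
  move=> -> s01; rewrite -oppr_ge0 => gs ks.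
  have := sign_change_ge0 Y1 s01 gs; have := sign_change_le0 Y2 s01 ks.
  move=> h1 h2; have -> : s = y1 by lra.
  by split=> //; lra.
have onC z s : z = ga s -> 0 <= s < 1 -> g z <= 0 -> 0 <= h z -> z = ga z1 /\ z1 = z2.
  move=> -> s01; rewrite -(oppr_ge0 (g _)) -(oppr_le0 (h _)) => gs hs.
  have := sign_change_ge0 Z1 s01 gs; have := sign_change_le0 Z2 s01 hs.
  move=> h1 h2; have -> : s = z1 by lra.
  by split=> //; lra.
have lt01 (s : R) : 0 < s < 1 -> 0 <= s < 1 by lra.
have vB : y1 = y2 -> k (al x1) = 0 by rewrite eAB => ->.
have vC : z1 = z2 -> ga z1 = al x1 /\ k (al x1) = 0.
  move=> e; have hx2 : h (al x2) = 0.
    by rewrite eAC e; apply/eqP; rewrite -oppr_eq0 hz2.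
  have e2 : x2 = x1 by exact: (sign_change_eq0 X1).
  by rewrite -eAC e2; split => //; rewrite -{1}e2.
have fin z : z = al x1 -> k (al x1) = 0 -> [/\ g z = 0, h z = 0, k z = 0 & z = al x1].
  by move=> -> kz; split => //; exact: (line_zero LA (w0 _ x101)).
have zeroA z : S2 z -> 0 < gX z -> g z = 0 -> 0 <= h z -> k z <= 0 -> z = al x1 /\ k (al x1) = 0.
  move=> Sz gXz gz hz kz; have [s s01 e] := line_cover LA Sz gz gXz.
  by have [-> e12] := onA z s e (lt01 _ s01) hz kz; split => //; rewrite e12.
have zeroB z : S2 z -> 0 < gX z -> h z = 0 -> g z <= 0 -> k z <= 0 -> z = al x1 /\ k (al x1) = 0.
  move=> Sz gXz hz gz kz; have [s s01 e] := line_cover LB Sz hz gXz.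
  by have [-> e12] := onB z s e (lt01 _ s01) gz kz; rewrite eAB; split => //; rewrite -eAB vB.
have zeroC z : S2 z -> 0 < gX z -> k z = 0 -> g z <= 0 -> 0 <= h z -> z = al x1 /\ k (al x1) = 0.
  move=> Sz gXz kz gz hz; have [s s01 e] := line_cover LC Sz kz gXz.
  by have [-> e12] := onC z s e (lt01 _ s01) gz hz; exact: vC.
move=> Sy Dy gy hy ky.
have [gXn|gXp|gXe] := ltgtP (gX y) 0; first by case: Dy => [|[s s01 e]]; [lra|rewrite e gXu ?ltxx// in gXn; exact: le01].
- have [gn|gp|ge] := ltgtP (g y) 0; [|lra|by have [? ?] := zeroA y Sy gXp ge hy ky; exact: fin].
  have [hn|hp|he] := ltgtP (h y) 0; [lra| |by have [? ?] := zeroB y Sy gXp he gy ky; exact: fin].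
  have [kn|kp|ke] := ltgtP (k y) 0; [|lra|by have [? ?] := zeroC y Sy gXp ke gy hy; exact: fin].
  exfalso.
  pose O := [set z | S2 z /\ [/\ 0 < gX z, g z < 0, 0 < h z & k z < 0]].
  suff : O = set0 by move/seteqP => [/(_ y) + _]; apply.
  apply: (@infinite_frontier R O _ _ _ [set al x1; u t; - u r]) => //.
  + by move=> z [].
  + by move=> z [_ [gXz _ _ _]] [_ [+ _ _ _]]; rewrite (or_odd oX); lra.
  + move=> z [Sz [gXz gz hz kz]].
    apply: filterS (filterI (filterI (or_open oX Sz gXz) (oriented_neg_open og Sz gz))
      (filterI (or_open oh Sz hz) (oriented_neg_open ok Sz kz))).
    move=> w [[k1 k2] [k3 k4]] Sw.
    by split => //; split; [exact: k1|exact: k2|exact: k3|exact: k4].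
  move=> z Sz nOz nF.
  have [gXn|gXz] := ltP (gX z) 0.
    apply: filterS (oriented_neg_open oX Sz gXn) => w c Sw [_ [c1 _ _ _]].
    by have := c Sw; lra.
  have [gz|gz] := ltP 0 (g z).
    apply: filterS (or_open og Sz gz) => w c Sw [_ [_ c1 _ _]].
    by have := c Sw; lra.
  have [hz|hz] := ltP (h z) 0.
    apply: filterS (oriented_neg_open oh Sz hz) => w c Sw [_ [_ _ c1 _]].
    by have := c Sw; lra.
  have [kz|kz] := ltP 0 (k z).
    apply: filterS (or_open ok Sz kz) => w c Sw [_ [_ _ _ c1]].
    by have := c Sw; lra.
  exfalso; move: gXz; rewrite le_eqVlt => /orP[/eqP/esym gXz|gXz].
    have Xz : X z by apply/(or_zero oX Sz).
    apply: nF; have [s s01 [e|e]] := arcs_cover aX Xz; rewrite e in gz hz kz *.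
      left; right; congr u; have := line_u_le LA s01 gz; have := line_u_ge LB s01 hz.
      by move=> c1 c2; apply/eqP; rewrite eq_le c2 (le_trans tr c1).
    right; rewrite /= -(line_opp LB); congr u'.
    have := line_u'_ge LB s01 hz; have := line_u'_le LC s01 kz; have := opp_order LB LC rq.
    by move=> c1 c2 c3; apply/eqP; rewrite eq_le c3 (le_trans c2 c1).
  have [gzn|gzp|gze] := ltgtP (g z) 0; [|lra|].
    have [hzn|hzp|hze] := ltgtP (h z) 0; [lra| |].
      have [kzn|kzp|kze] := ltgtP (k z) 0; [|lra|].
        by apply: nOz.
      by apply: nF; left; left; case: (zeroC z Sz gXz kze gz hz).
    by apply: nF; left; left; case: (zeroB z Sz gXz hze gz kz).
  by apply: nF; left; left; case: (zeroA z Sz gXz gze hz kz).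
- have [s s01 e] := half_domain_X Dy gXe; rewrite e in gy hy ky *.
  have c1 := line_u_le LA (le01 s01) gy; have c2 := line_u_ge LB (le01 s01) hy.
  have es : s = t by apply/eqP; rewrite eq_le c1 (le_trans tr c2).
  have et : t = r by apply/eqP; rewrite eq_le tr -es c2.
  have x10 : 0 = x1.
    apply: (sign_change_eq0 X1); first by rewrite lexx ltr01.
    by rewrite (line_start LA) et (line_ut LB).
  have ea : u s = al x1 by rewrite -x10 (line_start LA) es.
  apply: fin => //; apply/eqP; rewrite eq_le kw andbT -ea; exact: ky.
Qed.

End Three.
End Ref.
End Lines.

(** * The order of the lines *)

Section Order.
Variable R : realType.
Notation E := 'rV[R]_3.
Notation S2 := (sphere (R := R)).

(** Reversing all orientations, together with the direction of X, preserves the axioms of lines and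
    reverses their order. *)
Section Mirror.
Variables (X : set E) (gX : E -> R) (o : E) (u u' : R -> E).
Let v s := u (1 - s).
Let v' s := u' (1 - s).

Lemma line_mirror A g t t' al : line X gX o u u' A g t t' al ->
  line X gX (- o) v v' A (fun y => - g y) (1 - t) (1 - t') al.
Proof.
move=> L; have [t01 t'01] := (line_t L, line_t' L).
have sub (s : R) : 1 - (1 - s) = s by lra.
have odd := or_odd (line_or L).
split; rewrite /v /v' ?sub.
- exact: oriented_opp (line_or L).
- by rewrite odd opprK; exact: line_o L.
- lra.
- lra.
- by rewrite (line_ut L) oppr0.
- by move=> s s01 st; rewrite oppr_lt0; apply: (line_gt L); lra.
- by move=> s s01 st; rewrite oppr_gt0; apply: (line_lt L); lra.
- by move=> s s01 st; rewrite oppr_lt0; apply: (line_gt' L); lra.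
- by move=> s s01 st; rewrite oppr_gt0; apply: (line_lt' L); lra.
- exact: line_opp L.
- exact: line_meet L.
- exact: line_arcs L.
- exact: line_pos L.
- by move=> y Sy /eqP; rewrite oppr_eq0 => /eqP gy gXy; have := line_cover L Sy gy gXy.
Qed.

Lemma half_domain_mirror y : half_domain gX u y -> half_domain gX v y.
Proof.
case=> [h|[s s01 ->]]; [by left|right; exists (1 - s); first lra].
by rewrite /v; congr u; lra.
Qed.
End Mirror.

Section Ref.
Variables (X : set E) (gX : E -> R) (o : E) (u u' : R -> E).
Hypotheses (oX : oriented X gX) (aX : arcs X o u u').
Local Notation line := (line X gX o u u').

Section Three.
Variables (A B C : set E) (g h k : E -> R) (t t' r r' q q' : R) (al be ga : R -> E).
Hypotheses (LA : line A g t t' al) (LB : line B h r r' be) (LC : line C k q q' ga).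
Hypotheses (AB : meet2 A B) (BC : meet2 B C) (AC : meet2 A C).

(** The triple condition for three lines. If the crossing point of A and B is weakly above
    C, b is constrained by [weak_region_empty]; if it is weakly below C, a is, by the mirror image of
    the same lemma. *)
Lemma no_alternation a b : prec h t r al -> prec k r q be -> prec k t q al ->
  S2 a -> half_domain gX u a -> 0 <= g a -> h a <= 0 -> 0 <= k a ->
  S2 b -> half_domain gX u b -> g b <= 0 -> 0 <= h b -> k b <= 0 ->
  g a = 0 /\ g b = 0.
Proof.
move=> pAB pBC pAC Sa Da ga0 ha ka Sb Db gb hb kb.
have [x1 X1] := prec_change_A oX aX LA LB AB pAB.
have [y1 Y1] := prec_change_B oX aX LA LB AB pAB.
have [x2 X2] := prec_change_A oX aX LA LC AC pAC.
have [z1 Z1] := prec_change_B oX aX LA LC AC pAC.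
have [y2 Y2] := prec_change_A oX aX LB LC BC pBC.
have [z2 Z2] := prec_change_B oX aX LB LC BC pBC.
have [tr rq] := (prec_le pAB, prec_le pBC).
have eAB : al x1 = be y1 by apply: (same_crossing oX aX LA LB AB); [left|right].
have eBC : be y2 = ga z2 by apply: (same_crossing oX aX LB LC BC); [left|right].
have x101 : 0 <= x1 < 1 by case: X1.
have [y101 y201] : 0 <= y1 < 1 /\ 0 <= y2 < 1 by case: Y1; case: Y2.
have [Q|P] := leP 0 (k (al x1)).
  have [gb0 hb0 kb0 eb] := weak_region_empty oX aX LA LB LC AB AC tr rq X1 X2 Y1 Y2 Z1 Z2 Q Sb Db gb hb kb.
  have kw : k (al x1) = 0 by rewrite -eb.
  have ky1 : k (be y1) = 0 by rewrite -eAB.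
  have e12 : y1 = y2 by exact: (sign_change_eq0 Y2).
  have gy2 : g (be y2) = 0.
    by case: Y1 => _ + _ _; rewrite -e12 => /eqP; rewrite oppr_eq0 => /eqP.
  split => //.
  have LA' := line_mirror LA; have LB' := line_mirror LB; have LC' := line_mirror LC.
  have := weak_region_empty oX (arcs_rev aX) LC' LB' LA' (meet2_sym BC) (meet2_sym AC) _ _
    Z2 Z1 (sign_change_oppK Y2) Y1 (sign_change_oppK X2) (sign_change_oppK X1) _ Sa
    (half_domain_mirror Da).
  rewrite !oppr_le0 !oppr_ge0 -eBC gy2 lexx => W.
  have [||_ _ ga1 _] := W _ _ isT ka ha ga0; [lra|lra|].
  by apply/eqP; rewrite -oppr_eq0 ga1.
have y12 : y1 < y2.
  rewrite ltNge; apply/negP => y21; have : 0 <= k (be y1).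
    move: y21; rewrite le_eqVlt => /orP[/eqP e|lt21]; first by rewrite -e; case: Y2 => _ ->.
    by apply: ltW; case: Y2 => _ _ _; apply; lra.
  by rewrite -eAB; lra.
have gy2 : g (be y2) < 0.
  by case: Y1 => _ _ _ /(_ y2); rewrite oppr_gt0; apply; lra.
have LA' := line_mirror LA; have LB' := line_mirror LB; have LC' := line_mirror LC.
have := weak_region_empty oX (arcs_rev aX) LC' LB' LA' (meet2_sym BC) (meet2_sym AC) _ _
  Z2 Z1 (sign_change_oppK Y2) Y1 (sign_change_oppK X2) (sign_change_oppK X1) _ Sa
  (half_domain_mirror Da).
rewrite !oppr_le0 !oppr_ge0 -eBC => W.
have [||_ _ ga1 ea] := W _ _ (ltW gy2) ka ha ga0; [lra|lra|].
by exfalso; move: gy2; rewrite -ea; lra.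
Qed.

Lemma prec_trans : prec h t r al -> prec k r q be -> prec k t q al.
Proof.
case=> [tr|[tr hal]]; case=> [rq|[rq kbe]]; try by left; lra.
right; split; first by rewrite tr.
move=> s s01; have s01' : 0 <= s <= 1 by lra.
apply: (tie_incl oX aX LB LC BC rq kbe (line_S LA s01') (line_pos LA s01)); exact: hal.
Qed.

End Three.

(** The triple condition when the last curve is X itself: b then lies on the arc u. *)
Lemma no_alternation_ref A B g h t t' r r' al be a b :
  line A g t t' al -> line B h r r' be -> meet2 A B -> prec h t r al ->
  S2 a -> 0 < gX a -> 0 <= g a -> h a <= 0 ->
  S2 b -> half_domain gX u b -> gX b <= 0 -> g b <= 0 -> 0 <= h b ->
  g a = 0 /\ g b = 0.
Proof.
move=> LA LB AB pAB Sa gXa ga ha Sb Db gXb gb hb.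
case: Db => [h0|[s s01 eb]]; first lra.
have s01' : 0 <= s <= 1 by lra.
have st : s <= t by apply: (line_u_le LA s01'); rewrite -eb.
have rs : r <= s by apply: (line_u_ge LB s01'); rewrite -eb.
have tr := prec_le pAB.
case: pAB => [|[e hal]]; first lra.
have es : s = t by lra.
split; last by rewrite eb es (line_ut LA).
apply/eqP; rewrite eq_le ga andbT leNgt; apply/negP => ga0.
by have := tie_incl oX aX LA LB AB e hal Sa gXa ga0; lra.
Qed.

End Ref.

(** Two sign functions of the same curve agree or are opposite. *)
Lemma oriented_unique A g G : oriented A g -> oriented A G ->
  (forall y, S2 y -> (0 < g y <-> 0 < G y)) \/ (forall y, S2 y -> (0 < g y <-> G y < 0)).
Proof.
move=> og oG.
have nz y : S2 y -> 0 < g y -> G y <> 0.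
  by move=> Sy gy /(or_zero oG Sy)/(or_zero og Sy); lra.
have key G' : oriented A G' -> forall y z, S2 y -> 0 < g y -> S2 z -> 0 < g z -> 0 < G' y -> 0 < G' z.
  move=> oG' y z Sy gy Sz gz Gy.
  apply: (@connected_const _ [set y | S2 y /\ 0 < g y] (fun y => 0 < G' y) y z) => //; first exact: or_conn og.
  move=> w [Sw gw]; have Gw0 : G' w <> 0 by move/(or_zero oG' Sw)/(or_zero og Sw); lra.
  have [Gn|Gp|//] := ltgtP (G' w) 0.
    apply: filterS (oriented_neg_open oG' Sw Gn) => w' k [Sw' _]; have := k Sw'.
    by split; lra.
  by apply: filterS (or_open oG' Sw Gp) => w' k [Sw' _]; have := k Sw'.
have conv (G' : E -> R) : oriented A G' -> (forall y, S2 y -> 0 < g y -> 0 < G' y) ->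
    forall y, S2 y -> 0 < G' y -> 0 < g y.
  move=> oG' h y Sy Gy; have [gn|//|ge] := ltgtP (g y) 0.
    have := h (- y) (sphereN Sy); rewrite (or_odd og) (or_odd oG') oppr_gt0 => /(_ gn); lra.
  by move: ge => /(or_zero og Sy)/(or_zero oG' Sy); lra.
have [[y [Sy gy]]|none] := pselect (exists y, S2 y /\ 0 < g y); last first.
  left=> y Sy; split => [gy|Gy]; first by case: none; exists y.
  have [gn|//|ge] := ltgtP (g y) 0; last by move: ge => /(or_zero og Sy)/(or_zero oG Sy); lra.
  by case: none; exists (- y); split; [exact: sphereN|rewrite (or_odd og) oppr_gt0].
have [Gn|Gp|Ge] := ltgtP (G y) 0; last by case: (nz y Sy gy).
  right=> z Sz; have oG' := oriented_opp oG; rewrite -oppr_gt0.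
  have h w : S2 w -> 0 < g w -> 0 < - G w.
    by move=> Sw gw; apply: (key _ oG' y w) => //; rewrite oppr_gt0.
  by split; [exact: h|exact: (conv _ oG' h)].
left=> z Sz.
have h w : S2 w -> 0 < g w -> 0 < G w by move=> Sw gw; exact: (key _ oG y w).
by split; [exact: h|exact: (conv _ oG h)].
Qed.

Section Half.
Variables (X : set E) (gX : E -> R) (o : E) (u u' : R -> E).
Hypotheses (oX : oriented X gX) (aX : arcs X o u u').
Variables (hs : seq (set E)) (bd : set E -> set E).
Hypothesis hs_or : forall H, H \in hs -> exists2 g, oriented (bd H) g & forall y, H y <-> S2 y /\ 0 < g y.
Hypothesis hs_meet : forall H1 H2, H1 \in hs -> H2 \in hs -> bd H1 <> bd H2 -> meet2 (bd H1) (bd H2).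
Hypothesis hs_X : forall H, H \in hs -> bd H <> X -> meet2 (bd H) X /\ ~ bd H o.

(** Polychromatic colouring of the points in the fundamental domain. The pseudohemispheres are listed
    in the order of their boundary curves, X coming last. Each of them is the set of points
    strictly above its curve, or the complement of the set of points weakly above it. *)
Lemma half_coloring (V : finType) (pt : V -> E) (U : {set V}) k :
  (forall v, S2 (pt v)) -> (forall v, v \in U <-> half_domain gX u (pt v)) ->
  exists c : V -> nat, forall H (L : {set V}), H \in hs -> (forall v, v \in L <-> H (pt v)) ->
    (2 * k - 1 <= #|U :&: L|)%N ->
    forall i, (i < k)%N -> exists2 v, v \in U :&: L & c v = i.
Proof.
move=> Spt UE.
(* for each curve other than X, a sign function with o on the negative side, and the data of [line] *)
have dat A : exists d : (E -> R) * (R * R * (R -> E)), (exists2 H, H \in hs & A = bd H) ->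
   (A = X -> d.1 = gX) /\ (A <> X -> line X gX o u u' A d.1 d.2.1.1 d.2.1.2 d.2.2).
  have [[H Hh AH]|no] := pselect (exists2 H, H \in hs & A = bd H); last first.
    by exists (gX, (0, 0, u)).
  have [AX|AX] := pselect (A = X); first by exists (gX, (0, 0, u)).
  have [g og _] := hs_or Hh; rewrite -AH in og.
  have [AX2 nAo] : meet2 A X /\ ~ A o by rewrite AH; apply: hs_X => //; rewrite -AH.
  have So : S2 o by apply: (or_sub oX); rewrite -(arcs_start1 aX); apply: (arcs_in1 aX); lra.
  have [G [oG Go]] : exists G, oriented A G /\ G o < 0.
    have [gn|gp|ge] := ltgtP (g o) 0; first by exists g.
      by exists (fun y => - g y); split; [exact: oriented_opp|rewrite oppr_lt0].
    by case: nAo; apply/(or_zero og So).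
  have [t [t' [al L]]] := line_exists oX aX oG AX2 Go.
  by exists (G, (t, t', al)).
have [D hD] := choice dat.
pose G A := (D A).1; pose T A := (D A).2.1.1; pose T' A := (D A).2.1.2; pose AL A := (D A).2.2.
have GX H : H \in hs -> bd H = X -> G (bd H) = gX by move=> Hh; case: (hD (bd H)) => //; exists H.
have GL H : H \in hs -> bd H <> X -> line X gX o u u' (bd H) (G (bd H)) (T (bd H)) (T' (bd H)) (AL (bd H)).
  by move=> Hh; case: (hD (bd H)) => //; exists H.
have oG H : H \in hs -> oriented (bd H) (G (bd H)).
  move=> Hh; have [e|ne] := pselect (bd H = X); first by rewrite GX// e.
  exact: line_or (GL H Hh ne).
pose prc A B := prec (G B) (T A) (T B) (AL A).
(* the total preorder used for sorting, with the sides of X last *)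
pose le (H1 H2 : set E) : bool := `[< bd H1 = bd H2 \/ bd H2 = X \/ (bd H1 <> X /\ bd H2 <> X /\ prc (bd H1) (bd H2)) >].
have le_tot : {in hs &, total le}.
  move=> H1 H2 h1 h2; apply/orP.
  have [e|ne] := pselect (bd H1 = bd H2); first by left; apply/asboolP; left.
  have [e1|ne1] := pselect (bd H1 = X); first by right; apply/asboolP; right; left.
  have [e2|ne2] := pselect (bd H2 = X); first by left; apply/asboolP; right; left.
  have [p|p] := prec_total oX aX (GL _ h1 ne1) (GL _ h2 ne2) (hs_meet h1 h2 ne).
    by left; apply/asboolP; right; right.
  by right; apply/asboolP; right; right.
have pasym H1 H2 : H1 \in hs -> H2 \in hs -> bd H1 <> bd H2 -> bd H1 <> X -> bd H2 <> X ->
    prc (bd H1) (bd H2) -> prc (bd H2) (bd H1) -> False.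
  move=> h1 h2 ne ne1 ne2 p q.
  exact: (prec_asym oX aX (GL _ h1 ne1) (GL _ h2 ne2) (hs_meet h1 h2 ne) p q).
have le_tr : {in hs & &, transitive le}.
  move=> H2 H1 H3 h2 h1 h3 /asboolP l12 /asboolP l23; apply/asboolP.
  have [e13|ne13] := pselect (bd H1 = bd H3); first by left.
  have [e3|ne3] := pselect (bd H3 = X); first by right; left.
  right; right.
  case: l23 => [e23|[//|[ne2 [_ p23]]]].
    case: l12 => [e12|[e2|h12]]; [by case: ne13; rewrite e12|by case: ne3; rewrite -e23|].
    by rewrite -e23.
  case: l12 => [e12|[//|[ne1 [_ p12]]]]; first by rewrite e12.
  have [e12|ne12] := pselect (bd H1 = bd H2); first by rewrite e12.
  have [e23|ne23] := pselect (bd H2 = bd H3); first by rewrite -e23.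
  split => //; split => //.
  exact: (prec_trans oX aX (GL _ h1 ne1) (GL _ h2 ne2) (GL _ h3 ne3) (hs_meet h2 h3 ne23) p12 p23).
pose pos (H : set E) : bool := `[< forall y, S2 y -> (H y <-> 0 < G (bd H) y) >].
(* points exactly on the curve count as above it when H is the lower side, so that H is the
   complement of L H in that case *)
pose L (H : set E) : {set V} := [set v | if pos H then 0 < G (bd H) (pt v) else 0 <= G (bd H) (pt v)]%SET.
have L_ge H v : v \in L H -> 0 <= G (bd H) (pt v) by rewrite inE; case: ifP => // _ /ltW.
have L_le H v : v \notin L H -> G (bd H) (pt v) <= 0.
  by rewrite inE; case: ifP => // _; [rewrite -leNgt|rewrite -ltNge => /ltW].
have L_ne H v w : v \in L H -> w \notin L H -> G (bd H) (pt v) = 0 -> G (bd H) (pt w) = 0 -> False.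
  by rewrite !inE; case: ifP => _; [move=> + _ e; rewrite e ltxx|move=> _ + _ e; rewrite e lexx].
pose hs' := sort le hs.
have shs : sorted le hs' by apply: (sort_sorted_in le_tot); apply/allP.
have memhs : hs' =i hs by move=> H; rewrite mem_sort.
have [c hc] : exists c : V -> nat, forall L0, L0 \in [seq L H | H <- hs'] ->
    ((2 * k - 1 <= #|U :&: L0|)%N ->
      forall i, (i < k)%N -> exists2 v, v \in U :&: L0 & c v = i) /\
    ((2 * k - 1 <= #|U :\: L0|)%N ->
      forall i, (i < k)%N -> exists2 v, v \in U :\: L0 & c v = i).
  apply: polychromatic_lines => i j l p q ij jl; rewrite size_map => ls pU qU.
  have js := ltn_trans jl ls; have is_ := ltn_trans ij js.
  rewrite !(nth_map set0)//.
  set H1 := nth _ _ i; set H2 := nth _ _ j; set H3 := nth _ _ l.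
  have h1 : H1 \in hs by rewrite -memhs mem_nth.
  have h2 : H2 \in hs by rewrite -memhs mem_nth.
  have h3 : H3 \in hs by rewrite -memhs mem_nth.
  have hom : forall a b, (a < b)%N -> (b < size hs')%N -> le (nth set0 hs' a) (nth set0 hs' b).
    move=> a b ab bs; apply: (sorted_ltn_nth_in le_tr) => //; last by rewrite inE (ltn_trans ab).
    by apply/allP => H; rewrite memhs.
  have /asboolP l12 : le H1 H2 by exact: hom.
  have /asboolP l23 : le H2 H3 by exact: hom.
  move=> p1 p2 p3 q1 q2 q3.
  have z1 := L_ne _ _ _ p1 q1; have z2 := L_ne _ _ _ q2 p2; have z3 := L_ne _ _ _ p3 q3.
  move: (L_ge _ _ p1) (L_le _ _ p2) (L_ge _ _ p3) (L_le _ _ q1) (L_ge _ _ q2) (L_le _ _ q3).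
  move=> P1 P2 P3 Q1 Q2 Q3.
  have [Sp Sq] := (Spt p, Spt q).
  have [/UE Dp /UE Dq] := (pU, qU).
  have [e12|ne12] := pselect (bd H1 = bd H2).
    by apply: z1; rewrite e12 in P1 Q1 *; lra.
  have [e23|ne23] := pselect (bd H2 = bd H3).
    by apply: z2; rewrite e23 in P2 Q2 *; lra.
  case: l12 => [//|[e2|[ne1 [ne2 p12]]]].
    by case: l23 => [//|[e3|[//]]]; case: ne23; rewrite e2 e3.
  case: l23 => [//|[e3|[_ [ne3 p23]]]].
    rewrite (GX _ h3 e3) in P3 Q3 z3.
    have gXq : gX (pt q) = 0.
      by case: Dq => [gXq|[s s01 e]]; [lra|apply/(or_zero oX Sq); rewrite e; apply: (arcs_in1 aX); lra].
    have gXp : 0 < gX (pt p) by rewrite lt_def P3 andbT; apply/eqP => e; exact: z3.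
    have [] := no_alternation_ref oX aX (GL _ h1 ne1) (GL _ h2 ne2) (hs_meet h1 h2 ne12) p12
      Sp gXp P1 P2 Sq Dq Q3 Q1 Q2.
    exact: z1.
  have [e13|ne13] := pselect (bd H1 = bd H3).
    by apply: (pasym _ _ h1 h2 ne12 ne1 ne2 p12); rewrite e13.
  have p13 := prec_trans oX aX (GL _ h1 ne1) (GL _ h2 ne2) (GL _ h3 ne3) (hs_meet h2 h3 ne23) p12 p23.
  have [] := no_alternation oX aX (GL _ h1 ne1) (GL _ h2 ne2) (GL _ h3 ne3)
    (hs_meet h1 h2 ne12) (hs_meet h2 h3 ne23) (hs_meet h1 h3 ne13) p12 p23 p13
    Sp Dp P1 P2 P3 Sq Dq Q1 Q2 Q3.
  exact: z1.
exists c => H L0 Hh L0E.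
have [hc1 hc2] := hc (L H) (map_f _ (etrans (memhs H) Hh)).
have [g og HE] := hs_or Hh.
have [posH|nposH] := boolP (pos H).
  suff -> : U :&: L0 = U :&: L H by exact: hc1.
  apply/setP => v; rewrite !finset.in_setI; congr (_ && _); apply/idP/idP.
    by rewrite inE posH => /L0E; move/asboolP: posH => h /h; apply; exact: Spt.
  by rewrite inE posH => h; apply/L0E; move/asboolP: posH => h'; apply/h'.
have neg y : S2 y -> (H y <-> G (bd H) y < 0).
  move=> Sy; case: (oriented_unique og (oG _ Hh)) => h; last first.
    by rewrite HE -h//; split=> [[]|].
  case/asboolP: nposH => z Sz; rewrite HE -h//; split=> [[]|] //.
suff -> : U :&: L0 = U :\: L H by exact: hc2.
apply/setP => v; rewrite !finset.in_setI finset.in_setD andbC; congr (_ && _); apply/idP/idP.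
  by rewrite inE (negbTE nposH) -ltNge => /L0E /neg; apply; exact: Spt.
by rewrite inE (negbTE nposH) -ltNge => h; apply/L0E/neg.
Qed.

End Half.
End Order.

(** * Polychromatic colourings *)

Section Final.
Variable R : realType.
Notation E := 'rV[R]_3.
Notation S2 := (sphere (R := R)).

Lemma card_trace (P : {fset E}) (H : set E) n : `I_n #<= H `&` [set` P] ->
  (n <= #|[set v : P | `[< H (val v) >]]%SET|)%N.
Proof.
move=> /pcard_leP[f].
have fI (i : 'I_n) : (H `&` [set` P]) (f i) by apply: funS => /=.
have fP (i : 'I_n) : f i \in P by case: (fI i).
pose F (i : 'I_n) : P := FSetSub (fP i).
have Finj : injective F.
  move=> i j /(congr1 val) /= e; apply/val_inj => /=.
  by apply: (@inj _ _ _ f) => //; apply: mem_set => /=.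
rewrite -{1}[n]card_ord -(card_imset _ Finj); apply/subset_leq_card/fintype.subsetP => v.
by case/imsetP => i _ ->; rewrite inE; apply/asboolP; case: (fI i).
Qed.

Lemma sides_disjoint (C H1 H2 : set E) y : side C H1 -> side C H2 -> H1 y -> H2 y -> H1 = H2.
Proof.
move=> [x1 _ ->] [x2 _ ->] h1 h2.
by rewrite (same_connected_component h1) (same_connected_component h2).
Qed.

Lemma curve_infinite (C F : set E) : simple_closed_curve C -> finite_set F -> exists2 o, C o & ~ F o.
Proof.
move=> [f [cf f01 inj CE]] finF; apply: contrapT => no.
pose w (n : nat) := f (n.+2%:R^-1).
have w01 (n : nat) : 0 <= (n.+2%:R^-1 : R) < 1.
  rewrite invr_ge0 ler0n/= invf_lt1 ?ltr0n//.
  by rewrite (_ : 1 = 1%:R)// ltr_nat.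
have winj : injective w.
  by move=> a b /(inj _ _ (w01 a) (w01 b)) /invr_inj/eqP; rewrite eqr_nat => /eqP[].
apply: infinite_nat; have -> : [set: nat] = w @^-1` F.
  apply/seteqP; split=> // n _; apply: contrapT => nF; apply: no; exists (w n) => //.
  by rewrite CE; exists (n.+2%:R^-1) => //=; rewrite in_itv/=; have /andP[-> /ltW ->] := w01 n.
by apply: finite_preimage => // a b _ _; exact: winj.
Qed.

(** If at least two curves occur, X is one of them, and o is a point of X on no other curve and not
    in S nor antipodal to a point of S. The points of S in the fundamental domain of X and o are coloured
    by [half_coloring], the remaining ones by the same lemma for the opposite orientation. *)
Lemma polychromatic_arrangement k (S : set E) (HH : set (set E)) : (1 <= k)%N ->
  finite_set S -> S `<=` S2 -> pseudohemisphere_arrangement HH ->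
  exists c : E -> 'I_k,
    forall H, HH H -> `I_(4 * k - 3) #<= H `&` S ->
      forall i : 'I_k, exists2 p, (H `&` S) p & c p = i.
Proof.
case: k => // k _ /finite_fsetP[P ->] SS [finHH [bd [hbd hmeet]]].
have [hs0 HHE] := (finite_seqP _).1 finHH.
pose hs := undup hs0.
have memhs H : H \in hs <-> HH H by rewrite mem_undup HHE.
pose V : finType := P.
pose pt (v : V) : E := val v.
have Spt v : S2 (pt v) by apply: SS; exact: (valP v).
pose T (H : set E) : {set V} := [set v : V | `[< H (pt v) >]]%SET.
have TE H v : v \in T H <-> H (pt v) by rewrite inE; split => [/asboolP|h]//; exact/asboolP.
suff [c hc] : exists c : V -> nat, forall H, H \in hs -> (4 * k.+1 - 3 <= #|T H|)%N ->
    forall i, (i < k.+1)%N -> exists2 v, v \in T H & c v = i.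
  exists (fun p => if insub p is Some v then inord (c v) else ord0) => H HHH cH i.
  have [|v vH vi] := hc H _ (card_trace cH) i (ltn_ord i); first exact/memhs.
  exists (pt v); first by split; [exact/TE|exact: (valP v)].
  by rewrite /pt valK; apply/val_inj; rewrite /= vi inordK.
have [[H0 [H1 [h0 h1 ne]]]|same] := pselect (exists H0 H1, [/\ HH H0, HH H1 & bd H0 <> bd H1]);
  last first.
  (* all the pseudohemispheres are sides of one curve, hence disjoint: there is nothing to order *)
  have bdE H H' : HH H -> HH H' -> bd H = bd H'.
    by move=> h h'; apply: contrapT => ne; apply: same; exists H, H'.
  have [c hc] : exists c : V -> nat, forall L, L \in [seq T H | H <- hs] ->
    ((2 * k.+1 - 1 <= #|finset.setT :&: L|)%N ->
      forall i, (i < k.+1)%N -> exists2 v, v \in finset.setT :&: L & c v = i) /\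
    ((2 * k.+1 - 1 <= #|finset.setT :\: L|)%N ->
      forall i, (i < k.+1)%N -> exists2 v, v \in finset.setT :\: L & c v = i).
    apply: polychromatic_lines => i j l p q ij jl; rewrite size_map => ls _ _.
    have js := ltn_trans jl ls; have is_ := ltn_trans ij js.
    rewrite !(nth_map set0)// => /TE pi pj /TE pl _ _ _.
    have hi : HH (nth set0 hs i) by apply/memhs; exact: mem_nth.
    have hl : HH (nth set0 hs l) by apply/memhs; exact: mem_nth.
    have [_ _ _ si] := hbd _ hi; have [_ _ _ sl] := hbd _ hl.
    rewrite (bdE _ _ hl hi) in sl.
    have /eqP := sides_disjoint si sl pi pl.
    rewrite nth_uniq ?undup_uniq// => /eqP il.
    by have := ltn_trans ij jl; rewrite il ltnn.
  exists c => H Hh cH i ik.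
  have [hT _] := hc (T H) (map_f _ Hh).
  have [|v] := hT _ i ik; first by rewrite finset.setTI; lia.
  by rewrite finset.setTI => vT vi; exists v.
pose X := bd H0.
have curve H : HH H -> [/\ bd H `<=` S2, centrally_symmetric (bd H), simple_closed_curve (bd H) & side (bd H) H].
  by move=> /hbd[? ? ? ?].
have hs_or H : H \in hs -> exists2 g, oriented (bd H) g & forall y, H y <-> S2 y /\ 0 < g y.
  move=> /memhs Hh; have [c1 c2 c3 c4] := curve _ Hh.
  have [B [Bh Bne]] : exists B, HH B /\ bd H <> bd B.
    have [e|n] := pselect (bd H = bd H0); last by exists H0.
    by exists H1; rewrite e.
  have [b1 b2 b3 _] := curve _ Bh.
  exact: (side_oriented c1 c2 c3 b1 b2 b3 (hmeet _ _ Hh Bh Bne) c4).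
have H0h : H0 \in hs by exact/memhs.
have [gX oX _] := hs_or _ H0h.
have [ o Xo noF] : exists2 o, X o & ~ ([set` P] `|` -%R @` [set` P] `|`
    \bigcup_(H in HH `&` [set H | bd H <> X]) (bd H `&` X)) o.
  have [_ _ c3 _] := curve _ h0; apply: curve_infinite => //.
  rewrite !finite_setU; split; first by split; [exact: finite_fset|apply: finite_image; exact: finite_fset].
  apply: bigcup_finite; first by apply: sub_finite_set finHH => H [].
  by move=> H [Hh Hne]; have [p [q [_ ->]]] := hmeet _ _ Hh h0 Hne; exact: finite_set2.
have onP : o \notin P by apply/negP => h; apply: noF; left; left.
have NonP : - o \notin P.
  by apply/negP => h; apply: noF; left; right; exists (- o) => //; rewrite opprK.
have nbo H : HH H -> bd H <> X -> ~ bd H o.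
  by move=> Hh Hne Ho; apply: noF; right; exists H.
have [cX1 cX2 cX3 _] := curve _ h0.
have [u [u' aX]] := arcs_exist cX1 cX2 cX3 Xo.
have hs_meet H H' : H \in hs -> H' \in hs -> bd H <> bd H' -> meet2 (bd H) (bd H').
  by move=> /memhs Hh /memhs Hh'; exact: hmeet.
pose U : {set V} := [set v | `[< half_domain gX u (pt v) >]]%SET.
have UE v : v \in U <-> half_domain gX u (pt v) by rewrite inE; split => [/asboolP|h]//; exact/asboolP.
have [c0 hc0] := @half_coloring R X gX o u u' oX aX hs bd hs_or hs_meet
  (fun H Hh ne => conj (hs_meet H H0 Hh H0h ne) (nbo H ((memhs H).1 Hh) ne)) V pt U k.+1 Spt UE.
pose v1 s := u' (1 - s).
have aX' := arcs_rev (arcs_sym aX).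
(* outside the domain of X, gX, u lies the domain of the opposite orientation: o and -o are not in S *)
have NU v : v \in ~: U <-> half_domain (fun y => - gX y) v1 (pt v).
  rewrite inE; split.
    move=> /negP nU; have {}nU : ~ half_domain gX u (pt v) by move=> h; apply: nU; exact/UE.
    have [gn|gp|ge] := ltgtP (gX (pt v)) 0; first by left; rewrite oppr_gt0.
      by case: nU; left.
    have Xv : X (pt v) by apply/(or_zero oX (Spt v)).
    have [s s01 es] := arcs_cover aX Xv.
    have s0 : s != 0.
      apply: contraNneq onP => s0; have <- : pt v = o; last exact: (valP v).
      by case: es => ->; rewrite s0 ?(arcs_start1 aX) ?(arcs_start2 aX).
    have s1 : s != 1.
      apply: contraNneq NonP => s1; have <- : pt v = - o; last exact: (valP v).
      by case: es => ->; rewrite s1 ?(arcs_end1 aX) ?(arcs_end2 aX).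
    have s01' : 0 < s < 1 by rewrite !lt_neqAle eq_sym s0 s1.
    case: es => es; first by case: nU; right; exists s.
    by right; exists (1 - s); [lra|rewrite /v1 es; congr u'; lra].
  move=> h; apply/negP => /UE h'.
  have zero s : 0 < s < 1 -> gX (u s) = 0 /\ gX (u' s) = 0.
    move=> s01; have s01' : 0 <= s <= 1 by lra.
    have i1 := arcs_in1 aX s01'; have i2 := arcs_in2 aX s01'.
    by split; apply/(or_zero oX (cX1 _ _)).
  case: h => [h|[s s01 es]]; case: h' => [h'|[s' s01' es']].
  - by move: h; rewrite oppr_gt0; lra.
  - by have [e _] := zero s' s01'; move: h; rewrite es' e oppr0 ltxx.
  - have s2 : 0 < 1 - s < 1 by lra.
    by have [_ e] := zero _ s2; move: h'; rewrite es /v1 e ltxx.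
  - apply: (arcs_disj1 aX s01' (t := 1 - s)); first lra.
    by rewrite -es' es.
have hXN H : H \in hs -> bd H <> X -> meet2 (bd H) X /\ ~ bd H (- o).
  move=> Hh neX; split; first exact: hs_meet.
  move=> bo; apply: (nbo H) => //; first exact/memhs.
  have [_ c2 _ _] := curve H ((memhs H).1 Hh).
  by rewrite -(opprK o); exact: c2.
have [c1 hc1] := @half_coloring R X (fun y => - gX y) (- o) v1 (fun s => u (1 - s))
  (oriented_opp oX) aX' hs bd hs_or hs_meet hXN V pt (~: U) k.+1 Spt NU.
exists (fun v => if v \in U then c0 v else c1 v) => H Hh cH.
apply: (@glue_colorings V U (T H) c0 c1 k.+1) => //.
- by rewrite finset.setIC; exact: (hc0 H (T H) Hh (TE H)).
- by rewrite finset.setDE finset.setIC; exact: (hc1 H (T H) Hh (TE H)).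
Qed.

End Final.

Theorem corollary4p5 (k : nat) (hk : (1 <= k)%N) :
  (forall (R : realType) (S : set 'rV[R]_3) (HH : set (set 'rV[R]_3)),
      finite_set S -> S `<=` sphere (R := R) ->
      pseudohemisphere_arrangement HH ->
      exists c : 'rV[R]_3 -> 'I_k,
        forall H, HH H -> `I_(4 * k - 3) #<= H `&` S ->
          forall i : 'I_k, exists2 p, (H `&` S) p & c p = i)
  /\
  (forall (d : Order.disp_t) (V : finOrderType d) (E : {set {set V}}),
      pseudohemisphere_hypergraph E ->
      exists c : V -> 'I_k,
        forall A : {set V}, A \in E -> (4 * k - 3 <= #|A|)%N ->
          forall i : 'I_k, exists2 v, v \in A & c v = i).
Proof.
split=> [R S HH|d V E]; first exact: polychromatic_arrangement.
exact: polychromatic_pseudohemisphere_hypergraph.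
Qed.
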